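(* The map $\alpha\mapsto X_0(\alpha)$, where $X_0(\alpha)\in\mathbb{C}[p_1,p_2,\dots]$ is the coefficient of $N^0$ in the prechromatic invariant $X(\alpha)$ of a permutation $\alpha\in\mathbb{S}_m$ ($m\ge 0$), extends by linearity to a filtered Hopf algebra homomorphism $X_0:\mathcal{A}\to\mathbb{C}[p_1,p_2,\dots]$ from the rotational Hopf algebra of permutations $\mathcal{A}$ to the Hopf algebra of polynomials in infinitely many variables.
   Context: **The weight system $w_{\mathfrak{gl}}$.** For $\alpha\in\mathbb{S}_m$ (the symmetric group on $\{1,\dots,m\}$) and $N\ge1$ let $w_{\mathfrak{gl}(N)}(\alpha)=\sum_{i_1,\dots,i_m=1}^N E_{i_1,i_{\alpha(1)}}\cdots E_{i_m,i_{\alpha(m)}}\in U\mathfrak{gl}(N)$, where $E_{i,j}$ are the matrix units; put $C_m=w_{\mathfrak{gl}(N)}((1,2,\dots,m))$, with $(1,2,\dots,m)$ the standard cycle $1\mapsto2\mapsto\dots\mapsto m\mapsto1$. Then $w_{\mathfrak{gl}}(\alpha)\in\mathbb{C}[N,C_1,C_2,\dots]$ is the unique polynomial which specializes to $w_{\mathfrak{gl}(N)}(\alpha)$ for every positive integer $N$ (with $C_k$ replaced by the element $w_{\mathfrak{gl}(N)}((1,2,\dots,k))\in U\mathfrak{gl}(N)$, $k=1,2,\dots$). Equivalently (a known theorem of Zhuoke Yang), $w_{\mathfrak{gl}}$ is the unique function on permutations with the following properties: it equals $1$ on the empty permutation; it is invariant under conjugation by the standard long cycle; it is multiplicative for concatenation;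 it takes value $C_m$ on the standard $m$-cycle; and for $1\le\ell<m$, with $\tau=(\ell\ \ell{+}1)$ and $\alpha'=\tau\alpha\tau$: (i) if $\alpha(\ell)\ne\ell+1$ and $\alpha(\ell+1)\neq\ell$, then $w_{\mathfrak{gl}}(\alpha)=w_{\mathfrak{gl}}(\alpha')+w_{\mathfrak{gl}}(\beta_1)-w_{\mathfrak{gl}}(\beta_2)$, where $\beta_1$, $\beta_2$ are the restrictions (defined below) of $\alpha\circ\tau$ ($\tau$ applied first) to $\{1,\dots,m\}\setminus\{\ell+1\}$ and $\{1,\dots,m\}\setminus\{\ell\}$ respectively; (ii) if $\alpha(\ell+1)=\ell$ and $\alpha(\ell)\ne\ell+1$, then $w_{\mathfrak{gl}}(\alpha)=w_{\mathfrak{gl}}(\alpha')+C_1 w_{\mathfrak{gl}}(\alpha|_{\{1,\dots,m\}\setminus\{\ell,\ell+1\}})-N w_{\mathfrak{gl}}(\alpha|_{\{1,\dots,m\}\setminus\{\ell\}})$. **Restriction.** For $U\subset\{1,\dots,m\}$, $\alpha|_U\in\mathbb{S}_{|U|}$ is obtained by deleting from the disjoint cycles of $\alpha$ all elements not in $U$ (keeping the cyclic order of the remaining ones in each cycle) and renumbering $U$ increasingly by $1,\dots,|U|$. $V(\alpha)$ is the set of disjoint cycles of $\alpha$ (fixed points included), $c(\alpha)=|V(\alpha)|$; for $I\subset V(\alpha)$, $\alpha|_I$ is the restriction of $\alpha$ to the set of elements contained in the cycles from $I$. **Prechromatic invariant.** $X(\alpha)=N^{c(\alpha)-m}\,w_{\mathfrak{gl}}(\alpha)|_{C_k:=p_kN^{k-1},\,k=1,2,\dots}$.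 It is a polynomial in $N^{-2},p_1,p_2,\dots$, written $X(\alpha)=X_0(\alpha)+N^{-2}X_1(\alpha)+N^{-4}X_2(\alpha)+\dots$ with $X_k(\alpha)\in\mathbb{C}[p_1,p_2,\dots]$. **The Hopf algebra $\mathcal{A}$.** The concatenation $\alpha_1\#\alpha_2\in\mathbb{S}_{m_1+m_2}$ of $\alpha_1\in\mathbb{S}_{m_1}$, $\alpha_2\in\mathbb{S}_{m_2}$ acts as $\alpha_1$ on $\{1,\dots,m_1\}$ and as the shifted $\alpha_2$ on $\{m_1+1,\dots,m_1+m_2\}$. Consider the equivalence relation on permutations generated by: $\alpha\sim\sigma^{-1}\alpha\sigma$ with $\sigma=(1,2,\dots,m)$, $\alpha\in\mathbb{S}_m$; and $\alpha_1\#\alpha_2\sim\alpha_1'\#\alpha_2'$ whenever $\alpha_i'$ is (cyclically) equivalent to $\alpha_i$, $i=1,2$. Let $\mathcal{A}_m$ be the $\mathbb{C}$-vector space freely spanned by the equivalence classes $[\alpha]$, $\alpha\in\mathbb{S}_m$, and $\mathcal{A}=\bigoplus_{m\ge0}\mathcal{A}_m$. With multiplication induced by $\#$ and comultiplication $\mu([\alpha])=\sum_{I\sqcup J=V(\alpha)}[\alpha|_I]\otimes[\alpha|_J]$ (sum over ordered partitions of $V(\alpha)$ into two disjoint subsets), $\mathcal{A}$ is a graded connected commutative cocommutative Hopf algebra, filtered by the subspaces $\mathcal{A}_0\oplus\dots\oplus\mathcal{A}_m$. **The target.** $\mathbb{C}[p_1,p_2,\dots]$ has the usual multiplication and the comultiplication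 determined by $p_m\mapsto 1\otimes p_m+p_m\otimes1$; it is filtered by weighted degree, where $p_m$ has degree $m$. A homomorphism is filtered if it maps the $m$-th term of the filtration to the $m$-th term for all $m$. *)

(* Defs.v *)
From HB Require Import structures.
From mathcomp Require Import all_boot all_order all_fingroup all_algebra.
From mathcomp Require Import finmap monalg complex.
From mathcomp Require Import boolp reals.
From mathcomp Require classical_sets.

Set Implicit Arguments.
Unset Strict Implicit.
Unset Printing Implicit Defensive.

Import GRing.Theory.
Local Open Scope quotient_scope.
Local Open Scope ring_scope.

(* Indices start at 0: i : 'I_m stands for the element i + 1 of {1, ..., m}, and
   the variable k of {malg K[{cmonom nat}]} stands for C_{k+1} or p_{k+1}. *)

Definition anyperm : Type := {m : nat & 'S_m}.
HB.instance Definition _ := Choice.on anyperm.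

Definition mkperm m (a : 'S_m) : anyperm := Tagged (fun m => 'S_m) a.

Definition std_cycle m : 'S_m := perm (@ordS_inj m).

Definition concat_fun m1 m2 (a : 'S_m1) (b : 'S_m2) (i : 'I_(m1 + m2)) :
    'I_(m1 + m2) :=
  unsplit (match split i with inl j => inl (a j) | inr j => inr (b j) end).

Lemma concat_fun_inj m1 m2 (a : 'S_m1) (b : 'S_m2) :
  injective (concat_fun a b).
Proof.
move=> i j /(can_inj unsplitK).
move=> h; apply: (can_inj splitK); move: h.
by case: (split i) => u; case: (split j) => v // [] /perm_inj ->.
Qed.

Definition concat m1 m2 (a : 'S_m1) (b : 'S_m2) : 'S_(m1 + m2) :=
  perm (@concat_fun_inj m1 m2 a b).

Definition pconcat (a b : anyperm) : anyperm :=
  mkperm (concat (tagged a) (tagged b)).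

(* [fingraph.orbit a x] lists the cycle of x as x, a x, a (a x), ...; [next] moves
   along the cyclic sequence left when the elements outside U are deleted. *)
Definition restr_fun m (a : 'S_m) (U : {set 'I_m}) (x : 'I_m) : 'I_m :=
  next [seq y <- fingraph.orbit a x | y \in U] x.

Lemma restr_fun_in m (a : 'S_m) (U : {set 'I_m}) x :
  x \in U -> restr_fun a U x \in [seq y <- fingraph.orbit a x | y \in U].
Proof. by move=> xU; rewrite mem_next mem_filter xU in_orbit. Qed.

Lemma filter_rot_ex (T : eqType) (p : pred T) n (s : seq T) :
  exists k, filter p (rot n s) = rot k (filter p s).
Proof.
exists (size (filter p (take n s))).
have e : filter p s = filter p (take n s) ++ filter p (drop n s).
  by rewrite -filter_cat cat_take_drop.
by rewrite /rot filter_cat e drop_size_cat // take_size_cat.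
Qed.

Lemma restr_fun_inj m (a : 'S_m) (U : {set 'I_m}) :
  {in U &, injective (restr_fun a U)}.
Proof.
move=> x y xU yU eqxy.
have := restr_fun_in a xU; have := restr_fun_in a yU.
rewrite -eqxy !mem_filter => /andP[_ zy] /andP[_ zx].
have yx : y \in fingraph.orbit a x.
  move: zx zy; rewrite -!fconnect_orbit => zx zy.
  apply: (connect_trans zx); rewrite fconnect_sym //; exact: perm_inj.
have ux : uniq (fingraph.orbit a x) by apply: orbit_uniq; exact: perm_inj.
have [|k ok] := @orbit_rot_cycle _ a (fingraph.orbit a x) _ ux y yx.
  by apply: cycle_orbit; exact: perm_inj.
have [l fl] := filter_rot_ex (mem U) k (fingraph.orbit a x).
move: eqxy; rewrite /restr_fun ok fl next_rot ?filter_uniq // => eqxy.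
by rewrite -[x](prev_next (filter_uniq (mem U) ux)) eqxy prev_next ?filter_uniq.
Qed.

Lemma restr_fun_stable m (a : 'S_m) (U : {set 'I_m}) x :
  x \in U -> restr_fun a U x \in U.
Proof. by move/(restr_fun_in a); rewrite mem_filter => /andP[]. Qed.

(* [enum_val] and [enum_rank_in] renumber U increasingly. *)
Definition restr_ord m (a : 'S_m) (U : {set 'I_m}) (i : 'I_#|U|) : 'I_#|U| :=
  enum_rank_in (enum_valP i) (restr_fun a U (enum_val i)).

Lemma restr_ord_inj m (a : 'S_m) (U : {set 'I_m}) : injective (@restr_ord m a U).
Proof.
move=> i j /(congr1 enum_val); rewrite /restr_ord.
rewrite !enum_rankK_in ?restr_fun_stable ?enum_valP //.
by move/(restr_fun_inj (enum_valP i) (enum_valP j))/enum_val_inj.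
Qed.

Definition restr m (a : 'S_m) (U : {set 'I_m}) : 'S_#|U| :=
  perm (@restr_ord_inj m a U).

Inductive rot_equiv : anyperm -> anyperm -> Prop :=
| rot_refl a : rot_equiv a a
| rot_sym a b : rot_equiv a b -> rot_equiv b a
| rot_trans a b c : rot_equiv a b -> rot_equiv b c -> rot_equiv a c
| rot_conj m (a : 'S_m) : rot_equiv (mkperm a) (mkperm (a ^ std_cycle m)%g)
| rot_concat a a' b b' : rot_equiv a a' -> rot_equiv b b' ->
    rot_equiv (pconcat a b) (pconcat a' b').

Definition rot_equivb (a b : anyperm) : bool := `[< rot_equiv a b >].

Lemma rot_equivb_refl : reflexive rot_equivb.
Proof. by move=> a; apply/asboolP/rot_refl. Qed.

Lemma rot_equivb_sym : symmetric rot_equivb.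
Proof. by move=> a b; apply/asboolP/asboolP => /rot_sym. Qed.

Lemma rot_equivb_trans : transitive rot_equivb.
Proof.
by move=> b a c /asboolP ab /asboolP bc; apply/asboolP/(rot_trans ab bc).
Qed.

Canonical rot_equivb_equiv :=
  EquivRel rot_equivb rot_equivb_refl rot_equivb_sym rot_equivb_trans.

Definition rot_class := {eq_quot rot_equivb}.
HB.instance Definition _ := Choice.on rot_class.
HB.instance Definition _ := EqQuotient.on rot_class.

Definition pclass (a : anyperm) : rot_class := \pi_rot_class a.
Definition cls m (a : 'S_m) : rot_class := pclass (mkperm a).

Lemma pclassP a b : reflect (rot_equiv a b) (pclass a == pclass b).
Proof. by rewrite piE; apply: asboolP. Qed.

Lemma rot_equiv_size a b : rot_equiv a b -> tag a = tag b.
Proof.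
by elim=> // [a' b' c' _ -> _ ->|a' a'' b' b'' _ /= -> _ ->].
Qed.

Lemma pclass_repr a : rot_equiv (generic_quotient.repr (pclass a)) a.
Proof. by apply/pclassP; rewrite /pclass reprK. Qed.

Definition class_size (x : rot_class) : nat := tag (generic_quotient.repr x).

Lemma class_sizeE m (a : 'S_m) : class_size (cls a) = m.
Proof. exact: rot_equiv_size (pclass_repr _). Qed.

Definition class_mul (x y : rot_class) : rot_class :=
  pclass (pconcat (generic_quotient.repr x) (generic_quotient.repr y)).
Definition class_one : rot_class := cls (1%g : 'S_0).

Lemma class_mulE a b : class_mul (pclass a) (pclass b) = pclass (pconcat a b).
Proof. by apply/eqP/pclassP/rot_concat; apply: pclass_repr. Qed.

Lemma anypermP (a b : anyperm) : tag a = tag b ->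
  (forall (i : 'I_(tag a)) (j : 'I_(tag b)),
     i = j :> nat -> tagged a i = tagged b j :> nat) ->
  a = b.
Proof.
case: a b => m a [n b] /= mn; case: n / mn b => b eqab.
by congr Tagged; apply/permP => i; apply: val_inj; apply: eqab.
Qed.

Lemma concat_lshift m1 m2 (a : 'S_m1) (b : 'S_m2) i :
  concat a b (lshift m2 i) = lshift m2 (a i).
Proof. by rewrite permE /concat_fun (unsplitK (inl i)). Qed.

Lemma concat_rshift m1 m2 (a : 'S_m1) (b : 'S_m2) i :
  concat a b (rshift m1 i) = rshift m1 (b i).
Proof. by rewrite permE /concat_fun (unsplitK (inr i)). Qed.

Lemma pconcatA : associative pconcat.
Proof.
move=> [m1 a] [m2 b] [m3 c]; apply: anypermP => /=; first by rewrite addnA.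
move=> i j ij.
case: (split_ordP i) ij => [u ->|k ->] /= ij.
  have -> : j = lshift m3 (lshift m2 u) by apply: val_inj; rewrite /= -ij.
  by rewrite !concat_lshift.
case: (split_ordP k) ij => [u ->|w ->] /= ij.
  have -> : j = lshift m3 (rshift m1 u) by apply: val_inj; rewrite /= -ij.
  by rewrite !(concat_lshift, concat_rshift).
have -> : j = rshift (m1 + m2) w by apply: val_inj; rewrite /= -ij addnA.
by rewrite !(concat_lshift, concat_rshift) /= addnA.
Qed.

Lemma pconcat1p : left_id (mkperm (1%g : 'S_0)) pconcat.
Proof.
move=> [m a]; apply: anypermP => //= i j ij.
have -> : i = rshift 0 j by apply: val_inj.
by rewrite concat_rshift.
Qed.

Lemma pconcatp1 : right_id (mkperm (1%g : 'S_0)) pconcat.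
Proof.
move=> [m a]; apply: anypermP => /=; first by rewrite addn0.
move=> i j ij; have -> : i = lshift 0 j by apply: val_inj.
by rewrite concat_lshift.
Qed.

Lemma std_cycleX m k (i : 'I_m) :
  (std_cycle m ^+ k)%g i = ((i + k) %% m)%N :> nat.
Proof.
elim: k => [|k IHk]; first by rewrite perm1 addn0 modn_small.
by rewrite expgSr permM permE /= IHk -addn1 modnDml addn1 addnS.
Qed.

Lemma rot_conjX m (a : 'S_m) k :
  rot_equiv (mkperm a) (mkperm (a ^ (std_cycle m ^+ k))%g).
Proof.
elim: k => [|k IHk]; first by rewrite conjg1; apply: rot_refl.
by apply: (rot_trans IHk); rewrite expgSr conjgM; apply: rot_conj.
Qed.

Lemma pconcatC a b : rot_equiv (pconcat a b) (pconcat b a).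
Proof.
case: a b => m1 a [m2 b]; apply: (rot_trans (rot_conjX _ m2)).
have -> // : mkperm (concat a b ^ (std_cycle (m1 + m2) ^+ m2))%g =
    pconcat (mkperm b) (mkperm a); last exact: rot_refl.
apply: anypermP => /= [|i j ij]; first exact: addnC.
set s := (std_cycle _ ^+ _)%g.
have [k ik] : exists k, i = s k by exists (s^-1%g i); rewrite permKV.
move: ij; rewrite {i}ik permJ => ij.
have sl u : s (lshift m2 u) = (m2 + u)%N :> nat.
  by rewrite /s std_cycleX /= [(u + m2)%N]addnC modn_small // addnC ltn_add2r.
have sr u : s (rshift m1 u) = u :> nat.
  rewrite /s std_cycleX /= addnAC modnDl modn_small //.
  exact: (leq_trans (ltn_ord u) (leq_addl _ _)).
case: (split_ordP k) ij => u ->.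
  rewrite sl => ij; have -> : j = rshift m2 u by apply: val_inj.
  by rewrite concat_lshift concat_rshift sl.
rewrite sr => ij; have -> : j = lshift m1 u by apply: val_inj.
by rewrite concat_lshift concat_rshift sr.
Qed.

Lemma pclass_ind (P : rot_class -> Prop) :
  (forall a, P (pclass a)) -> forall x, P x.
Proof. by move=> h x; rewrite -[x]reprK; apply: h. Qed.

Lemma class_mulA : associative class_mul.
Proof.
elim/pclass_ind=> a; elim/pclass_ind=> b; elim/pclass_ind=> c.
by rewrite !class_mulE pconcatA.
Qed.

Lemma class_mulC : commutative class_mul.
Proof.
elim/pclass_ind=> a; elim/pclass_ind=> b.
by rewrite !class_mulE; apply/eqP/pclassP/pconcatC.
Qed.

Lemma class_mul1 : left_id class_one class_mul.
Proof. by elim/pclass_ind=> a; rewrite class_mulE pconcat1p. Qed.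

Lemma class_mulr1 : right_id class_one class_mul.
Proof. by move=> x; rewrite class_mulC class_mul1. Qed.

Lemma class_sizeM x y : class_size (class_mul x y) = (class_size x + class_size y)%N.
Proof. exact: class_sizeE. Qed.

Lemma class_size0 x : class_size x = 0%N -> x = class_one.
Proof.
elim/pclass_ind: x => -[m a]; rewrite class_sizeE => m0; subst m.
by congr pclass; apply: anypermP => //= -[].
Qed.

Lemma class_mul_eq1 x y :
  class_mul x y = class_one -> x = class_one /\ y = class_one.
Proof.
move/(congr1 class_size)/eqP; rewrite class_sizeM class_sizeE addn_eq0.
by case/andP=> /eqP/class_size0 -> /eqP/class_size0 ->.
Qed.

HB.instance Definition _ := Choice_isMonomialDef.Build rot_class
  class_mulA class_mul1 class_mulr1 class_mul_eq1.
HB.instance Definition _ := MonomialDef_isConomialDef.Build rot_class class_mulC.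

Definition ncycles m (a : 'S_m) : nat := #|porbits a|.

Definition restr_cycles m (a : 'S_m) (I : {set {set 'I_m}}) : rot_class :=
  cls (restr a (cover I)).

Definition rank_in m (U : {set 'I_m}) (x : 'I_m) : nat :=
  #|[set y in U | (y < x)%N]|.

Lemma enum_val_lt m (U : {set 'I_m}) (i j : 'I_#|U|) :
  (i < j)%N -> (enum_val i < enum_val j)%N.
Proof.
move=> ij; have x0 := enum_val i; rewrite !(enum_val_nth x0).
have srt : sorted ltn [seq val x | x <- enum U].
  have -> : enum U = filter (mem U) (enum 'I_m) by rewrite enumT {1}/enum_mem.
  apply: (subseq_sorted ltn_trans (s2 := map val (enum 'I_m))).
    by apply: map_subseq; apply: filter_subseq.
  by rewrite val_enum_ord; apply: iota_ltn_sorted.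
rewrite -!(nth_map x0 (val x0) val) -?cardE //.
have lt (k : 'I_#|U|) : (k : nat) \in gtn (size [seq val x | x <- enum U]).
  by rewrite inE size_map -cardE.
exact: (sorted_ltn_nth ltn_trans).
Qed.

Lemma rank_enum_val m (U : {set 'I_m}) (i : 'I_#|U|) :
  rank_in U (enum_val i) = i.
Proof.
rewrite /rank_in.
have -> : [set y in U | (y < enum_val i)%N] =
          [set enum_val j | j in [set j : 'I_#|U| | (j < i)%N]].
  apply/setP => y; rewrite inE; apply/andP/imsetP => [[yU yi]|[j ji ->]].
    exists (enum_rank_in yU y); last by rewrite enum_rankK_in.
    rewrite inE; set j := enum_rank_in _ _.
    have ej : enum_val j = y by rewrite enum_rankK_in.
    rewrite ltnNge leq_eqVlt; apply/negP => /orP[/eqP ij|/enum_val_lt].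
      by move: yi; rewrite -ej (_ : i = j) ?ltnn //; apply: val_inj.
    by rewrite ej ltnNge ltnW.
  by rewrite enum_valP enum_val_lt //; move: ji; rewrite inE.
rewrite card_imset; last exact: enum_val_inj.
rewrite cardsE -sum1_card (big_ord_narrow (ltnW (ltn_ord i))) /=.
by rewrite sum1_card card_ord.
Qed.

Lemma rank_in_inj m (U : {set 'I_m}) : {in U &, injective (rank_in U)}.
Proof.
move=> x y xU yU.
rewrite -(enum_rankK_in xU xU) -(enum_rankK_in yU yU) !rank_enum_val => e.
by congr enum_val; apply: val_inj.
Qed.

Lemma rank_restr m (a : 'S_m) (U : {set 'I_m}) (i : 'I_#|U|) :
  restr a U i = rank_in U (restr_fun a U (enum_val i)) :> nat.
Proof.
rewrite permE /restr_ord -[LHS]rank_enum_val.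
by rewrite enum_rankK_in // restr_fun_stable ?enum_valP.
Qed.

Lemma orbit_map m n (a : 'S_m) (b : 'S_n) (h : 'I_m -> 'I_n) x :
  injective h -> (forall x, b (h x) = h (a x)) ->
  fingraph.orbit b (h x) = map h (fingraph.orbit a x).
Proof.
move=> hI hab; rewrite /fingraph.orbit.
have tr k : traject b (h x) k = map h (traject a x k).
  by elim: k x => //= k IHk x; rewrite hab IHk.
rewrite tr; congr (map h (traject a x _)).
apply: etrans (card_image hI (fconnect a x)); apply: eq_card => y.
have it k : iter k b (h x) = h (iter k a x) by elim: k => //= k ->.
apply/idP/imageP => [|[z /iter_findex <- ->]]; last first.
  by rewrite -it; apply: fconnect_iter.
by rewrite -topredE /= => /iter_findex <-; rewrite it;
  eexists; last reflexivity; apply: fconnect_iter.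
Qed.

Lemma restr_fun_map m n (a : 'S_m) (b : 'S_n) (h : 'I_m -> 'I_n)
    (U : {set 'I_m}) (V : {set 'I_n}) x :
  injective h -> (forall x, b (h x) = h (a x)) ->
  (forall x, (h x \in V) = (x \in U)) ->
  restr_fun b V (h x) = h (restr_fun a U x).
Proof.
move=> hI hab hUV; rewrite /restr_fun (orbit_map _ hI hab) filter_map.
have -> : [seq y <- fingraph.orbit a x | preim h (mem V) y] =
          [seq y <- fingraph.orbit a x | y \in U].
  by apply: eq_filter => y /=; rewrite hUV.
by rewrite next_map // filter_uniq // orbit_uniq //; apply: perm_inj.
Qed.

Lemma restr_concat m1 m2 (a : 'S_m1) (b : 'S_m2) (U : {set 'I_m1})
    (V : {set 'I_m2}) :
  mkperm (restr (concat a b) (lshift m2 @: U :|: @rshift m1 m2 @: V)) =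
  pconcat (mkperm (restr a U)) (mkperm (restr b V)).
Proof.
set W := _ :|: _.
have lW x : (lshift m2 x \in W) = (x \in U).
  rewrite inE mem_imset; last exact: lshift_inj.
  case: imsetP => [[y _ /eqP]|_]; last by rewrite orbF.
  by rewrite eq_lrshift.
have rW x : (rshift m1 x \in W) = (x \in V).
  rewrite inE orbC mem_imset; last exact: rshift_inj.
  case: imsetP => [[y _ /eqP]|_]; last by rewrite orbF.
  by rewrite eq_rlshift.
have cW : #|W| = (#|U| + #|V|)%N.
  rewrite cardsU (card_imset _ (@lshift_inj m1 m2)).
  rewrite (card_imset _ (@rshift_inj m1 m2)) [X in (_ - X)%N]eq_card0 ?subn0 //.
  move=> y; rewrite inE; apply/negP => /andP[/imsetP[t _ ->]] /imsetP[u _ /eqP].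
  by rewrite eq_lrshift.
clearbody W.
have rkl x : rank_in W (lshift m2 x) = rank_in U x.
  rewrite /rank_in -(card_imset _ (@lshift_inj m1 m2)); congr #|pred_of_set _|.
  apply/setP => y; case: (split_ordP y) => z ->.
    by rewrite mem_imset ?inE -?lW ?inE //; apply: lshift_inj.
  rewrite inE rW /= ltnNge (leq_trans (ltnW (ltn_ord x))) ?leq_addr // andbF.
  by apply/esym/imsetP => -[t _ /eqP]; rewrite eq_rlshift.
have cU : #|U| = #|[set y in W | (y < m1)%N]|.
  rewrite -(card_imset _ (@lshift_inj m1 m2)); congr #|pred_of_set _|.
  apply/setP => y; case: (split_ordP y) => z ->.
    rewrite mem_imset; last exact: lshift_inj.
    by rewrite [in RHS]inE lW /= ltn_ord andbT.
  rewrite [in RHS]inE /= ltnNge leq_addr andbF.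
  by apply/imsetP => -[t _ /eqP]; rewrite eq_rlshift.
have rkr x : rank_in W (rshift m1 x) = (#|U| + rank_in V x)%N.
  rewrite cU /rank_in -(card_imset _ (@rshift_inj m1 m2)) -cardsUI.
  rewrite [X in (_ = _ + X)%N]eq_card0 ?addn0; last first.
    move=> y; rewrite !inE; apply/negP => /andP[/andP[_ ym]] /imsetP[t _ yt].
    by move: ym; rewrite yt /= ltnNge leq_addr.
  congr #|pred_of_set _|; apply/setP => y; case: (split_ordP y) => z ->.
    rewrite !inE lW /= ltn_ord (leq_trans (ltn_ord z)) ?leq_addr // !andbT.
    case: imsetP => [[t _ /eqP]|_]; last by rewrite orbF.
    by rewrite eq_lrshift.
  rewrite in_setU mem_imset; last exact: rshift_inj.
  by rewrite !inE -!(rW z) /= ltn_add2l [(m1 + z < m1)%N]ltnNge leq_addr andbF.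
apply: anypermP => /= [|i j ij]; first exact: cW.
rewrite rank_restr.
case: (split_ordP j) ij => u -> /= iu.
  have -> : enum_val i = lshift m2 (enum_val u).
    apply: (@rank_in_inj _ W); rewrite ?enum_valP ?lW ?enum_valP //.
    by rewrite rkl !rank_enum_val.
  rewrite (@restr_fun_map _ _ a _ _ U) ?rkl ?concat_lshift /= -?rank_restr //.
    exact: lshift_inj.
  by move=> x; rewrite concat_lshift.
have -> : enum_val i = rshift m1 (enum_val u).
  apply: (@rank_in_inj _ W); rewrite ?enum_valP ?rW ?enum_valP //.
  by rewrite rkr !rank_enum_val.
rewrite (@restr_fun_map _ _ b _ _ V) ?rkr ?concat_rshift /= -?rank_restr //.
  exact: rshift_inj.
by move=> x; rewrite concat_rshift.
Qed.

Lemma rank_std_cycle m (U : {set 'I_m}) (x : 'I_m) : x \in U ->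
  rank_in (std_cycle m @: U) (std_cycle m x) =
  ((rank_in U x + [exists y in U, y.+1 == m]) %% #|U|)%N.
Proof.
move=> xU; set s := std_cycle m.
have sE z : s z = (if z.+1 == m then 0 else z.+1)%N :> nat.
  rewrite permE /=; case: eqP => [->|/eqP nz]; first by rewrite modnn.
  by rewrite modn_small // ltn_neqAle nz ltn_ord.
have -> : rank_in (s @: U) (s x) = #|[set z in U | (s z < s x)%N]|.
  rewrite -(card_imset _ (@perm_inj _ s)) /rank_in; congr #|pred_of_set _|.
  apply/setP => y; rewrite -[y](permKV s) inE !(mem_imset _ _ (@perm_inj _ s)).
  by rewrite inE.
have rk_lt : (rank_in U x < #|U|)%N.
  apply/proper_card/properP; split; last by exists x; rewrite // inE ltnn andbF.
  by apply/subsetP => z; rewrite inE => /andP[].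
case: existsP => [[y /andP[yU /eqP ym]]|nU]; last first.
  rewrite addn0 modn_small //; congr #|pred_of_set _|; apply/setP => z.
  rewrite !inE; case zU: (z \in U) => //=; rewrite !sE.
  case: eqP => [zm|_]; first by case: nU; exists z; rewrite zU zm /=.
  case: eqP => [xm|_]; first by case: nU; exists x; rewrite xU xm /=.
  by rewrite ltnS.
have [xm|xm] := eqVneq x.+1 m.
  rewrite [X in #|pred_of_set X|](_ : _ = set0) ?cards0; last first.
    by apply/setP => z; rewrite !inE [X in (_ < X)%N]sE xm eqxx andbF.
  suff -> : (rank_in U x + true)%N = #|U| by rewrite modnn.
  rewrite addn1 (cardsD1 x U) xU add1n; congr S; congr #|pred_of_set _|.
  apply/setP => z; rewrite !inE andbC; case: (z \in U); rewrite ?andbF ?andbT //.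
  by rewrite ltn_neqAle -ltnS xm ltn_ord andbT.
have e : [set z in U | (s z < s x)%N] = y |: [set z in U | (z < x)%N].
  apply/setP => z; rewrite !inE !sE (negPf xm).
  have [->|zy] := eqVneq z y; first by rewrite yU ym eqxx.
  case: eqP => [zm|_]; last by rewrite ltnS.
  by case/eqP: zy; apply: val_inj; apply: succn_inj; rewrite /= zm ym.
rewrite e cardsU1 inE.
have -> : (y < x)%N = false.
  by apply/negbTE; rewrite -leqNgt -ltnS ym ltn_ord.
rewrite andbF /= add1n -/(rank_in U x) addn1 modn_small //.
have -> : (rank_in U x).+1 = #|[set z in U | (s z < s x)%N]|.
  by rewrite e cardsU1 inE ltnNge -ltnS ym ltn_ord andbF add1n.
apply/proper_card/properP; split; last by exists x; rewrite // inE ltnn andbF.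
by apply/subsetP => z; rewrite inE => /andP[].
Qed.

Lemma restr_conj m (a : 'S_m) (U : {set 'I_m}) :
  cls (restr (a ^ std_cycle m)%g (std_cycle m @: U)) = cls (restr a U).
Proof.
set s := std_cycle m; pose k : nat := [exists y in U, y.+1 == m].
apply/eqP/pclassP/rot_sym; apply: (rot_trans (rot_conjX _ k)).
set t := (_ ^+ k)%g.
have sU x : (s x \in s @: U) = (x \in U) by rewrite mem_imset //; apply: perm_inj.
have -> : mkperm (restr a U ^ t)%g = mkperm (restr (a ^ s)%g (s @: U)); last first.
  exact: rot_refl.
apply/esym/anypermP => /= [|i j ij]; first by rewrite card_imset //; apply: perm_inj.
have [l jl] : exists l, j = t l by exists (t^-1%g j); rewrite permKV.
move: ij; rewrite {j}jl permJ => il.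
have -> /= : t (restr a U l) = ((restr a U l + k) %% #|U|)%N :> nat.
  by rewrite /t std_cycleX.
have il' : i = ((l + k) %% #|U|)%N :> nat by rewrite il /t std_cycleX.
rewrite !rank_restr.
have -> : enum_val i = s (enum_val l).
  apply: (@rank_in_inj _ (s @: U)); rewrite ?enum_valP ?sU ?enum_valP //.
  by rewrite rank_std_cycle ?enum_valP // !rank_enum_val.
rewrite (@restr_fun_map _ _ a _ _ U) ?rank_std_cycle ?restr_fun_stable ?enum_valP //.
  exact: perm_inj.
by move=> x; rewrite permJ.
Qed.

Section ProductMonom.
Context (G H : monomType).
Implicit Types x y z : G * H.

Definition pmul x y : G * H := (mmul x.1 y.1, mmul x.2 y.2).

Lemma pmulA : associative pmul.
Proof. by move=> x y z; rewrite /pmul !mulmA. Qed.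
Lemma pmul1 : left_id (mone, mone) pmul.
Proof. by case=> x y; rewrite /pmul !mul1m. Qed.
Lemma pmulr1 : right_id (mone, mone) pmul.
Proof. by case=> x y; rewrite /pmul !mulm1. Qed.
Lemma pmul_eq1 x y :
  pmul x y = (mone, mone) -> x = (mone, mone) /\ y = (mone, mone).
Proof.
by case: x y => x1 x2 [y1 y2] [] /unitm[-> ->] /unitm[-> ->].
Qed.

HB.instance Definition _ := Choice_isMonomialDef.Build (G * H)%type
  pmulA pmul1 pmulr1 pmul_eq1.
End ProductMonom.

Section ProductConom.
Context (G H : conomType).
Lemma pmulC : commutative (@pmul G H).
Proof. by move=> x y; rewrite /pmul (mulmC x.1) (mulmC x.2). Qed.
HB.instance Definition _ := MonomialDef_isConomialDef.Build (G * H)%type pmulC.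
End ProductConom.

(* The tensor product of the free modules on G and H is the free module on
   G * H, with <<(g, h)>> for <<g>> (x) <<h>>. *)
Notation tensor K G H := {malg K[(G * H)%type]}.

Section Tensor.
Context (K : fieldType).

Definition tens (G H : choiceType) (u : {malg K[G]}) (v : {malg K[H]}) :
    tensor K G H :=
  \sum_(g <- msupp u) \sum_(h <- msupp v) << u@_g * v@_h *g (g, h) >>.

Definition tens_map (G G' H H' : choiceType) (f : {malg K[G]} -> {malg K[G']})
    (f' : {malg K[H]} -> {malg K[H']}) (t : tensor K G H) : tensor K G' H' :=
  \sum_(k <- msupp t) t@_k *: tens (f << k.1 >>) (f' << k.2 >>).

End Tensor.

Notation rot_alg K := {malg K[rot_class]}.

Section RotAlg.
Context (K : fieldType).

Definition comult_perm m (a : 'S_m) : tensor K rot_class rot_class :=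
  \sum_(I in powerset (porbits a))
    << (restr_cycles a I, restr_cycles a (porbits a :\: I)) >>.

(* The choice of the representative does not matter: see [rot_comultE]. *)
Definition comult_class (x : rot_class) : tensor K rot_class rot_class :=
  comult_perm (tagged (generic_quotient.repr x)).

Definition rot_comult (x : rot_alg K) : tensor K rot_class rot_class :=
  \sum_(c <- msupp x) x@_c *: comult_class c.

Definition rot_counit (x : rot_alg K) : K := x@_(mone : rot_class).

Definition rot_filt (n : nat) (x : rot_alg K) : Prop :=
  forall c, c \in msupp x -> (class_size c <= n)%N.

Lemma imset_inj_subset (T T' : finType) (h : T -> T') (A B : {set T}) :
  injective h -> (h @: A \subset h @: B) = (A \subset B).
Proof.
move=> hI; apply/idP/idP => [/subsetP hAB|/imsetS->//].
by apply/subsetP => x xA; rewrite -(mem_imset _ _ hI) hAB // imset_f.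
Qed.

Lemma imset_injD (T T' : finType) (h : T -> T') (A B : {set T}) :
  injective h -> h @: (A :\: B) = (h @: A) :\: (h @: B).
Proof.
move=> hI; apply/setP => y; rewrite inE; apply/imsetP/andP => [[x]|[yB]].
  by rewrite inE => /andP[xB xA] ->; rewrite !(mem_imset _ _ hI).
case/imsetP => x xA yx; move: yB; rewrite yx (mem_imset _ _ hI) => xB.
by exists x; rewrite // inE xB.
Qed.

Lemma cover_imset (T T' : finType) (h : T -> T') (I : {set {set T}}) :
  cover [set h @: (O : {set T}) | O in I] = h @: cover I.
Proof.
apply/setP => y; apply/bigcupP/imsetP => [[_ /imsetP[O OI ->]]|[x]].
  by case/imsetP => x xO ->; exists x => //; apply/bigcupP; exists O.
case/bigcupP => O OI xO ->; exists (h @: O); first exact: imset_f.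
exact: imset_f.
Qed.

Lemma porbit_map m n (a : 'S_m) (b : 'S_n) (h : 'I_m -> 'I_n) x :
  (forall x, b (h x) = h (a x)) -> porbit b (h x) = h @: porbit a x.
Proof.
move=> hab; have hX i y : (b ^+ i)%g (h y) = h ((a ^+ i)%g y).
  by elim: i => [|i IH]; rewrite ?perm1 // !expgSr !permM IH hab.
apply/setP => y; apply/porbitP/imsetP => [[i ->]|[z /porbitP[i ->] ->]].
  by exists ((a ^+ i)%g x) => //; apply: mem_porbit.
by exists i.
Qed.

Lemma comult_perm_conj m (a : 'S_m) :
  comult_perm (a ^ std_cycle m)%g = comult_perm a.
Proof.
set s := std_cycle m.
have sI : injective (fun O : {set 'I_m} => s @: O).
  by apply: imset_inj; apply: perm_inj.
have pE : porbits (a ^ s)%g = [set s @: (O : {set 'I_m}) | O in porbits a].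
  rewrite /porbits -imset_comp; apply/setP => O.
  have pm x : porbit (a ^ s)%g (s x) = s @: porbit a x.
    by apply: porbit_map => y; rewrite permJ.
  apply/imsetP/imsetP => [[x _ ->]|[x _ ->]].
    by exists (s^-1%g x) => //=; rewrite -pm permKV.
  by exists (s x) => //=; rewrite pm.
pose G (I : {set {set 'I_m}}) := [set s @: (O : {set 'I_m}) | O in I].
have GI : injective G by apply: imset_inj.
rewrite /comult_perm [LHS](reindex_inj GI) /G.
apply: eq_big => [I|I _]; first by rewrite !powersetE pE imset_inj_subset.
have rc (J : {set {set 'I_m}}) : restr_cycles (a ^ s)%g [set s @: (O : {set 'I_m}) | O in J] =
    restr_cycles a J.
  by rewrite /restr_cycles cover_imset restr_conj.
by rewrite pE -(imset_injD _ _ sI) !rc.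
Qed.

Lemma restr_cycles_concat m1 m2 (a : 'S_m1) (b : 'S_m2)
    (I : {set {set 'I_m1}}) (J : {set {set 'I_m2}}) :
  restr_cycles (concat a b)
    ([set lshift m2 @: (O : {set 'I_m1}) | O in I] :|:
     [set @rshift m1 m2 @: (O : {set 'I_m2}) | O in J]) =
  mmul (restr_cycles a I) (restr_cycles b J).
Proof.
rewrite /restr_cycles /cover bigcup_setU -!/(cover _) !cover_imset.
by rewrite /cls restr_concat -class_mulE.
Qed.

Lemma comult_perm_concat m1 m2 (a : 'S_m1) (b : 'S_m2) :
  comult_perm (concat a b) = comult_perm a * comult_perm b.
Proof.
pose L (O : {set 'I_m1}) := lshift m2 @: O.
pose R (O : {set 'I_m2}) := @rshift m1 m2 @: O.
have LI : injective L by apply: imset_inj; apply: lshift_inj.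
have RI : injective R by apply: imset_inj; apply: rshift_inj.
have pE : porbits (concat a b) = L @: porbits a :|: R @: porbits b.
  have pl x : porbit (concat a b) (lshift m2 x) = L (porbit a x).
    by apply: porbit_map => y; rewrite concat_lshift.
  have pr x : porbit (concat a b) (rshift m1 x) = R (porbit b x).
    by apply: porbit_map => y; rewrite concat_rshift.
  apply/setP => O; rewrite inE; apply/imsetP/orP => [[x _ ->]|].
    by case: (split_ordP x) => y ->; rewrite ?pl ?pr; [left|right];
      rewrite !imset_f.
  by case=> /imsetP[_ /imsetP[x _ ->] ->]; rewrite -?pl -?pr; eexists.
have LR x y : L (porbit a x) <> R (porbit b y).
  move/setP/(_ (lshift m2 x)); rewrite imset_f ?porbit_id //.
  by move/esym/imsetP => -[z _ /eqP]; rewrite eq_lrshift.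
pose h (p : {set {set 'I_m1}} * {set {set 'I_m2}}) := L @: p.1 :|: R @: p.2.
pose h' (J : {set {set 'I_(m1 + m2)}}) :=
  ([set O in porbits a | L O \in J], [set O in porbits b | R O \in J]).
have hL (I : {set {set 'I_m1}}) (J : {set {set 'I_m2}}) O : I \subset porbits a -> J \subset porbits b -> O \in porbits a ->
    (L O \in h (I, J)) = (O \in I).
  move=> Ia Jb /imsetP[x _ ->]; rewrite inE (mem_imset _ _ LI) /=.
  case: imsetP => [[_ /(subsetP Jb)/imsetP[y _ ->] /LR]|_] //.
  by rewrite orbF.
have hR (I : {set {set 'I_m1}}) (J : {set {set 'I_m2}}) O : I \subset porbits a -> J \subset porbits b -> O \in porbits b ->
    (R O \in h (I, J)) = (O \in J).
  move=> Ia Jb /imsetP[x _ ->]; rewrite inE orbC (mem_imset _ _ RI) /=.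
  case: imsetP => [[_ /(subsetP Ia)/imsetP[y _ ->] /esym/LR]|_] //.
  by rewrite orbF.
rewrite /comult_perm big_distrlr /= pair_big /=.
rewrite (reindex_onto h h') /=; last first.
  move=> J; rewrite powersetE pE => /subsetP JS; apply/setP => O.
  rewrite inE; apply/orP/idP => [|OJ].
    by case=> /imsetP[Q]; rewrite inE => /andP[_ QJ] ->.
  by have := JS O OJ; rewrite inE => /orP[] /imsetP[Q Qp OQ]; [left|right];
    rewrite OQ imset_f // inE Qp -OQ.
apply: eq_big => [[I J]|[I J]] /=.
  rewrite !powersetE pE; apply/andP/andP => [[hs /eqP[<- <-]]|[Ia Jb]].
    by split; apply/subsetP => O; rewrite inE => /andP[].
  split; first by apply: setUSS; apply: imsetS.
  apply/eqP; congr pair; apply/setP => O; rewrite inE.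
    by apply/andP/idP => [[Oa]|OI]; [|have Oa := subsetP Ia O OI; split=> //];
      rewrite hL.
  by apply/andP/idP => [[Oa]|OI]; [|have Oa := subsetP Jb O OI; split=> //];
    rewrite hR.
rewrite !powersetE pE => /andP[_ /eqP[eI eJ]].
have Ia : I \subset porbits a.
  by rewrite -eI; apply/subsetP => O; rewrite inE => /andP[].
have Jb : J \subset porbits b.
  by rewrite -eJ; apply/subsetP => O; rewrite inE => /andP[].
have -> : (L @: porbits a :|: R @: porbits b) :\: h (I, J) =
          L @: (porbits a :\: I) :|: R @: (porbits b :\: J).
  apply/setP => O; rewrite in_setD; apply/andP/setUP => [[Oh]|[]].
  - case/setUP => /imsetP[Q Qp OQ]; [left|right]; rewrite OQ imset_f // inE Qp.
      by move: Oh; rewrite OQ hL // => ->.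
    by move: Oh; rewrite OQ hR // => ->.
  - case/imsetP => Q; rewrite inE => /andP[QI Qa] ->.
    by rewrite hL // QI inE imset_f.
  case/imsetP => Q; rewrite inE => /andP[QI Qa] ->.
  by rewrite hR // QI inE orbC imset_f.
rewrite !restr_cycles_concat malgM_def fgmulUU mulr1.
by [].
Qed.

Lemma comult_perm_equiv a b : rot_equiv a b ->
  comult_perm (tagged a) = comult_perm (tagged b).
Proof.
move=> ab; elim: {a b} ab => [a|a b _ ->|a b c _ -> _ ->|m a|a1 a2 b1 b2 _ ea _ eb].
- by [].
- by [].
- by [].
- exact/esym/comult_perm_conj.
rewrite [LHS](comult_perm_concat (tagged a1) (tagged b1)) ea eb.
exact/esym/comult_perm_concat.
Qed.

Lemma rot_comultE m (a : 'S_m) : rot_comult << cls a >> = comult_perm a.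
Proof.
rewrite /rot_comult msuppU oner_eq0 big_seq_fset1 mcoeffUU scale1r.
exact: (comult_perm_equiv (pclass_repr (mkperm a))).
Qed.

End RotAlg.

Notation pol_alg K := {malg K[{cmonom nat}]}.

Definition mpow (S : nzRingType) (v : nat -> S) (e : {cmonom nat}) : S :=
  \prod_(k <- finsupp e) v k ^+ e k.

(* p_{k+1} has degree k + 1. *)
Definition pweight (e : {cmonom nat}) : nat := (\sum_(k <- finsupp e) e k * k.+1)%N.

Section PolAlg.
Context (K : fieldType).

Definition pvar (k : nat) : pol_alg K := << ucm k >>.

(* The algebra morphism with p_k |-> p_k (x) 1 + 1 (x) p_k. *)
Definition poly_comult : pol_alg K -> tensor K {cmonom nat} {cmonom nat} :=
  mmap (@mkmalgU ({cmonom nat} * {cmonom nat})%type K mone)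
    (mpow (fun k => tens (pvar k) 1 + tens 1 (pvar k))).

Definition poly_counit (u : pol_alg K) : K := u@_(mone : {cmonom nat}).

Definition poly_filt (n : nat) (u : pol_alg K) : Prop :=
  forall e, e \in msupp u -> (pweight e <= n)%N.

End PolAlg.

Section WeightSystem.
Context (K : fieldType).

(* K[N, C_1, C_2, ...], the variable of {poly _} being N. *)
Definition gl_poly : Type := {poly pol_alg K}.
HB.instance Definition _ := GRing.Ring.on gl_poly.

(* Evaluation at N := n and C_{k+1} := c k, with phi embedding the scalars.
   If the c k commute only modulo an ideal, then modulo that ideal the order in
   which [mpow] multiplies them is immaterial. *)
Definition gl_eval (S : nzRingType) (phi : K -> S) (n : S) (c : nat -> S)
    (F : gl_poly) : S :=
  \sum_(d < size F) n ^+ d * mmap phi (mpow c) F`_d.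

(* The free associative algebra on the E_{i,j}; U gl(N) is its quotient by
   [Ugl_ideal], the two-sided ideal generated by the commutation relations. *)
Definition gl_free (N : nat) := {malg K[{fmonom ('I_N * 'I_N)%type}]}.
HB.instance Definition _ N := GRing.Lalgebra.on (gl_free N).

Definition gl_gen N (i j : 'I_N) : gl_free N := << fmu (i, j) >>.

Definition gl_rel N (i j k l : 'I_N) : gl_free N :=
  gl_gen i j * gl_gen k l - gl_gen k l * gl_gen i j
  - (gl_gen i l *+ (j == k) - gl_gen k j *+ (i == l)).

Inductive Ugl_ideal N : gl_free N -> Prop :=
| Ugl_rel i j k l : Ugl_ideal (gl_rel i j k l)
| Ugl_0 : Ugl_ideal 0
| Ugl_add x y : Ugl_ideal x -> Ugl_ideal y -> Ugl_ideal (x + y)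
| Ugl_mull a x : Ugl_ideal x -> Ugl_ideal (a * x)
| Ugl_mulr a x : Ugl_ideal x -> Ugl_ideal (x * a).

(* Equality of the classes of x and y in U gl(N). *)
Definition Ugl_eq N (x y : gl_free N) : Prop := Ugl_ideal (x - y).

Definition w_glN N m (a : 'S_m) : gl_free N :=
  \sum_(i : {ffun 'I_m -> 'I_N}) \prod_(l < m) gl_gen (i l) (i (a l)).

Definition gl_specialize N (F : gl_poly) : gl_free N :=
  gl_eval (@mkmalgU _ K mone) N%:R (fun k => w_glN N (std_cycle k.+1)) F.

(* The unique polynomial specializing to [w_glN N a] in U gl(N) for all N >= 1;
   the C_k are central in U gl(N), so this does not depend on the order of the
   factors in [gl_specialize]. *)
Definition w_gl m (a : 'S_m) : gl_poly :=
  classical_sets.xget 0 (fun F : gl_poly =>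
    forall N, (0 < N)%N -> Ugl_eq (gl_specialize N F) (w_glN N a)).

(* C_{k+1} := p_{k+1} N^k *)
Definition gl_subst : gl_poly -> {poly pol_alg K} :=
  gl_eval (fun c : K => ((<< c *g (mone : {cmonom nat}) >> : pol_alg K)%:P))
    'X (fun k => pvar K k *: 'X^k).

(* The coefficient of N^d, d in Z, in the Laurent polynomial
   X(a) = N^(c(a) - m) w_gl(a)|_{C_k := p_k N^(k-1)}. *)
Definition prechromatic_coef m (a : 'S_m) (d : int) : pol_alg K :=
  if d - ((ncycles a)%:Z - m%:Z) is Posz n then (gl_subst (w_gl a))`_n else 0.

(* X(a) = X_0(a) + N^-2 X_1(a) + N^-4 X_2(a) + ... *)
Definition X_ (k : nat) m (a : 'S_m) : pol_alg K :=
  prechromatic_coef a (- (2 * k)%N%:Z).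

End WeightSystem.

Section HopfMorphism.
Context (K : fieldType) (f : rot_alg K -> pol_alg K).

Definition coalgebra_morphism : Prop :=
  (forall x, tens_map f f (rot_comult x) = poly_comult (f x)) /\
  (forall x, poly_counit (f x) = rot_counit x).

Definition filtered_morphism : Prop :=
  forall n x, rot_filt n x -> poly_filt n (f x).

End HopfMorphism.

(* Main.v *)
(* Exchanging two adjacent factors E_{..} of w_gl(N)(a) in U gl(N) expresses w_gl(N)(a)
   through a permutation conjugate to a by an adjacent transposition and two permutations
   of one point less; no division into cases is needed if a closed index loop is counted
   as a factor N.  Moving one factor through all others, these corrections telescope,
   which gives invariance under rotation and makes the C_k commute.  Descending to
   concatenations of standard cycles yields a polynomial w_gl(a) which, with N in
   degree 1 and C_k in degree k - 1, has degree at most m - c(a).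

   This polynomial is unique: gl_N acts on functions on N x N matrices by
   E_ij |-> t x_ij + (vector field), and the top power of t turns C_k, on the
   diagonal matrix diag(y), into the power sum of the y_j^k.  The monomials in
   N and the power sums are distinct characters of the monoid of finite lists y
   under the product of all pairs, hence linearly independent (Dedekind).

   So X_0(a), the part of degree exactly m - c(a), satisfies the recurrence in which
   the smaller permutations survive only if they merge two cycles or delete a point
   next to its neighbour in a cycle.  The sum of X_0(a|_I) (x) X_0(a|_J) satisfies the
   image of this recurrence, and both sides agree on concatenations of cycles. *)

From HB Require Import structures.
From mathcomp Require Import -(notations) mpoly.
Require Import Defs.
From mathcomp Require Import all_boot all_order all_fingroup all_algebra.
From mathcomp Require Import finmap monalg complex reals.
From mathcomp Require Import boolp ring zify.
From mathcomp Require classical_sets.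

Set Implicit Arguments.
Unset Strict Implicit.
Unset Printing Implicit Defensive.

Import GRing.Theory Num.Theory.
Local Open Scope ring_scope.

(** * Cycle sums over permutations *)

(** The recurrence deletes points, and renumbering after each deletion would bury the algebra. So a
    permutation stays on a fixed finite type, and the objects are pairs of a list [s] and a
    permutation [a] preserving [s]: the order of [s] is the order of the noncommuting factors, and a
    deleted point survives as a fixed point outside the list. Renumbering is transport along an
    injective map. Two obstacles shape the rest. The values of the C_k commute only modulo the
    relations of gl(N), so specialization becomes a ring morphism only after passing to an actual
    quotient ring. And [w_gl] is picked by [xget], so nothing can be computed about it before the
    polynomial is known to be unique. For the coproduct, a correction that splits a cycle creates
    unions of cycles without counterpart in the original permutation. Exactly these corrections have
    too low a degree in N to contribute to X_0. *)

Lemma perm_swap_ind (T : eqType) (P : seq T -> Prop) :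
  (forall s1 x y s2, P (s1 ++ x :: y :: s2) -> P (s1 ++ y :: x :: s2)) ->
  forall s t, perm_eq s t -> P s -> P t.
Proof.
(* With a prefix [p], the head of [t] can be moved to the front of [s] by adjacent swaps and then
   absorbed into [p]. *)
move=> sw s t; suff h p : perm_eq s t -> P (p ++ s) -> P (p ++ t) by exact: (h [::]).
elim: t s p => [|x t IH] s p; first by move/perm_nilP ->.
move=> st; have xs : x \in s by rewrite (perm_mem st) mem_head.
case/splitPr: s / xs st => s1 s2; rewrite -cat1s perm_catCA perm_cons => st ps.
rewrite -cat1s catA; apply: IH st _.
elim/last_ind: s1 s2 ps => [|s1 y IHs] s2; first by rewrite -catA.
by rewrite -cats1 -catA /= catA => /sw; rewrite -catA => /IHs; rewrite -!catA.
Qed.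

Section IteratedSum.
Context (T : eqType) (V : finType) (S : nmodType).
Implicit Types (i : T -> V) (s : seq T).

Definition upd i x v : T -> V := fun z => if z == x then v else i z.

(** Iterated along a list, so that a single index can be split off and contracted, and indices can
    be reordered by adjacent exchanges. The assignment [i] supplies the values off the list. *)
Fixpoint asum s (f : (T -> V) -> S) i : S :=
  if s is x :: s' then \sum_v asum s' f (upd i x v) else f i.

Lemma asum_cat s1 s2 f i : asum (s1 ++ s2) f i = asum s1 (asum s2 f) i.
Proof. by elim: s1 i => //= x s1 IH i; apply: eq_bigr => v _. Qed.

Lemma eq_asum s f g i : f =1 g -> asum s f i = asum s g i.
Proof. by move=> fg; elim: s i => //= x s IH i; apply: eq_bigr => v _. Qed.

Lemma asumD s f g i : asum s (fun j => f j + g j) i = asum s f i + asum s g i.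
Proof.
by elim: s i => //= x s IH i; rewrite -big_split; apply: eq_bigr => v _.
Qed.

Lemma asumMn s f n i : asum s (fun j => f j *+ n) i = asum s f i *+ n.
Proof.
by elim: s i => //= x s IH i; rewrite -sumrMnl; apply: eq_bigr => v _.
Qed.

Lemma updC i x y u v : x != y -> upd (upd i x u) y v = upd (upd i y v) x u.
Proof.
move=> /negPf xy; apply/funext => z; rewrite /upd.
by have [->|//] := eqVneq z y; rewrite eq_sym xy.
Qed.

Lemma asum_perm s t f i : perm_eq s t -> asum s f i = asum t f i.
Proof.
move=> st; pose P u := asum s f i = asum u f i.
apply: (perm_swap_ind (P := P)) st _ => // s1 x y s2; rewrite /P => ->.
rewrite !asum_cat; congr (asum s1 _ i); apply/funext => j /=.
have [->//|xy] := eqVneq x y.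
rewrite exchange_big; apply: eq_bigr => v _; apply: eq_bigr => u _.
by rewrite updC.
Qed.

End IteratedSum.

Lemma asum_off (V : finType) (S : nmodType) (U : finType) (s : seq U)
    (f : (U -> V) -> S) (i : U -> V) : uniq s ->
  asum s f i =
  \sum_(j : {ffun U -> V} | [forall z, (z \notin s) ==> (j z == i z)]) f j.
Proof.
elim: s i => [|x s IH] i /=.
  move=> _; rewrite (big_pred1 [ffun z => i z]) => [|j].
    by congr f; apply/funext => z; rewrite ffunE.
  apply/forallP/eqP => [h|-> z]; last by rewrite ffunE.
  by apply/ffunP => z; rewrite ffunE; apply/eqP; apply: h.
case/andP => xs us; rewrite (partition_big (fun j : {ffun U -> V} => j x) xpredT) //.
apply: eq_bigr => v _; rewrite IH //; apply: eq_bigl => j.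
apply/forallP/andP => [h|[/forallP h /eqP jx] z].
  have jx : j x == v by have := h x; rewrite xs /upd eqxx.
  split=> //; apply/forallP => z; rewrite inE negb_or; apply/implyP => /andP[zx zs].
  by have := h z; rewrite zs /upd (negPf zx).
apply/implyP => zs; rewrite /upd; have [->|zx] := eqVneq z x; first by rewrite jx.
by have := h z; rewrite inE negb_or zx zs.
Qed.

Lemma asum_all (V : finType) (S : nmodType) (U : finType) (s : seq U)
    (f : (U -> V) -> S) (i : U -> V) :
  uniq s -> (forall x, x \in s) -> asum s f i = \sum_(j : {ffun U -> V}) f j.
Proof.
move=> us sT; rewrite asum_off //; apply: eq_bigl => j.
by apply/forallP => z; rewrite sT.
Qed.

Lemma asum_map (T T' : eqType) (V : finType) (S : nmodType) (h : T -> T')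
    (s : seq T) (f : (T -> V) -> S) (f' : (T' -> V) -> S) i i' :
  {in s &, injective h} ->
  (forall j j', {in s, j =1 j' \o h} -> f j = f' j') ->
  asum s f i = asum (map h s) f' i'.
Proof.
move=> hI ff'.
(* [P] collects the points already summed over, where the two running assignments correspond through
   [h]. *)
suff H (P t : seq T) : {in P ++ t &, injective h} ->
    (forall j j', {in P ++ t, j =1 j' \o h} -> f j = f' j') ->
    {in P, i =1 i' \o h} -> asum t f i = asum (map h t) f' i' by exact: (H [::]).
elim: t P i i' {hI ff'} => [|x t IH] P i i' hI ff' ii' /=.
  by apply: ff' => z; rewrite cats0; apply: ii'.
apply: eq_bigr => v _; apply: (IH (rcons P x)); rewrite ?cat_rcons //.
move=> z; rewrite mem_rcons inE => zP; rewrite /upd /=.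
have [->|zx] := eqVneq z x; first by rewrite eqxx.
have {}zP : z \in P by case/orP: zP => // /eqP zx'; rewrite zx' eqxx in zx.
rewrite (inj_in_eq hI) ?mem_cat ?zP ?mem_head ?orbT // (negPf zx).
exact: ii'.
Qed.

Lemma eq_asum_off (T : eqType) (V : finType) (S : nmodType) (s : seq T)
    (f g : (T -> V) -> S) i :
  (forall j, (forall z, z \notin s -> j z = i z) -> f j = g j) ->
  asum s f i = asum s g i.
Proof.
elim: s i => [|x s IH] i fg /=; first exact: fg.
apply: eq_bigr => v _; apply: IH => j ji; apply: fg => z.
by rewrite inE negb_or => /andP[zx zs]; rewrite ji // /upd (negPf zx).
Qed.

Definition stable (T : eqType) (s : seq T) (a : T -> T) : Prop :=
  {in s, forall z, a z \in s}.

(** The predecessor of [y] is redirected to [a y], and [y] becomes a fixed point, so the type of the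
    permutation does not change. *)
Definition del (T : finType) (y : T) (a : {perm T}) : {perm T} :=
  (a * tperm y (a y))%g.

Lemma del_self (T : finType) (y : T) a : del y a y = y.
Proof. by rewrite permM tpermR. Qed.

Lemma delE (T : finType) (y : T) a z :
  z != y -> del y a z = if a z == y then a y else a z.
Proof.
move=> zy; rewrite permM; case: tpermP => [->|/(@perm_inj _ a) e|/eqP/negPf-> _ //].
  by rewrite eqxx.
by rewrite e eqxx in zy.
Qed.

Lemma stable_perm (T : finType) (s : seq T) (a : {perm T}) z :
  stable s a -> (a z \in s) = (z \in s).
Proof.
move=> sa; have sub : [set a u | u in [set v in s]] \subset [set v in s].
  by apply/subsetP => _ /imsetP[u + ->]; rewrite !inE; apply: sa.
have := subset_leqif_cards sub; rewrite (card_imset _ perm_inj) => -[_].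
rewrite eqxx => /esym/eqP e; transitivity (a z \in [set v in s]).
  by rewrite inE.
by rewrite -e mem_imset ?inE //; exact: perm_inj.
Qed.

Lemma stableM (T : finType) (s : seq T) (a b : {perm T}) :
  stable s a -> stable s b -> stable s (a * b)%g.
Proof. by move=> sa sb z zs; rewrite permM; apply/sb/sa. Qed.

Lemma stable_tperm (T : finType) (s : seq T) x y :
  x \in s -> y \in s -> stable s (tperm x y).
Proof. by move=> xs ys z zs; case: tpermP. Qed.

Lemma stable_del (T : finType) (s t : seq T) y (a : {perm T}) :
  stable s a -> (forall z, (z \in t) = (z \in s) && (z != y)) ->
  stable t (del y a).
Proof.
move=> sa ts z; rewrite !ts => /andP[zs zy]; apply/andP; split; last first.
  by apply: contraNneq zy => e; rewrite -(inj_eq (@perm_inj _ (del y a))) e del_self.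
rewrite delE //; case: eqP => [azy|_]; last exact: sa.
by apply: (sa); rewrite -azy; apply: (sa).
Qed.

Lemma mem_rem_mid (T : eqType) (s1 s2 : seq T) y z :
  uniq (s1 ++ y :: s2) ->
  (z \in s1 ++ s2) = (z \in s1 ++ y :: s2) && (z != y).
Proof.
rewrite uniq_catC /= mem_cat negb_or => /andP[/andP[ys2 ys1] _].
rewrite !mem_cat inE; have [->|_] := eqVneq z y; last by rewrite andbT.
by rewrite andbF (negPf ys2) (negPf ys1).
Qed.

Lemma uniq_adj (T : eqType) (s1 s2 : seq T) x y : uniq (s1 ++ x :: y :: s2) ->
  [/\ x != y, x \notin s1, x \notin s2, y \notin s1 & y \notin s2].
Proof.
rewrite cat_uniq /= !inE !negb_or => /and3P[_].
by case/and3P=> xs1 ys1 _ /and3P[/andP[xy xs2] ys2 _]; split.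
Qed.

Lemma perm_adj (T : eqType) (s1 s2 : seq T) x y :
  perm_eq (s1 ++ y :: x :: s2) (s1 ++ x :: y :: s2).
Proof. by rewrite perm_cat2l (perm_catCA [:: y] [:: x]). Qed.

(** * Exchanging adjacent factors and rotating the product *)

Section CycleSum.
Context (V : finType) (S : nzRingType) (e : V -> V -> S) (v0 : V).

Definition wprod (T : eqType) (s : seq T) (a : T -> T) (i : T -> V) : S :=
  \prod_(l <- s) e (i l) (i (a l)).

(** [v0] only starts the iteration: when [s] is stable, every index that occurs is summed over. *)
Definition wsum (T : eqType) (s : seq T) (a : T -> T) : S :=
  asum s (wprod s a) (fun=> v0).

Lemma wsum_map (T T' : eqType) (h : T -> T') s a a' :
  {in s &, injective h} -> stable s a -> {in s, forall x, a' (h x) = h (a x)} ->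
  wsum (map h s) a' = wsum s a.
Proof.
move=> hI sa aa'; apply/esym/asum_map => // j j' jj'.
rewrite /wprod big_map big_seq [RHS]big_seq; apply: eq_bigr => x xs.
by rewrite aa' // !jj' // sa.
Qed.

Lemma eq_wsum (T : eqType) s (a b : T -> T) :
  stable s a -> {in s, a =1 b} -> wsum s a = wsum s b.
Proof.
move=> sa ab; rewrite -{2}[s]map_id; apply/esym/wsum_map => // x xs.
by rewrite ab.
Qed.

Lemma wsum_nil (T : eqType) (a : T -> T) : wsum [::] a = 1.
Proof. by rewrite /wsum /= /wprod big_nil. Qed.

Lemma wsum_cat (T : eqType) (s1 s2 : seq T) (a : T -> T) :
  ~~ has (mem s1) s2 -> stable s1 a -> stable s2 a ->
  wsum (s1 ++ s2) a = wsum s1 a * wsum s2 a.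
Proof.
move=> dis st1 st2; rewrite {1}/wsum asum_cat.
have asumMl s f (c : S) j : asum s (fun i : T -> V => c * f i) j = c * asum s f j.
  by elim: s j => //= x s IH j; rewrite mulr_sumr; apply: eq_bigr.
have asumMr s f (c : S) j : asum s (fun i : T -> V => f i * c) j = asum s f j * c.
  by elim: s j => //= x s IH j; rewrite mulr_suml; apply: eq_bigr.
rewrite -asumMr; apply: eq_asum => j.
have notin z : z \in s1 -> z \notin s2.
  by move=> zs1; apply: contra dis => zs2; apply/hasP; exists z.
rewrite (@eq_asum_off _ _ _ _ _ (fun i => wprod s1 a j * wprod s2 a i)).
  rewrite asumMl; congr (_ * _); rewrite -[in RHS](map_id s2).
  apply: (asum_map (h := id)) => // i i' ii'.
  rewrite /wprod map_id big_seq [RHS]big_seq; apply: eq_bigr => x xs.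
  by rewrite !ii' //; apply: st2.
move=> i ij; rewrite /wprod /= big_cat /=; congr (_ * _).
rewrite big_seq [RHS]big_seq; apply: eq_bigr => x xs.
by rewrite !ij // notin // st1.
Qed.

Hypothesis e_comm : forall a b c d, e a b * e c d =
  e c d * e a b + (e a d *+ (b == c) - e c b *+ (d == a)).

Lemma wsum_perm_asum (T : eqType) (s t : seq T) a :
  perm_eq s t -> asum t (wprod s a) (fun=> v0) = wsum s a.
Proof. by move=> st; apply/esym/asum_perm. Qed.

(* The elimination of the summation index of [y] against a Kronecker symbol. *)
Lemma wsum_contract (T : finType) (s1 s2 : seq T) x y (a : {perm T}) :
  uniq (s1 ++ x :: y :: s2) ->
  asum (s1 ++ x :: y :: s2) (fun i => wprod s1 a i *
    (e (i x) (i (a y)) *+ (i (a x) == i y)) * wprod s2 a i) (fun=> v0) =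
  wsum (s1 ++ x :: s2) (del y (tperm x y * a)%g) *+ (#|V| ^ (a x == y)).
Proof.
move=> us; set f := fun i => _.
have -> : asum (s1 ++ x :: y :: s2) f (fun=> v0) =
    asum ((s1 ++ x :: s2) ++ [:: y]) f (fun=> v0).
  by apply: asum_perm; rewrite -catA perm_cat2l /= perm_cons perm_sym perm_catC.
have [xy xs1 xs2 ys1 ys2] := uniq_adj us.
rewrite asum_cat -asumMn; apply: eq_asum => i /=.
set b := del y _.
have bE l : l != x -> l != y -> b l = if a l == y then a x else a l.
  move=> lx ly; have tl : tperm x y l = l by rewrite tpermD // eq_sym.
  by rewrite /b delE // !permM tl tpermR.
have bx : b x = if a y == y then a x else a y.
  by rewrite /b delE // !permM tpermL tpermR.
have wE s j : x \notin s -> y \notin s ->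
    (forall l, l \in s -> j (a l) = i (b l)) -> (forall z, z != y -> j z = i z) ->
    wprod s a j = wprod s b i.
  move=> xs ys h1 h2; rewrite /wprod big_seq [RHS]big_seq; apply: eq_bigr => l ls.
  by rewrite h1 // h2 //; apply: contraNneq ys => <-.
have nx l (s : seq T) z : z \notin s -> l \in s -> l != z.
  by move=> zs ls; apply: contraNneq zs => <-.
have -> : wprod (s1 ++ x :: s2) b i = wprod s1 b i * e (i x) (i (b x)) * wprod s2 b i.
  by rewrite /wprod big_cat big_cons /= mulrA.
(* If [a x = y], there is a closed loop: the index of [y] occurs in no remaining factor, and its
   free summation gives the factor [#|V|]. Otherwise the Kronecker symbol leaves the single value
   [i (a x)]. *)
have [axy|axy] := eqVneq (a x) y.
  rewrite -sumr_const; apply: eq_bigr => v _; rewrite /f /upd axy eqxx mulr1n.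
  have al l : l != x -> a l != y.
    by apply: contraNneq => e1; rewrite -(inj_eq (@perm_inj _ a)) e1 axy.
  rewrite (negPf xy); congr (_ * _ * _).
  - apply: wE => // [l ls|z /negPf-> //].
    by rewrite bE ?(nx _ s1) // !(negPf (al _ _)) ?(nx _ s1).
  - by rewrite bx (negPf (al y _)) // eq_sym.
  apply: wE => // [l ls|z /negPf-> //].
  by rewrite bE ?(nx _ s2) // !(negPf (al _ _)) ?(nx _ s2).
rewrite mulr1n (bigD1 (i (a x))) //= big1 ?addr0 => [|v vi]; last first.
  have vi' : i (a x) == v = false by rewrite eq_sym (negPf vi).
  by rewrite /f /upd (negPf axy) eqxx vi' mulr0n mulr0 mul0r.
rewrite /f /upd (negPf axy) eqxx eqxx mulr1n (negPf xy); congr (_ * _ * _).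
- apply: wE => // [l ls|z /negPf-> //].
  by rewrite bE ?(nx _ s1) //; case: eqP.
- by rewrite bx; case: eqP.
apply: wE => // [l ls|z /negPf-> //].
by rewrite bE ?(nx _ s2) //; case: eqP.
Qed.

(** [e_comm] is applied to the factors of [x] and [y]. Its two Kronecker symbols identify [i (a x)]
    with [i y] and [i (a y)] with [i x]; contracting the index of [y], respectively of [x], shows
    the second correction to be the first with [x] and [y] exchanged. *)
Lemma wsum_swap (T : finType) (s1 s2 : seq T) x y (a : {perm T}) :
  uniq (s1 ++ x :: y :: s2) ->
  wsum (s1 ++ x :: y :: s2) a = wsum (s1 ++ y :: x :: s2) a
    + wsum (s1 ++ x :: s2) (del y (tperm x y * a)%g) *+ (#|V| ^ (a x == y))
    - wsum (s1 ++ y :: s2) (del x (tperm x y * a)%g) *+ (#|V| ^ (a y == x)).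
Proof.
move=> us.
have pe := perm_adj s1 s2 x y.
have us' : uniq (s1 ++ y :: x :: s2) by rewrite (perm_uniq pe).
rewrite -wsum_contract // [tperm x y]tpermC -(wsum_contract a us').
rewrite (asum_perm _ _ pe) -(wsum_perm_asum a pe).
apply/eqP; rewrite eq_sym subr_eq; apply/eqP.
rewrite /wsum -!asumD; apply: eq_asum => i.
rewrite /wprod !big_cat !big_cons /= !mulrA -[_ * e (i x) _ * e (i y) _]mulrA.
rewrite e_comm mulrDr mulrDl !mulrA -addrA; congr (_ + _).
by rewrite mulrBr mulrBl subrK.
Qed.

(* Moving [x] through [s] produces the terms [t1 y - t2 y]; with [A z] the sum for the
   permutation in which the images of the predecessors of [a x] and [z] are exchanged
   once [x] is deleted, [t1 y = A y] and [t2 y = A (del x a y)], so they cancel. *)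
Lemma wsum_rotr (T : finType) (s : seq T) x (a : {perm T}) :
  uniq (x :: s) -> stable (x :: s) a -> wsum (x :: s) a = wsum (rcons s x) a.
Proof.
move=> us st; have /andP[xs us'] := us.
pose b y := del y (tperm x y * a)%g.
pose t1 y := wsum s (b y ^ tperm x y)%g *+ (#|V| ^ (a x == y)).
pose t2 y := wsum s (del x (tperm x y * a)%g) *+ (#|V| ^ (a y == x)).
have sb y : y \in s -> stable (x :: s) (tperm x y * a)%g.
  move=> ys; apply: stableM => //.
  by apply: stable_tperm; rewrite ?mem_head // inE ys orbT.
have telescope s1 s2 : s = s1 ++ s2 ->
    wsum (x :: s) a = wsum (s1 ++ x :: s2) a + \sum_(y <- s1) (t1 y - t2 y).
  elim/last_ind: s1 s2 => [|s1 y IH] s2 es; first by rewrite big_nil addr0 es.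
  have es' : s = s1 ++ y :: s2 by rewrite -cat_rcons.
  have pe : perm_eq (s1 ++ x :: y :: s2) (x :: s).
    by rewrite es' perm_sym -cat1s (perm_catCA [:: x] s1).
  have ys : y \in s by rewrite es' mem_cat mem_head orbT.
  rewrite (IH _ es') big_rcons /= wsum_swap ?(perm_uniq pe) //.
  suff e1 : wsum (s1 ++ x :: s2) (b y) *+ #|V| ^ (a x == y) = t1 y.
    have e2 : wsum (s1 ++ y :: s2) (del x (tperm x y * a)%g) *+ #|V| ^ (a y == x) = t2 y.
      by rewrite /t2 es'.
    rewrite e1 e2 cat_rcons -!addrA; congr (_ + _).
    by rewrite addrA [RHS]addrC.
  have ux : uniq (s1 ++ x :: y :: s2) by rewrite (perm_uniq pe).
  have [xy xs1 xs2 ys1 ys2] := uniq_adj ux.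
  (* Renaming [x] to [y] carries this correction from a list containing [x] to the list [s], so that
     all corrections live on the same points. *)
  have -> : t1 y = wsum (map (tperm x y) (s1 ++ x :: s2))
    (b y ^ tperm x y)%g *+ #|V| ^ (a x == y).
    have tid t : x \notin t -> y \notin t -> map (tperm x y) t = t.
      move=> xt yt; rewrite -[RHS]map_id; apply/eq_in_map => z zt.
      by rewrite tpermD //; apply: contraTneq zt => <-.
    by rewrite map_cat /= tpermL !tid // -es'.
  congr (_ *+ _); apply/esym/wsum_map => [z z' _ _ /perm_inj //||z _].
    apply: stable_del (sb _ ys) _ => z; rewrite -(perm_mem pe).
    have := @mem_rem_mid _ (rcons s1 x) s2 y z; rewrite !cat_rcons; exact.
  by rewrite permJ.
have {telescope} := telescope s [::]; rewrite cats0 cats1 => -> //.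
rewrite -[RHS]addr0; congr (_ + _); rewrite sumrB; apply/eqP; rewrite subr_eq0; apply/eqP.
have nx z : z \in s -> z != x by move=> zs; apply: contraNneq xs => <-.
have aI : injective a by apply: perm_inj.
have conjE y z : y \in s -> z \in s ->
    (b y ^ tperm x y)%g z = tperm x y (if a z == y then a x else a z).
  move=> /nx yx /nx zx; have xy : x != y by rewrite eq_sym.
  rewrite conjgE 2!permM tpermV; congr (tperm _ _ _).
  have [->|zy] := eqVneq z y; first by rewrite tpermR /b delE // !permM tpermL tpermR.
  have ez : tperm x y z = z by rewrite tpermD // eq_sym.
  by rewrite ez /b delE // !permM ez tpermR.
have del2E y z : y \in s -> z \in s -> del x (tperm x y * a)%g z =
    if z == y then (if a x == x then a y else a x) else if a z == x then a y else a z.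
  move=> /nx yx /nx zx; rewrite delE // !permM tpermL; have [->|zy] := eqVneq z y.
    by rewrite tpermR.
  by rewrite tpermD // eq_sym.
have [axx|axx] := eqVneq (a x) x.
  apply: eq_big_seq => y ys; have yx := nx _ ys.
  have ax z : z \in s -> a z == x = false.
    by move=> /nx/negPf zx; rewrite -{1}axx (inj_eq aI).
  have sa : stable s a.
    by move=> z zs; have := st z; rewrite !inE zs orbT (ax _ zs) => /(_ isT).
  rewrite /t1 /t2 axx eq_sym (negPf yx) ax //.
  congr (_ *+ _); transitivity (wsum s a); [apply/esym|]; apply: eq_wsum => // z zs.
    rewrite conjE // axx; have [->|azy] := eqVneq (a z) y; first by rewrite tpermL.
    by rewrite tpermD // 1?eq_sym // ax.
  by rewrite del2E // axx eqxx ax //; have [->|] := eqVneq z y.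
pose A z := wsum s (del x a * tperm (a x) z)%g *+ (#|V| ^ (a x == z)).
have axs : a x \in s.
  by have := st x (mem_head _ _); rewrite inE (negPf axx).
have sd : stable s (del x a).
  apply: stable_del st _ => z; rewrite inE; have [->|] := eqVneq z x; last by rewrite andbT.
  by rewrite (negPf xs).
have dxE z : z \in s -> del x a z = if a z == x then a x else a z.
  by move/nx=> zx; rewrite delE.
have axz z : z \in s -> a z == a x = false by move/nx/negPf=> zx; rewrite (inj_eq aI).
rewrite (eq_big_seq A) => [|y ys]; last first.
  congr (_ *+ _); apply/esym/eq_wsum => [|z zs].
    by apply: stableM => //; apply: stable_tperm.
  rewrite conjE // permM dxE //; have yx := nx _ ys.
  case: (eqVneq (a z) y) => [azy|azy].
    have qy : y == a x = false by rewrite -azy axz.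
    by rewrite azy (negPf yx) tpermR tpermD // ?qy // eq_sym.
  have [->|azx] := eqVneq (a z) x; first by rewrite !tpermL.
  by rewrite !tpermD 1?eq_sym // axz.
rewrite [RHS](eq_big_seq (fun y => A (del x a y))) => [|y ys]; last first.
  congr (_ *+ (_ ^ _)%N); last first.
    by rewrite dxE //; have [_|_] := eqVneq (a y) x; rewrite ?eqxx // eq_sym axz.
  apply/esym/eq_wsum => [|z zs].
    by apply: stableM => //; apply: stable_tperm => //; apply: sd.
  rewrite del2E // (negPf axx) permM; have [->|zy] := eqVneq z y.
    by rewrite tpermR.
  rewrite [del x a z]dxE //; have [azx|azx] := eqVneq (a z) x.
    by rewrite tpermL dxE // -azx (inj_eq aI) eq_sym (negPf zy).
  rewrite tpermD // 1?eq_sym ?axz // dxE //.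
  by case: ifP; rewrite ?axz // (inj_eq aI) zy.
(* [del x a] permutes the points of [s], so the two sums have the same terms in a different
   order. *)
rewrite -[RHS](big_map _ xpredT A); apply: perm_big.
apply: uniq_perm => //; first by rewrite map_inj_uniq //; exact: perm_inj.
move=> z; rewrite -[z in LHS](permKV (del x a)) -[z in RHS](permKV (del x a)).
by rewrite mem_map ?(stable_perm _ sd) //; exact: perm_inj.
Qed.
End CycleSum.

(** * Evaluation homomorphisms and U(gl_N) *)

Section CommutingProducts.
Context (S : nzRingType) (c : nat -> S).
Hypothesis cC : forall j k, GRing.comm (c j) (c k).

Lemma comm_prodX (s t : seq nat) (d d' : nat -> nat) :
  GRing.comm (\prod_(k <- s) c k ^+ d k) (\prod_(k <- t) c k ^+ d' k).
Proof.
apply: commr_prod => j _; apply: commr_sym; apply: commr_prod => k _.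
by apply: commrX; apply: commr_sym; apply: commrX.
Qed.

Lemma perm_prodX (s t : seq nat) (d : nat -> nat) : perm_eq s t ->
  \prod_(k <- s) c k ^+ d k = \prod_(k <- t) c k ^+ d k.
Proof.
move=> st; pose P u := \prod_(k <- s) c k ^+ d k = \prod_(k <- u) c k ^+ d k.
apply: (perm_swap_ind (P := P)) st _ => // s1 x y s2; rewrite /P => ->.
rewrite !big_cat !big_cons /=; congr (_ * _); rewrite !mulrA; congr (_ * _).
by apply: commrX; apply: commr_sym; apply: commrX; apply: cC.
Qed.

Lemma mpowEw (d : {fset nat}) (m : {cmonom nat}) : (finsupp m `<=` d)%fset ->
  mpow c m = \prod_(k <- d) c k ^+ m k.
Proof.
move=> md; have pe : perm_eq d (finsupp m ++ (d `\` finsupp m)%fset).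
  apply: uniq_perm; rewrite ?fset_uniq // ?cat_uniq ?fset_uniq /= ?andbT //.
    by apply/hasPn => k; rewrite in_fsetD => /andP[].
  move=> k; rewrite mem_cat in_fsetD; case: (boolP (k \in finsupp m)) => //=.
  by move/(fsubsetP md).
rewrite (perm_prodX _ pe) big_cat /= [X in _ * X]big1_seq ?mulr1 // => k /andP[_].
by rewrite in_fsetD => /andP[km _]; rewrite fsfun_dflt ?expr0.
Qed.

Lemma prodXD (s : seq nat) (d d' : nat -> nat) :
  \prod_(k <- s) c k ^+ (d k + d' k) =
  \prod_(k <- s) c k ^+ d k * \prod_(k <- s) c k ^+ d' k.
Proof.
elim: s => [|x s IH]; first by rewrite !big_nil mulr1.
rewrite !big_cons IH exprD !mulrA; congr (_ * _); rewrite -!mulrA; congr (_ * _).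
by have := comm_prodX s [:: x] d d'; rewrite big_seq1 => ->.
Qed.

Lemma mpow_mmorphism : mmorphism (mpow c).
Proof.
split=> [m1 m2|]; last by rewrite /mpow mdom1 big_seq_fset0.
pose d := finsupp (mmul m1 m2 : {cmonom nat}).
have [d1 d2] : (finsupp m1 `<=` d)%fset /\ (finsupp m2 `<=` d)%fset.
  by rewrite /d mdomD fsubsetUl fsubsetUr.
rewrite (mpowEw d1) (mpowEw d2) /mpow -prodXD; apply: eq_bigr => k _.
by rewrite cmM.
Qed.

Lemma mpowU k : mpow c (ucm k) = c k.
Proof. by rewrite /mpow mdomU big_seq_fset1 cmUU. Qed.
End CommutingProducts.

Section GlEval.
Context (K : fieldType) (S : nzRingType) (phi : {rmorphism K -> S}).
Context (n : S) (c : nat -> S).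
Hypothesis phiC : forall a s, GRing.comm (phi a) s.
Hypothesis nC : forall s, GRing.comm n s.
Hypothesis cC : forall j k, GRing.comm (c j) (c k).

(** [gl_eval] is a bare sum; with central scalars, central [n] and commuting [c k], it is evaluation
    at [n] after substitution in the coefficients, hence a ring morphism. It serves both the
    specialization to U(gl_N) and the substitution of the p_k. *)
Lemma gl_eval_morphism : exists f : {rmorphism gl_poly K -> S},
  [/\ gl_eval phi n c =1 f, f 'X = n, (forall k, f (pvar K k)%:P = c k)
    & forall a, f (<< a *g mone >>%:P) = phi a].
Proof.
pose h : {mmorphism {cmonom nat} -> S} := HB.pack (mpow c)
  (isMultiplicative.Build _ _ (mpow c) (mpow_mmorphism cC)).
have gm : multiplicative (mmap phi h) by apply: commr_mmap_is_multiplicative.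
pose g : {rmorphism pol_alg K -> S} := HB.pack (mmap phi h)
  (GRing.isMultiplicative.Build _ _ (mmap phi h) gm).
pose f0 (F : gl_poly K) := (map_poly g F).[n].
have fa : additive f0 by move=> x y; rewrite /f0 raddfB hornerD hornerN.
have fm : multiplicative f0.
  split=> [x y|]; last by rewrite /f0 rmorph1 hornerC.
  by rewrite /f0 rmorphM /= hornerM_comm //; apply: nC.
pose f : {rmorphism gl_poly K -> S} := HB.pack f0 (GRing.isAdditive.Build _ _ f0 fa)
  (GRing.isMultiplicative.Build _ _ f0 fm).
exists f; split=> [F||k|a] /=.
- rewrite /f0 (horner_coef_wide _ (size_poly _ _)) /gl_eval.
  by apply: eq_bigr => d _; rewrite coef_map; apply/esym/commrX/commr_sym/nC.
- by rewrite /f0 map_polyX hornerX.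
- by rewrite /f0 map_polyC hornerC /= /pvar mmapU /= rmorph1 mul1r mpowU.
by rewrite /f0 map_polyC hornerC /= mmapU /= (mpow_mmorphism cC).2 mulr1.
Qed.
End GlEval.

Lemma malgC_comm (K : fieldType) (M : monomType) (a : K) (x : {malg K[M]}) :
  GRing.comm << a *g mone >> x.
Proof.
rewrite /GRing.comm !malgM_def fgmulUg fgmulgU; apply: eq_bigr => k _.
by rewrite mul1m mulm1 mulrC.
Qed.

Section UglRing.
Local Open Scope quotient_scope.
Context (K : fieldType) (N : nat).
Implicit Types x y z : gl_free K N.

Lemma Ugl_idealN x : Ugl_ideal x -> Ugl_ideal (- x).
Proof. by move=> Ix; rewrite -mulN1r; apply: Ugl_mull. Qed.

(** The constant coefficient is a ring morphism that kills the generators, hence the relations.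
    Consequently 1 lies outside the ideal and the quotient is a nonzero ring. *)
Lemma Ugl_ideal_counit x : Ugl_ideal x -> x@_(mone : {fmonom ('I_N * 'I_N)%type}) = 0.
Proof.
have c1M := (@mcoeff1g_is_multiplicative {fmonom ('I_N * 'I_N)%type} K).1.
elim=> [i j k l||? ? _ e1 _ e2|a ? _ e|a ? _ e].
- have g0 a b : (gl_gen K a b)@_(mone : {fmonom ('I_N * 'I_N)%type}) = 0 :> K.
    by rewrite mcoeffU1 fm1_eq1.
  have g2 a b c d : (gl_gen K a b * gl_gen K c d)@_(mone : {fmonom ('I_N * 'I_N)%type})
    = 0 :> K.
    by apply: etrans (c1M (gl_gen K a b) (gl_gen K c d)) _; rewrite !g0 mul0r.
  rewrite /gl_rel; move: (g2 i j k l) (g2 k l i j) (g0 i l) (g0 k j).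
  move: (gl_gen K i j * gl_gen K k l) (gl_gen K k l * gl_gen K i j).
  move: (gl_gen K i l) (gl_gen K k j) => A B C D c d a b.
  by rewrite !(mcoeffB, mcoeffMn) a b c d !mul0rn !subrr.
- exact: mcoeff0.
- by rewrite mcoeffD e1 e2 addr0.
- by apply: etrans (c1M _ _) _; rewrite e mulr0.
by apply: etrans (c1M _ _) _; rewrite e mul0r.
Qed.

Definition Ugl_eqb x y : bool := `[< Ugl_eq x y >].

Lemma Ugl_eqb_equiv : equiv_class_of Ugl_eqb.
Proof.
split=> [x|x y|y x z]; rewrite /Ugl_eqb.
- by apply/asboolP; rewrite /Ugl_eq subrr; apply: Ugl_0.
- apply/asboolP/asboolP => /Ugl_idealN; rewrite /Ugl_eq opprB //.
move=> /asboolP xy /asboolP yz; apply/asboolP.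
by rewrite /Ugl_eq -[x](subrK y) -addrA; apply: Ugl_add.
Qed.

Canonical Ugl_equiv := EquivRelPack Ugl_eqb_equiv.

Definition Ugl := {eq_quot Ugl_eqb}.
HB.instance Definition _ := Choice.on Ugl.
HB.instance Definition _ := EqQuotient.on Ugl.

Definition Upi x : Ugl := \pi_Ugl x.

Lemma UpiP x y : Upi x = Upi y <-> Ugl_eq x y.
Proof.
by split=> [/eqP|xy]; [rewrite /Upi piE => /asboolP|apply/eqP; rewrite /Upi piE;
  apply/asboolP].
Qed.

Lemma Upi_repr x : Ugl_eq (generic_quotient.repr (Upi x)) x.
Proof. by apply/UpiP; rewrite /Upi reprK. Qed.

Lemma Ugl_ind (P : Ugl -> Prop) : (forall x, P (Upi x)) -> forall u, P u.
Proof. by move=> h u; rewrite -[u]reprK; apply: h. Qed.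

Definition Uadd (u v : Ugl) := Upi (generic_quotient.repr u + generic_quotient.repr v).
Definition Uopp (u : Ugl) := Upi (- generic_quotient.repr u).
Definition Umul (u v : Ugl) := Upi (generic_quotient.repr u * generic_quotient.repr v).

Lemma UaddE x y : Uadd (Upi x) (Upi y) = Upi (x + y).
Proof.
apply/UpiP; rewrite /Ugl_eq opprD addrACA.
by apply: Ugl_add; apply: Upi_repr.
Qed.

Lemma UoppE x : Uopp (Upi x) = Upi (- x).
Proof. by apply/UpiP; rewrite /Ugl_eq -opprD; apply/Ugl_idealN/Upi_repr. Qed.

Lemma UmulE x y : Umul (Upi x) (Upi y) = Upi (x * y).
Proof.
apply/UpiP; rewrite /Ugl_eq; set x' := _ (Upi x); set y' := _ (Upi y).
have -> : x' * y' - x * y = (x' - x) * y' + x * (y' - y).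
  by rewrite mulrBl mulrBr addrA subrK.
by apply: Ugl_add; [apply/Ugl_mulr/Upi_repr|apply/Ugl_mull/Upi_repr].
Qed.

Lemma UaddA : associative Uadd.
Proof.
by elim/Ugl_ind=> x; elim/Ugl_ind=> y; elim/Ugl_ind=> z; rewrite !UaddE addrA.
Qed.
Lemma UaddC : commutative Uadd.
Proof. by elim/Ugl_ind=> x; elim/Ugl_ind=> y; rewrite !UaddE addrC. Qed.
Lemma Uadd0 : left_id (Upi 0) Uadd.
Proof. by elim/Ugl_ind=> x; rewrite UaddE add0r. Qed.
Lemma UaddN : left_inverse (Upi 0) Uopp Uadd.
Proof. by elim/Ugl_ind=> x; rewrite UoppE UaddE addNr. Qed.

HB.instance Definition _ := GRing.isZmodule.Build Ugl UaddA UaddC Uadd0 UaddN.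

Lemma UmulA : associative Umul.
Proof.
by elim/Ugl_ind=> x; elim/Ugl_ind=> y; elim/Ugl_ind=> z; rewrite !UmulE mulrA.
Qed.
Lemma Umul1 : left_id (Upi 1) Umul.
Proof. by elim/Ugl_ind=> x; rewrite UmulE mul1r. Qed.
Lemma Umulr1 : right_id (Upi 1) Umul.
Proof. by elim/Ugl_ind=> x; rewrite UmulE mulr1. Qed.
Lemma UmulDl : left_distributive Umul Uadd.
Proof.
by elim/Ugl_ind=> x; elim/Ugl_ind=> y; elim/Ugl_ind=> z; rewrite !(UmulE, UaddE) mulrDl.
Qed.
Lemma UmulDr : right_distributive Umul Uadd.
Proof.
by elim/Ugl_ind=> x; elim/Ugl_ind=> y; elim/Ugl_ind=> z; rewrite !(UmulE, UaddE) mulrDr.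
Qed.
Lemma Uone_neq0 : Upi 1 != Upi 0.
Proof.
apply/eqP => /UpiP /Ugl_ideal_counit; rewrite subr0 mcoeff1 eqxx => /eqP.
by rewrite oner_eq0.
Qed.

HB.instance Definition _ := GRing.Zmodule_isNzRing.Build Ugl UmulA Umul1 Umulr1
  UmulDl UmulDr Uone_neq0.

Lemma Upi_additive : additive Upi.
Proof. by move=> x y; rewrite -[RHS]/(Uadd (Upi x) (Uopp (Upi y))) UoppE UaddE. Qed.
Lemma Upi_multiplicative : multiplicative Upi.
Proof. by split=> [x y|]; [rewrite -[RHS]/(Umul (Upi x) (Upi y)) UmulE|]. Qed.
HB.instance Definition _ := GRing.isAdditive.Build _ _ Upi Upi_additive.
HB.instance Definition _ := GRing.isMultiplicative.Build _ _ Upi Upi_multiplicative.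

Definition Ugen (i j : 'I_N) : Ugl := Upi (gl_gen K i j).

Lemma Upi_comm_rel x y z w (a b : nat) :
  Ugl_ideal (x * y - y * x - (z *+ a - w *+ b)) ->
  Upi x * Upi y = Upi y * Upi x + (Upi z *+ a - Upi w *+ b).
Proof.
rewrite -[X in Ugl_ideal X]subr0 => /UpiP Uxy.
have Mn u n : Upi (u *+ n) = Upi u *+ n by apply: raddfMn.
have M u v : Upi (u * v) = Upi u * Upi v := Upi_multiplicative.1 u v.
have B u v u' v' : Upi u = u' -> Upi v = v' -> Upi (u - v) = u' - v'.
  by move=> <- <-; apply: Upi_additive.
have /eqP := etrans (esym (B _ _ _ _ (B _ _ _ _ (M x y) (M y x))
  (B _ _ _ _ (Mn z a) (Mn w b)))) (etrans Uxy (raddf0 Upi)).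
by rewrite subr_eq0 subr_eq addrC => /eqP.
Qed.

Lemma Ugen_comm i j k l : Ugen i j * Ugen k l =
  Ugen k l * Ugen i j + (Ugen i l *+ (j == k) - Ugen k j *+ (l == i)).
Proof. by rewrite [l == i]eq_sym; apply/Upi_comm_rel/Ugl_rel. Qed.

Definition Uscal (a : K) : Ugl := Upi (<< a *g mone >>).

Lemma Uscal_additive : additive Uscal.
Proof. by move=> a b; rewrite /Uscal monalgUB rmorphB. Qed.
Lemma Uscal_multiplicative : multiplicative Uscal.
Proof. by split=> [a b|]; [rewrite /Uscal mpolyCM rmorphM|rewrite -(rmorph1 Upi)]. Qed.
HB.instance Definition _ := GRing.isAdditive.Build _ _ Uscal Uscal_additive.
HB.instance Definition _ := GRing.isMultiplicative.Build _ _ Uscal Uscal_multiplicative.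

Lemma Uscal_comm a u : GRing.comm (Uscal a) u.
Proof.
elim/Ugl_ind: u => x; apply: etrans (esym (Upi_multiplicative.1 _ x)) _.
apply: etrans _ (Upi_multiplicative.1 x _); apply: (congr1 Upi); exact: malgC_comm.
Qed.

End UglRing.

(** * Rotation invariance and commuting cycles *)

Section CycleSumConsequences.
Context (V : finType) (S : nzRingType) (e : V -> V -> S) (v0 : V).
Hypothesis e_comm : forall a b c d, e a b * e c d =
  e c d * e a b + (e a d *+ (b == c) - e c b *+ (d == a)).
Notation wsum := (wsum e v0).

Lemma wsum_catC (T : finType) (s1 s2 : seq T) (a : {perm T}) :
  uniq (s1 ++ s2) -> stable (s1 ++ s2) a -> wsum (s1 ++ s2) a = wsum (s2 ++ s1) a.
Proof.
elim: s1 s2 => [|x s1 IH] s2 us st; first by rewrite cats0.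
rewrite cat_cons wsum_rotr // rcons_cat IH ?cat_rcons //.
  by rewrite -rcons_cat -cats1 uniq_catC.
by move=> z; rewrite -rcons_cat !mem_rcons; apply: st.
Qed.

(** The map [j |-> iter j a x] renames the standard cycle into the cycle of [x]. The list must be
    the orbit in its own order, because the factors do not commute. *)
Lemma wsum_orbit (T : finType) (a : {perm T}) x k : fingraph.order a x = k.+1 ->
  wsum (fingraph.orbit a x) a = wsum (enum 'I_k.+1) (std_cycle k.+1).
Proof.
move=> ok; pose h (j : 'I_k.+1) := iter j a x.
have <- : map h (enum 'I_k.+1) = fingraph.orbit a x.
  rewrite /fingraph.orbit ok (map_comp (fun j => iter j a x) val) val_enum_ord.
  apply: (@eq_from_nth _ x); rewrite ?size_map ?size_iota ?size_traject // => j jk.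
  by rewrite nth_traject // (nth_map 0%N) ?size_iota ?nth_iota.
apply: wsum_map.
- move=> i j _ _; rewrite /h => /eqP.
  rewrite -(nth_traject a (ltn_ord i) x) -(nth_traject a (ltn_ord j) x).
  have ut : uniq (traject a x k.+1).
    by rewrite -ok; apply: orbit_uniq; exact: perm_inj.
  by rewrite nth_uniq ?size_traject // => /eqP/val_inj.
- by move=> i _; rewrite mem_enum.
move=> i _; rewrite /h -iterS permE /=.
have [ek|ik] := eqVneq i.+1 k.+1; last by rewrite modn_small // ltn_neqAle ik ltn_ord.
by rewrite ek modnn /= -[RHS](iter_order (@perm_inj _ a)) ok; case: ek => ->.
Qed.

(** Both products are cycle sums of the same concatenated permutation, along [s1 ++ s2] and
    [s2 ++ s1], which differ by a rotation. *)
Lemma wsum_cycle_comm j k :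
  GRing.comm (wsum (enum 'I_j) (std_cycle j)) (wsum (enum 'I_k) (std_cycle k)).
Proof.
pose a := concat (std_cycle j) (std_cycle k).
pose s1 := map (lshift k) (enum 'I_j); pose s2 := map (@rshift j k) (enum 'I_k).
have w1 : wsum s1 a = wsum (enum 'I_j) (std_cycle j).
  apply: wsum_map => [? ? _ _ /lshift_inj //|i _|i _]; first by rewrite mem_enum.
  by rewrite concat_lshift.
have w2 : wsum s2 a = wsum (enum 'I_k) (std_cycle k).
  apply: wsum_map => [? ? _ _ /rshift_inj //|i _|i _]; first by rewrite mem_enum.
  by rewrite concat_rshift.
have st1 : stable s1 a.
  by move=> _ /mapP[i _ ->]; rewrite concat_lshift map_f ?mem_enum.
have st2 : stable s2 a.
  by move=> _ /mapP[i _ ->]; rewrite concat_rshift map_f ?mem_enum.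
have dis : ~~ has (mem s1) s2.
  apply/hasPn => _ /mapP[i _ ->]; apply/mapP => -[i' _ /eqP].
  by rewrite eq_rlshift.
have dis' : ~~ has (mem s2) s1 by rewrite has_sym.
rewrite /GRing.comm -w1 -w2 -!wsum_cat // wsum_catC //.
  rewrite cat_uniq dis (map_inj_uniq (@lshift_inj _ _)).
  by rewrite (map_inj_uniq (@rshift_inj _ _)) !enum_uniq.
by move=> z; rewrite !mem_cat => /orP[/st1->|/st2->] //; rewrite orbT.
Qed.
End CycleSumConsequences.

(** * Polynomials realizing a cycle sum in every U(gl_N) *)

Section Realization.
Context (K : fieldType).

Definition UW n (T : eqType) (s : seq T) (a : T -> T) : Ugl K n.+1 :=
  wsum (@Ugen K n.+1) ord0 s a.

Lemma Upi_w_glN n m (a : 'S_m) : Upi (w_glN K n.+1 a) = UW n (enum 'I_m) a.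
Proof.
rewrite /UW /wsum asum_all ?enum_uniq // => [|x]; last by rewrite mem_enum.
apply: etrans (raddf_sum _ _ _ _) _; apply: eq_bigr => i _.
apply: etrans (rmorph_prod _ _ _ _) _.
by rewrite /wprod [index_enum _]unlock enumT.
Qed.

Definition Uspec n (F : gl_poly K) : Ugl K n.+1 := Upi (gl_specialize n.+1 F).

(** In the free algebra the lifts of the C_k need not commute, so multiplicativity is obtained only
    for the class of [gl_specialize] in the quotient, where [wsum_cycle_comm] applies. *)
Lemma Uspec_morphism n : exists f : {rmorphism gl_poly K -> Ugl K n.+1},
  [/\ Uspec n =1 f, f 'X = n.+1%:R &
      forall k, f (pvar K k)%:P = UW n (enum 'I_k.+1) (std_cycle k.+1)].
Proof.
have [| |j k|f [fE fX fv _]] := @gl_eval_morphism K (Ugl K n.+1) (@Uscal K n.+1) n.+1%:R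
  (fun k => UW n (enum 'I_k.+1) (std_cycle k.+1)).
- exact: Uscal_comm.
- by move=> s; apply/commr_sym/commr_nat.
- by apply: wsum_cycle_comm; apply: Ugen_comm.
exists f; split=> [F| |] //; rewrite -fE /Uspec /gl_specialize /gl_eval.
apply: etrans (raddf_sum _ _ _ _) _; apply: eq_bigr => d _.
apply: etrans (rmorphM _ _ _) _; apply: (congr2 *%R).
  by apply: etrans (rmorphXn _ _ _) _; apply: (congr1 (fun x => x ^+ d)); apply: rmorph_nat.
rewrite /mmap; apply: etrans (raddf_sum _ _ _ _) _; apply: eq_bigr => m _.
apply: etrans (rmorphM _ _ _) _; apply: (congr2 *%R); first by [].
apply: etrans (rmorph_prod _ _ _ _) _; apply: eq_bigr => k _.
apply: etrans (rmorphXn _ _ _) _; apply: (congr1 (fun x => x ^+ m k)); exact: Upi_w_glN.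
Qed.

Definition realizes (T : eqType) (F : gl_poly K) (s : seq T) (a : T -> T) : Prop :=
  forall n, Uspec n F = UW n s a.

Lemma realizes_gl m (F : gl_poly K) (a : 'S_m) :
  realizes F (enum 'I_m) a <->
  forall N, (0 < N)%N -> Ugl_eq (gl_specialize N F) (w_glN K N a).
Proof.
split=> [r [//|n] _|r n]; first by apply/UpiP; rewrite Upi_w_glN -r.
by rewrite -Upi_w_glN; apply/UpiP/r.
Qed.

End Realization.

(** * Uniqueness of the universal polynomial *)

Section GlAction.
Context (K : fieldType) (N : nat) (B : comNzRingType) (phi : {rmorphism K -> B}).
Context (d : 'I_N -> 'I_N -> {additive B -> B}) (x : 'I_N -> 'I_N -> B).
Hypothesis d_scal : forall i j c b, d i j (phi c * b) = phi c * d i j b.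
Hypothesis d_x : forall i j k l b,
  d i j (x k l * b) = x k l * d i j b + x i l * b *+ (j == k).
Hypothesis d_comm : forall i j k l b,
  d i j (d k l b) = d k l (d i j b) + (d i l b *+ (j == k) - d k j b *+ (i == l)).
Implicit Types (f g : nat -> B) (u v : gl_free K N).

(* On sequences [f] standing for the formal series with coefficients [f n] this is
   the operator [d i j + t * x i j]; by [d_x] and [d_comm] these operators satisfy
   the relations of gl(N), and the top coefficient in [t] of a word of generators
   is the product of the corresponding [x i j] ([symb]). *)
Definition act_gen (p : 'I_N * 'I_N) f : nat -> B :=
  fun n => d p.1 p.2 (f n) + x p.1 p.2 * (if n is n'.+1 then f n' else 0).

Definition act_word (w : seq ('I_N * 'I_N)) f : nat -> B := foldr act_gen f w.

Definition gl_act u f : nat -> B :=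
  fun n => mmap phi (fun w : {fmonom ('I_N * 'I_N)%type} => act_word w f n) u.

Lemma act_word_lin (I : eqType) (r : seq I) (c : I -> K) (g : I -> nat -> B) w n :
  act_word w (fun m => \sum_(i <- r) phi (c i) * g i m) n =
  \sum_(i <- r) phi (c i) * act_word w (g i) n.
Proof.
elim: w n => //= p w IH n.
have -> : act_word w (fun m => \sum_(i <- r) phi (c i) * g i m) =
    fun n => \sum_(i <- r) phi (c i) * act_word w (g i) n by apply/funext.
rewrite /act_gen raddf_sum /=; case: n => [|n].
  rewrite mulr0 addr0; apply: eq_bigr => i _; rewrite ?mulr0 addr0; exact: d_scal.
rewrite mulr_sumr -big_split /=; apply: eq_bigr => i _.
by rewrite d_scal mulrDr; congr (_ + _); rewrite mulrCA.
Qed.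

Lemma gl_actD u v f n : gl_act (u + v) f n = gl_act u f n + gl_act v f n.
Proof. by rewrite /gl_act raddfD. Qed.

Lemma gl_actB u v f n : gl_act (u - v) f n = gl_act u f n - gl_act v f n.
Proof. by rewrite /gl_act raddfB. Qed.

Lemma gl_actU c w f n : gl_act << c *g w >> f n = phi c * act_word w f n.
Proof. by rewrite /gl_act mmapU. Qed.

Lemma gl_act_sum (I : Type) (r : seq I) (P : pred I) (F : I -> gl_free K N) f n :
  gl_act (\sum_(i <- r | P i) F i) f n = \sum_(i <- r | P i) gl_act (F i) f n.
Proof. by rewrite /gl_act raddf_sum. Qed.

Lemma gl_actM u v f n : gl_act (u * v) f n = gl_act u (gl_act v f) n.
Proof.
rewrite malgME gl_act_sum [RHS]/gl_act mmapE; apply: eq_bigr => w _.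
rewrite gl_act_sum /= act_word_lin mulr_sumr; apply: eq_bigr => w' _.
by rewrite gl_actU rmorphM -mulrA /act_word fmM foldr_cat.
Qed.

Lemma gl_act0 u n : gl_act u (fun=> 0) n = 0.
Proof.
rewrite /gl_act mmapE big1 // => w _.
suff -> : act_word w (fun=> 0) = fun=> 0 by rewrite mulr0.
elim: {w}(w : seq _) => [//|p w IH]; rewrite /= IH; apply/funext => m.
by rewrite /act_gen raddf0; case: m => [|m]; rewrite mulr0 addr0.
Qed.

Lemma gl_act_gen i j f : gl_act (gl_gen K i j) f = act_gen (i, j) f.
Proof. by apply/funext => n; rewrite gl_actU rmorph1 mul1r /act_word fmU. Qed.

Lemma gl_act_ideal u : Ugl_ideal u -> forall f n, gl_act u f n = 0.
Proof.
elim=> [i j k l||u1 u2 _ e1 _ e2|a u1 _ e|a u1 _ e] f n.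
- have rel p q r s (a b : bool) : gl_act (p * q - q * p - (r *+ a - s *+ b)) f n =
      gl_act p (gl_act q f) n - gl_act q (gl_act p f) n
      - (gl_act r f n *+ a - gl_act s f n *+ b).
    have Mn y c : gl_act (y *+ c) f n = gl_act y f n *+ c by apply: raddfMn.
    have Bc y z y' z' : gl_act y f n = y' -> gl_act z f n = z' ->
        gl_act (y - z) f n = y' - z'.
      by move=> <- <-; apply: gl_actB.
    exact: Bc (Bc _ _ _ _ (gl_actM p q f n) (gl_actM q p f n))
      (Bc _ _ _ _ (Mn r a) (Mn s b)).
  rewrite /gl_rel rel !gl_act_gen /act_gen /= {rel u}.
  case: n => [|n]; first rewrite !mulr0 !addr0 d_comm.
    by case: (j == k); case: (i == l); rewrite ?mulr1n ?mulr0n; ring.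
  rewrite !raddfD /= !d_x d_comm [l == i]eq_sym.
  case: (j == k); case: (i == l); rewrite ?mulr1n ?mulr0n; ring.
- by rewrite /gl_act raddf0.
- by rewrite gl_actD e1 e2 addr0.
- rewrite gl_actM (_ : gl_act u1 f = fun=> 0) ?gl_act0 //.
  by apply/funext => m; apply: e.
by rewrite gl_actM.
Qed.

(** With [f] read as a polynomial in t of degree at most [m]: [u] raises this degree by at most [k],
    and its top part multiplies by [s]. Quantifying over all [f] is what lets symbols be
    multiplied. *)
Definition symb k (s : B) u := forall f m, (forall n, (m < n)%N -> f n = 0) ->
  (forall n, (m + k < n)%N -> gl_act u f n = 0) /\ gl_act u f (m + k)%N = s * f m.

Lemma symb_gen i j : symb 1 (x i j) (gl_gen K i j).
Proof.
move=> f m fm; have e n : gl_act (gl_gen K i j) f n = act_gen (i, j) f n.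
  by rewrite gl_act_gen.
split=> [n mn|]; rewrite e /act_gen /=.
  case: n mn => [|n]; first by rewrite ltn0.
  by rewrite addn1 ltnS => mn; rewrite !fm ?raddf0 ?mulr0 ?addr0 // ltnW.
by rewrite addn1 fm // raddf0 add0r.
Qed.

Lemma symbM k s u k' s' u' : symb k s u -> symb k' s' u' -> symb (k + k') (s * s') (u * u').
Proof.
move=> h h' f m fm; have [z' e'] := h' f m fm; have [z e] := h _ _ z'.
rewrite (addnC k) addnA; split=> [n mn|]; rewrite gl_actM; first exact: z.
by rewrite e e' mulrA.
Qed.

Lemma symb1 : symb 0 1 1.
Proof.
have a1 f n : gl_act 1 f n = f n by rewrite gl_actU rmorph1 mul1r /act_word fm1.
by move=> f m fm; split=> [n|]; rewrite ?addn0 ?mul1r a1 //; apply: fm.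
Qed.

Lemma symb_scal c : symb 0 (phi c) << c *g mone >>.
Proof.
have a1 f n : gl_act << c *g mone >> f n = phi c * f n by rewrite gl_actU /act_word fm1.
by move=> f m fm; split=> [n|]; rewrite ?addn0 a1 // => /fm ->; rewrite mulr0.
Qed.

Lemma symbD k s u s' u' : symb k s u -> symb k s' u' -> symb k (s + s') (u + u').
Proof.
move=> h h' f m fm; have [z e] := h f m fm; have [z' e'] := h' _ _ fm.
split=> [n mn|]; rewrite gl_actD; last by rewrite e e' mulrDl.
by rewrite z // z' // addr0.
Qed.

Lemma symb0 k : symb k 0 0.
Proof. by move=> f m fm; split=> [n|]; rewrite /gl_act raddf0 ?mul0r. Qed.

Lemma symb_sum (I : Type) (r : seq I) (P : pred I) k (s : I -> B) (F : I -> gl_free K N) :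
  (forall i, P i -> symb k (s i) (F i)) ->
  symb k (\sum_(i <- r | P i) s i) (\sum_(i <- r | P i) F i).
Proof.
move=> h; elim: r => [|i r IH]; first by rewrite !big_nil; apply: symb0.
by rewrite !big_cons; case: ifP => // Pi; apply: symbD => //; apply: h.
Qed.

Lemma symb_prod (I : Type) (r : seq I) (k : I -> nat) (s : I -> B) (F : I -> gl_free K N) :
  (forall i, symb (k i) (s i) (F i)) ->
  symb (\sum_(i <- r) k i) (\prod_(i <- r) s i) (\prod_(i <- r) F i).
Proof.
move=> h; elim: r => [|i r IH]; first by rewrite !big_nil; apply: symb1.
by rewrite !big_cons; apply: symbM.
Qed.

Lemma symbX k s u n : symb k s u -> symb (n * k) (s ^+ n) (u ^+ n).
Proof.
move=> h; elim: n => [|n IH]; first exact: symb1.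
by rewrite mulSn !exprS; apply: symbM.
Qed.

Lemma symb_nat n : symb 0 n%:R n%:R.
Proof.
elim: n => [|n IH]; first exact: symb0.
by rewrite -natr1 -[n.+1%:R in X in symb _ _ X]natr1; apply: symbD => //; apply: symb1.
Qed.

Lemma symb_w_glN m (a : 'S_m) :
  symb m (\sum_(i : {ffun 'I_m -> 'I_N}) \prod_(l < m) x (i l) (i (a l))) (w_glN K N a).
Proof.
apply: symb_sum => i _.
have := @symb_prod _ (index_enum 'I_m) (fun=> 1%N) _ _ (fun l => symb_gen (i l) (i (a l))).
by rewrite sum1_card card_ord.
Qed.

End GlAction.

(** * Vector fields on the space of matrices *)

Section MatrixFunctions.
Context (K : fieldType) (N : nat).

Definition mxfun := mpoly.mpoly #|{: 'I_N * 'I_N}| K.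
HB.instance Definition _ := GRing.ComRing.on mxfun.

Definition mxcoord (i j : 'I_N) : mxfun := mpoly.mpolyX K (mpoly.mnm1 (enum_rank (i, j))).
Definition mxderiv (i j : 'I_N) (p : mxfun) : mxfun := mpoly.mderiv (enum_rank (i, j)) p.
Definition mxscal (c : K) : mxfun := mpoly.mpolyC _ c.

Lemma mxscal_additive : additive mxscal.
Proof. by move=> a b; rewrite /mxscal mpoly.mpolyCB. Qed.
Lemma mxscal_multiplicative : multiplicative mxscal.
Proof. by split=> [a b|]; rewrite /mxscal ?mpoly.mpolyCM ?mpoly.mpolyC1. Qed.
HB.instance Definition _ := GRing.isAdditive.Build _ _ mxscal mxscal_additive.
HB.instance Definition _ := GRing.isMultiplicative.Build _ _ mxscal mxscal_multiplicative.

(* The right-invariant vector field of the elementary matrix (i, j) on matrices. *)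
Definition mxfield (i j : 'I_N) (p : mxfun) : mxfun :=
  \sum_l mxcoord i l * mxderiv j l p.

Lemma mxderiv_coord j l k m : mxderiv j l (mxcoord k m) = ((j == k) && (l == m))%:R.
Proof.
rewrite /mxderiv /mxcoord mpoly.mderivX mpoly.mnm1E (inj_eq enum_rank_inj).
rewrite xpair_eqE [k == j]eq_sym [m == l]eq_sym.
have [->|] /= := eqVneq j k; last by rewrite scale0r.
have [->|] /= := eqVneq l m; last by rewrite scale0r.
rewrite scale1r -[RHS](mpoly.mpolyX0 _ K); congr mpoly.mpolyX.
by apply/mpoly.mnmP => t; rewrite mpoly.mnmBE subnn mpoly.mnm0E.
Qed.

Lemma mxderivM j l (p q : mxfun) : mxderiv j l (p * q)
  = mxderiv j l p * q + p * mxderiv j l q.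
Proof. exact: mpoly.mderivM. Qed.

Lemma mxfield_additive i j : additive (mxfield i j).
Proof.
move=> p q; rewrite /mxfield -sumrB; apply: eq_bigr => l _.
by rewrite /mxderiv mpoly.mderivB mulrBr.
Qed.
HB.instance Definition _ i j := GRing.isAdditive.Build _ _ (mxfield i j)
  (mxfield_additive i j).

Lemma mxfield_scal i j c (b : mxfun) : mxfield i j (mxscal c * b)
  = mxscal c * mxfield i j b.
Proof.
rewrite /mxfield mulr_sumr; apply: eq_bigr => l _.
by rewrite /mxderiv /mxscal mpoly.mderiv_mulC mulrCA.
Qed.

Lemma mxfield_coord i j k l (b : mxfun) : mxfield i j (mxcoord k l * b) =
  mxcoord k l * mxfield i j b + mxcoord i l * b *+ (j == k).
Proof.
rewrite /mxfield mulr_sumr (eq_bigr (fun m => mxcoord k l * (mxcoord i m * mxderiv j m b) +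
   mxcoord i m * b *+ ((j == k) && (m == l)))) => [|m _].
  rewrite big_split; congr (_ + _); rewrite (bigD1 l) //= eqxx andbT big1 ?addr0 // =>
    m /negPf->.
  by rewrite andbF.
by rewrite mxderivM mxderiv_coord mulrDr addrC mulrCA; congr (_ + _);
  rewrite -mulr_natr; ring.
Qed.

(** The second-order parts of the two compositions agree because partial derivatives commute; the
    first-order parts, produced by the Leibniz rule on the coordinates, form the commutator. *)
Lemma mxfield_comm i j k l (b : mxfun) : mxfield i j (mxfield k l b) =
  mxfield k l (mxfield i j b) + (mxfield i l b *+ (j == k) - mxfield k j b *+ (i == l)).
Proof.
have H i' j' k' l' : mxfield i' j' (mxfield k' l' b) =
    mxfield i' l' b *+ (j' == k') +
    \sum_m \sum_m' mxcoord k' m * mxcoord i' m' * mxderiv j' m' (mxderiv l' m b).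
  rewrite {2}/mxfield raddf_sum /= (eq_bigr (fun m =>
    mxcoord i' m * mxderiv l' m b *+ (j' == k')
     + \sum_m' mxcoord k' m * mxcoord i' m' * mxderiv j' m' (mxderiv l' m b))).
    by rewrite big_split /= sumrMnl.
  move=> m _; rewrite mxfield_coord addrC; congr (_ + _).
  by rewrite mulr_sumr; apply: eq_bigr => m' _; rewrite mulrA.
rewrite !H exchange_big /=.
rewrite [in RHS](eq_bigr (fun m =>
  \sum_m' mxcoord k m' * mxcoord i m * mxderiv j m (mxderiv l m' b))).
  by rewrite [l == i]eq_sym; ring.
move=> m _; apply: eq_bigr => m' _; rewrite /mxderiv mpoly.mderiv_comm; ring.
Qed.

End MatrixFunctions.

(** * Symbols evaluated at diagonal matrices *)

Section SymbolEvaluation.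
Context (K : fieldType) (N : nat) (y : 'I_N -> K).

Definition diag_eval (p : mxfun K N) : K :=
  mpoly.meval (fun t => let: (i, j) := enum_val t in y i *+ (i == j)) p.

Lemma diag_eval_additive : additive diag_eval.
Proof. exact: mpoly.mevalB. Qed.
Lemma diag_eval_multiplicative : multiplicative diag_eval.
Proof. by split=> [a b|]; rewrite /diag_eval ?mpoly.mevalM ?mpoly.meval1. Qed.
HB.instance Definition _ := GRing.isAdditive.Build _ _ diag_eval diag_eval_additive.
HB.instance Definition _ := GRing.isMultiplicative.Build _ _ diag_eval diag_eval_multiplicative.

Lemma diag_eval_coord i j : diag_eval (mxcoord K i j) = y i *+ (i == j).
Proof. by rewrite /diag_eval /mxcoord mpoly.mevalXU enum_rankK. Qed.

Lemma diag_eval_scal c : diag_eval (mxscal N c) = c.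
Proof. exact: mpoly.mevalC. Qed.

Definition cycle_symbol k : mxfun K N :=
  \sum_(i : {ffun 'I_k.+1 -> 'I_N}) \prod_(l < k.+1) mxcoord K (i l) (i (std_cycle k.+1 l)).

(** On a diagonal matrix a product of entries along a cycle vanishes unless the index is constant
    along the cycle; the constant value is the [j] of the power sum. *)
Lemma diag_eval_cycle k : diag_eval (cycle_symbol k) = \sum_j y j ^+ k.+1.
Proof.
rewrite raddf_sum /= (bigID (fun i : {ffun 'I_k.+1 -> 'I_N} => i == [ffun=> i ord0])) /=.
rewrite [X in _ + X]big1 ?addr0 => [|i ni]; last first.
  rewrite rmorph_prod /=; apply/eqP/prodf_eq0.
  have [l il] : exists l, i l != i (std_cycle k.+1 l).
    apply/existsP; apply: contraR ni; rewrite negb_exists => /forallP h.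
    apply/eqP/ffunP => l; rewrite ffunE.
    have {}h l' : i (std_cycle k.+1 l') = i l' by have := h l'; rewrite negbK => /eqP.
    have hX n : i ((std_cycle k.+1 ^+ n)%g ord0) = i ord0.
      by elim: n => [|n IH]; rewrite ?perm1 // expgSr permM h.
    rewrite -(hX l); congr (i _); apply: val_inj.
    by rewrite /= std_cycleX add0n modn_small.
  by exists l => //; rewrite diag_eval_coord (negPf il).
rewrite (reindex (fun j : 'I_N => [ffun=> j] : {ffun 'I_k.+1 -> 'I_N})) /=; last first.
  exists (fun i : {ffun _ -> _} => i ord0) => [j _|i]; first by rewrite ffunE.
  by rewrite inE => /eqP/esym.
apply: eq_big => [j|j _]; first by apply/eqP/ffunP => l; rewrite !ffunE.
rewrite rmorph_prod (eq_bigr (fun=> y j)) => [|l _]; last first.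
  by rewrite /= diag_eval_coord !ffunE eqxx.
by rewrite prodr_const card_ord.
Qed.

Notation symb := (symb (mxscal N) (mxfield (K := K) (N := N)) (@mxcoord K N)).

(** The contribution of one monomial of [F] to its specialization. Its symbol has degree
    [pweight m]: C_{k+1} is a sum of words of length k + 1, while N and the scalars have degree
    0. *)
Definition mono_elt (F : gl_poly K) d (m : {cmonom nat}) : gl_free K N :=
  N%:R ^+ d * (<< (F`_d)@_m *g mone >> * mpow (fun k => w_glN K N (std_cycle k.+1)) m).

Lemma symb_mono (F : gl_poly K) d m : symb (pweight m)
  (N%:R ^+ d * (mxscal N (F`_d)@_m * mpow cycle_symbol m)) (mono_elt F d m).
Proof.
have sM := symbM (@mxfield_scal K N).
rewrite -[pweight m]add0n -{1}(muln0 d).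
apply: (sM); first by apply: (symbX (@mxfield_scal K N)); apply: symb_nat.
rewrite -[pweight m]add0n; apply: (sM); first exact: symb_scal.
rewrite /mpow /pweight; apply: (symb_prod (@mxfield_scal K N)) => k.
apply: (symbX (@mxfield_scal K N)).
apply: symb_w_glN; exact: mxfield_scal.
Qed.

Lemma top_weight_vanish (F : gl_poly K) M : Ugl_ideal (gl_specialize N F) ->
  (forall d m, m \in msupp F`_d -> (pweight m <= M)%N) ->
  \sum_(d < size F) \sum_(m <- msupp F`_d | pweight m == M)
    (F`_d)@_m * (N%:R ^+ d * mpow (fun k => \sum_j y j ^+ k.+1) m) = 0.
Proof.
(* The constant function 1 in t-degree 0: coefficient [M] of the action on it reads off the symbol
   of degree [M]. *)
move=> FI FM; pose f0 (n : nat) : mxfun K N := (n == 0)%:R.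
pose act := gl_act (mxscal N) (mxfield (K := K) (N := N)) (@mxcoord K N).
have a0 : act (gl_specialize N F) f0 M = 0.
  exact: (gl_act_ideal (@mxfield_scal K N) (@mxfield_coord K N) (@mxfield_comm K N) FI).
have a1 : act (gl_specialize N F) f0 M =
    \sum_(d < size F) \sum_(m <- msupp F`_d) act (mono_elt F d m) f0 M.
  apply: etrans (gl_act_sum _ _ _ _ _ _ _ _) _; apply: eq_bigr => d _.
  by rewrite /mmap mulr_sumr; apply: etrans (gl_act_sum _ _ _ _ _ _ _ _) _.
apply: etrans (etrans (congr1 diag_eval (etrans (esym a1) a0)) (raddf0 _)).
rewrite raddf_sum; apply: eq_bigr => d _; rewrite raddf_sum /= big_mkcond /=.
rewrite big_seq [RHS]big_seq; apply: eq_bigr => m mF.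
have := symb_mono F d m; move/(_ f0 0%N) => [[//|n] _|z e]; first by [].
rewrite add0n in z e; case: eqP => [<-|nM]; last first.
  rewrite /act z ?raddf0 // ltn_neqAle (FM d) // andbT; exact/eqP.
rewrite /act e mulr1 rmorphM rmorphXn rmorph_nat rmorphM /= diag_eval_scal mulrCA.
congr (_ * (_ * _)); rewrite /mpow rmorph_prod; apply: eq_bigr => k _.
by rewrite rmorphXn /= diag_eval_cycle.
Qed.

End SymbolEvaluation.

(** Subtracting [chi q y] times the relation at [x] from the relation at [mul x y] removes [q] and
    leaves a shorter relation, with coefficients multiplied by [chi p y - chi q y]. The predicate
    [Q] will select the nonempty lists, since N is positive. *)
Lemma dedekind_independence (K : fieldType) (X : Type) (Q : X -> Prop) (mul : X -> X ->
  X) (e : X)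
    (P : eqType) (chi : P -> X -> K) (s : seq P) (c : P -> K) :
  Q e -> (forall x y, Q x -> Q y -> Q (mul x y)) ->
  (forall p, chi p e = 1) ->
  (forall p x y, Q x -> Q y -> chi p (mul x y) = chi p x * chi p y) ->
  (forall p q, p != q -> exists2 x, Q x & chi p x != chi q x) ->
  uniq s -> (forall x, Q x -> \sum_(p <- s) c p * chi p x = 0) ->
  {in s, forall p, c p = 0}.
Proof.
move=> Qe QM chi1 chiM chiD; elim: s c => //= q s IH c /andP[qs us] h.
have cs p : p \in s -> c p = 0.
  move=> ps; have pq : p != q by apply: contraNneq qs => <-.
  have [y Qy /negP pqy] := chiD _ _ pq.
  suff /eqP : c p * (chi p y - chi q y) = 0.
    by rewrite mulf_eq0 subr_eq0 => /orP[/eqP|/pqy].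
  apply: (IH (fun p => c p * (chi p y - chi q y))) ps => // x Qx.
  have := h _ (QM _ _ Qx Qy); have := h _ Qx.
  rewrite !big_cons chiM // => /eqP; rewrite addrC addr_eq0 => /eqP e1.
  move/eqP; rewrite addrC addr_eq0 => /eqP e2.
  transitivity (\sum_(j <- s) (c j * chi j (mul x y) - chi q y * (c j * chi j x))).
    by apply: eq_bigr => j _; rewrite chiM //; ring.
  by rewrite sumrB -mulr_sumr e1 e2; ring.
move=> p; rewrite inE => /orP[/eqP->|/cs //].
have := h _ Qe; rewrite big_cons big1_seq ?addr0 ?chi1 ?mulr1 // => j /andP[_ js].
by rewrite cs ?mul0r.
Qed.

(** * Separation of monomials in the power sums *)

Section Uniqueness.
Context (K : numFieldType).

Definition power_sum (k : nat) (ys : seq K) : K := \sum_(y <- ys) y ^+ k.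

(** The value of the monomial with exponent [p.1] of N and [p.2] of the C_k: a list of N numbers has
    N as its power sum of exponent 0. *)
Definition power_char (p : nat * {cmonom nat}) (ys : seq K) : K :=
  power_sum 0 ys ^+ p.1 * mpow (fun k => power_sum k.+1 ys) p.2.

(* On lists, with the lists of products as multiplication, each [power_sum k] is
   multiplicative; hence so are the monomials N^d C_1^{e_1} C_2^{e_2} ... *)
Lemma power_sumM k xs ys :
  power_sum k [seq x * y | x <- xs, y <- ys] = power_sum k xs * power_sum k ys.
Proof.
rewrite /power_sum big_allpairs_dep mulr_suml; apply: eq_bigr => x _.
by rewrite mulr_sumr; apply: eq_bigr => y _; rewrite exprMn.
Qed.

Lemma power_charM p xs ys :
  power_char p [seq x * y | x <- xs, y <- ys] = power_char p xs * power_char p ys.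
Proof.
rewrite /power_char power_sumM exprMn mulrACA; congr (_ * _).
by rewrite /mpow -big_split; apply: eq_bigr => k _; rewrite power_sumM exprMn.
Qed.

Lemma power_char1 p : power_char p [:: 1] = 1.
Proof.
rewrite /power_char /power_sum !big_seq1 expr0 expr1n mul1r /mpow big1 // => k _.
by rewrite big_seq1 !expr1n.
Qed.

Definition pair_exp (p : nat * {cmonom nat}) (k : nat) : nat :=
  if k is k'.+1 then p.2 k' else p.1.

(* The roots of this product, as a polynomial in [n], recover all the exponents. *)
Lemma power_char_shift p n m : (forall k, (m <= k)%N -> pair_exp p k = 0%N) ->
  power_char p (2 :: nseq n 1) = \prod_(0 <= k < m.+1) (n%:R + 2 ^+ k) ^+ pair_exp p k.
Proof.
move=> pm; have ps k : power_sum k (2 :: nseq n 1) = n%:R + 2 ^+ k.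
  rewrite /power_sum big_cons addrC; congr (_ + _).
  rewrite (eq_big_seq (fun=> 1)) => [|y]; last by rewrite mem_nseq => /andP[_ /eqP->];
    rewrite expr1n.
  by rewrite big_const_seq count_predT size_nseq iter_addr_0.
rewrite /power_char ps big_nat_recl //=; congr (_ * _).
have pe : perm_eq (seq_fset tt (iota 0 m)) (iota 0 m).
  by rewrite (permPl (seq_fset_perm _ _)) undup_id // iota_uniq.
rewrite (mpowEw (fun _ _ => mulrC _ _) (d := seq_fset tt (iota 0 m))).
  rewrite (perm_big _ pe) /= /index_iota subn0; apply: eq_bigr => k _.
  by rewrite ps.
apply/fsubsetP => k; rewrite seq_fsetE mem_iota /= add0n -cmE_neq0.
by apply: contraR; rewrite -leqNgt => mk; rewrite -[p.2 k]/(pair_exp p k.+1) pm // ltnW.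
Qed.

Lemma pair_exp_bound p : exists m, forall k, (m <= k)%N -> pair_exp p k = 0%N.
Proof.
exists (\max_(k <- finsupp p.2) k).+2 => -[//|k]; rewrite ltnS /= => mk.
apply/eqP; rewrite cmE_eq0; apply/negP => kp; move: mk; rewrite ltnNge => /negP; apply.
by rewrite (big_rem k) //= leq_maxl.
Qed.

Lemma mup_prodX (z : nat -> K) (r : seq nat) (E : nat -> nat) j :
  injective z -> uniq r -> j \in r ->
  mup (z j) (\prod_(k <- r) ('X - (z k)%:P) ^+ E k) = E j.
Proof.
move=> zI ur jr; have X0 k : ('X - (z k)%:P) ^+ E k != 0.
  by rewrite expf_neq0 // polyXsubC_eq0.
have -> : mup (z j) (\prod_(k <- r) ('X - (z k)%:P) ^+ E k) =
    (\sum_(k <- r) if k == j then E k else 0)%N.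
  elim: r {ur jr} => [|k r IH].
    by rewrite !big_nil mupNroot // root1.
  rewrite !big_cons mupM //; last by rewrite prodf_seq_neq0; apply/allP => ? _; apply: X0.
  by rewrite IH mup_XsubCX (inj_eq zI).
by rewrite -big_mkcond /= -big_filter filter_pred1_uniq // big_seq1.
Qed.

(** On the lists 2, 1, ..., 1 both characters are values, at natural numbers, of products of powers
    of X + 2^k. Agreement at all naturals makes these polynomials equal, and the multiplicity of the
    root -2^k is an exponent. In characteristic 0 these roots are distinct. *)
Lemma power_char_sep p q :
  (forall ys, (0 < size ys)%N -> power_char p ys = power_char q ys) -> p = q.
Proof.
move=> pq; have [m1 pm1] := pair_exp_bound p; have [m2 pm2] := pair_exp_bound q.
pose m := maxn m1 m2.
have pm k : (m <= k)%N -> pair_exp p k = 0%N by rewrite geq_max => /andP[/pm1].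
have qm k : (m <= k)%N -> pair_exp q k = 0%N by rewrite geq_max => /andP[_ /pm2].
pose z k : K := - 2 ^+ k.
have zI : injective z.
  move=> j k /oppr_inj /eqP; rewrite -!natrX eqr_nat => /eqP/eqP.
  by rewrite eqn_exp2l // => /eqP.
pose P u : {poly K} := \prod_(k <- index_iota 0 m.+1) ('X - (z k)%:P) ^+ pair_exp u k.
have PE u n : (P u).[n%:R] = \prod_(0 <= k < m.+1) (n%:R + 2 ^+ k) ^+ pair_exp u k.
  rewrite /P horner_prod; apply: eq_bigr => k _.
  by rewrite horner_exp hornerXsubC opprK.
have ePq : P p = P q.
  apply/eqP; rewrite -subr_eq0; apply/negPn/negP => nz.
  (* One root more than the degree of a nonzero difference allows. *)
  pose rs : seq K := [seq n%:R | n <- iota 0 (size (P p - P q))].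
  have := @max_poly_roots _ _ rs nz; rewrite size_map size_iota ltnn => H.
  suff : false by []. apply: H.
    apply/allP => _ /mapP[n _ ->]; rewrite rootE hornerD hornerN !PE.
    by rewrite -!power_char_shift // pq // subrr.
  rewrite map_inj_uniq ?iota_uniq //; move=> a b /eqP; rewrite eqr_nat => /eqP //.
have e k : pair_exp p k = pair_exp q k.
  have [km|km] := ltnP k m.+1; last by rewrite pm ?qm // ltnW.
  have kr : k \in index_iota 0 m.+1 by rewrite mem_index_iota.
  by rewrite -(mup_prodX (pair_exp p) zI _ kr) ?iota_uniq // -/(P p)
    ePq mup_prodX ?iota_uniq.
case: p q {pq pm1 pm2 pm qm ePq} e => d u [d' u'] e.
congr pair; first exact: (e 0%N).
by apply/eqP/cmP => k; apply: (e k.+1).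
Qed.

(** Descent on a bound [M] for the weights: the symbols of degree [M] give a linear relation between
    distinct characters, so every coefficient of weight [M] vanishes. Powers of N do not count in
    the weight; they are separated by the characters. *)
Lemma gl_specialize_inj (F : gl_poly K) :
  (forall n, Ugl_ideal (gl_specialize n.+1 F)) -> F = 0.
Proof.
move=> FI.
have step M : (forall d m, m \in msupp F`_d -> (pweight m <= M)%N) ->
    (forall d m, m \in msupp F`_d -> (pweight m < M)%N).
  move=> FM d m mF; rewrite ltn_neqAle (FM d) // andbT; apply/negP => /eqP mM.
  pose s := [seq (d, m)
    | d <- iota 0 (size F), m <- [seq m <- msupp F`_d | pweight m == M]].
  have us : uniq s.
    apply: allpairs_uniq_dep; rewrite ?iota_uniq //.
      by move=> x _; rewrite filter_uniq // fset_uniq.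
    by move=> [x y] [x' y'] _ _ /= [-> ->].
  have ds : (d, m) \in s.
    apply: allpairs_f_dep; last by rewrite mem_filter mM eqxx.
    rewrite mem_iota /= add0n ltnNge; apply/negP => Fd.
    by move: mF; rewrite nth_default // msupp0.
  suff /(_ _ ds) /eqP : {in s, forall p, (F`_p.1)@_p.2 = 0}.
    by rewrite /= mcoeff_eq0 mF.
  apply: (@dedekind_independence _ (seq K) (fun ys => (0 < size ys)%N)
    (fun xs ys => [seq x * y | x <- xs, y <- ys]) [:: 1] _ power_char) => //.
  - by move=> xs ys; rewrite size_allpairs muln_gt0 => -> ->.
  - exact: power_char1.
  - by move=> p xs ys _ _; apply: power_charM.
  - move=> p q; apply: contraNP => /forallPNP h; apply/eqP/power_char_sep => ys ysn.
    by apply/eqP; apply/negP => /negP; apply: h.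
  move=> ys ysn; rewrite big_allpairs_dep /=.
  have := @top_weight_vanish K (size ys) (fun i => ys`_i) F M.
  case: ys ysn => // y ys _; move/(_ (FI _) FM).
  have psE k : \sum_(j < (size ys).+1) (y :: ys)`_j ^+ k = power_sum k (y :: ys).
    by rewrite /power_sum [RHS](big_nth 0) big_mkord.
  have -> : iota 0 (size F) = index_iota 0 (size F) by rewrite /index_iota subn0.
  move=> H0; apply: etrans _ H0; rewrite big_mkord; apply: eq_bigr => d' _;
    rewrite big_filter.
  apply: eq_bigr => m' _; rewrite /power_char /=; congr (_ * (_ ^+ _ * _)).
    by rewrite -psE; under eq_bigr do rewrite expr0; rewrite sumr_const card_ord.
  by rewrite /mpow; apply: eq_bigr => k _; rewrite psE.
apply/polyP => d; rewrite coef0; apply/eqP; rewrite -msupp_eq0.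
have bound : exists M, forall d m, m \in msupp F`_d -> (pweight m <= M)%N.
  exists (\max_(d < size F) \max_(m <- msupp F`_d) pweight m) => {}d m mF.
  have dF : (d < size F)%N.
    by rewrite ltnNge; apply/negP => Fd; move: mF; rewrite nth_default // msupp0.
  by apply: leq_trans (leq_bigmax (Ordinal dF)); rewrite /= (big_rem m) //= leq_maxl.
have [M FM] := bound.
have F0 : forall d m, m \notin msupp F`_d.
  elim: M FM => [|M IH] /step FM; last by apply: IH.
  by move=> d' m; apply/negP => /FM.
by apply/eqP/fsetP => m; rewrite inE (negPf (F0 _ _)).
Qed.

End Uniqueness.

(** * Cycle counts and reduction to concatenated cycles *)

Section CycleCount.
Context (T : finType).
Implicit Types (a b : {perm T}) (s : seq T).

Definition cyc (s : seq T) a : nat := #|[set porbit a x | x in [set z in s]]|.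

Lemma eq_cyc s t a : s =i t -> cyc s a = cyc t a.
Proof.
move=> st; rewrite /cyc (_ : [set z in s] = [set z in t]) //.
by apply/setP => z; rewrite !inE st.
Qed.

Lemma stable_iter s a x n : stable s a -> x \in s -> (a ^+ n)%g x \in s.
Proof. by move=> sa xs; elim: n => [|n IH]; rewrite ?perm1 // expgSr permM sa. Qed.

Lemma stable_porbit s a x y : stable s a -> x \in s -> y \in porbit a x -> y \in s.
Proof. by move=> sa xs /porbitP[n ->]; apply: stable_iter. Qed.

Lemma porbit_agree s a b x : stable s a -> {in s, a =1 b} -> x \in s ->
  porbit a x = porbit b x.
Proof.
move=> sa ab xs; have E n : (a ^+ n)%g x = (b ^+ n)%g x.
  elim: n => [|n IH]; first by rewrite !perm1.
  by rewrite !expgSr !permM -IH ab // stable_iter.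
by apply/setP => y; apply/porbitP/porbitP => -[n ->]; exists n.
Qed.

Lemma cyc_agree s a b : stable s a -> {in s, a =1 b} -> cyc s a = cyc s b.
Proof.
move=> sa ab; rewrite /cyc; congr #|pred_of_set _|; apply: eq_in_imset => x.
rewrite inE => xs; exact: porbit_agree sa ab xs.
Qed.

Lemma cyc_cat s1 s2 a : ~~ has (mem s1) s2 -> stable s1 a ->
  cyc (s1 ++ s2) a = (cyc s1 a + cyc s2 a)%N.
Proof.
move=> dis st1; rewrite /cyc.
have -> : [set z in s1 ++ s2] = [set z in s1] :|: [set z in s2].
  by apply/setP => z; rewrite !inE mem_cat.
rewrite imsetU.
rewrite cardsU [X in (_ - #|pred_of_set X|)%N](_ : _ = set0) ?cards0 ?subn0 //.
apply/setP => O; rewrite !inE; apply/negP => /andP[/imsetP[x + ->] /imsetP[y + e]].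
rewrite !inE => xs1 ys2.
have : y \in s1 by apply: (stable_porbit st1 xs1); rewrite e porbit_id.
by move/hasPn: dis => /(_ y ys2) /negP.
Qed.

Lemma cyc_le s a : (cyc s a <= size s)%N.
Proof. by apply: leq_trans (leq_imset_card _ _) _; rewrite cardsE card_size. Qed.

Lemma cyc_all s a : (forall x, x \in s) -> cyc s a = #|porbits a|.
Proof.
move=> sT; rewrite /cyc /porbits; congr #|pred_of_set _|.
by apply/setP => O; apply/imsetP/imsetP => -[x _ ->]; exists x; rewrite ?inE ?sT.
Qed.

Lemma mem_orbit_porbit a x y : (y \in fingraph.orbit a x) = (y \in porbit a x).
Proof.
rewrite -fconnect_orbit; apply/idP/porbitP => [/iter_findex <-|[n ->]].
  by exists (findex a x y); rewrite permX.
by rewrite permX fconnect_iter.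
Qed.

Lemma stable_orbit a x : stable (fingraph.orbit a x) a.
Proof.
move=> y; rewrite !mem_orbit_porbit => /porbitP[n ->].
by rewrite -permM -expgSr mem_porbit.
Qed.

Lemma cyc_orbit a x : cyc (fingraph.orbit a x) a = 1%N.
Proof.
rewrite /cyc (_ : [set _ | _ in _] = [set porbit a x]) ?cards1 //.
apply/setP => O; rewrite inE; apply/imsetP/eqP => [[y + ->]|->].
  by rewrite inE => yx; apply/eqP; rewrite eq_porbit_mem -mem_orbit_porbit.
by exists x => //; rewrite inE; apply: in_orbit.
Qed.

Lemma cyc_cons_fix s a x : a x = x -> x \notin s -> cyc (x :: s) a = (cyc s a).+1.
Proof.
move=> ax xs; rewrite -cat1s cyc_cat; last 2 first.
- by apply/hasPn => y ys; rewrite /= inE; apply: contraNneq xs => <-.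
- by move=> y; rewrite !inE => /eqP->; rewrite ax.
rewrite [cyc [:: x] a](_ : _ = 1%N) ?add1n //.
rewrite /cyc (_ : [set z in [:: x]] = [set x]) ?imset_set1 ?cards1 //.
by apply/setP => z; rewrite !inE.
Qed.

Lemma porbits_del a y : #|porbits (del y a)| = (#|porbits a| + (a y != y))%N.
Proof.
(* Deletion as multiplication by a transposition on the other side, the form handled by
   [porbits_mul_tperm]. *)
have -> : del y a = (tperm ((a^-1)%g y) y * a)%g.
  rewrite -[X in tperm _ X](permK a y) -tpermJ conjgE invgK.
  by rewrite -!mulgA mulVg mulg1.
have := porbits_mul_tperm a ((a^-1)%g y) y; rewrite /=.
have -> : (a^-1)%g y \notin porbit a y = false.
  apply/negbTE; rewrite negbK porbit_sym; apply/porbitP; exists 1%N.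
  by rewrite expg1 permKV.
rewrite addn0 => ->; congr (_ + (~~ _))%N.
by rewrite -(inj_eq (@perm_inj _ a)) permKV eq_sym.
Qed.

(** The transposition merges the cycles of [x] and [y] or splits their common cycle; removing [y]
    then loses a cycle only if [y] has become a fixed point, that is, if [a x = y]. The count is
    made on all of [T] and corrected outside [s], where both permutations agree. *)
Lemma cyc_step s t x y a : uniq (x :: y :: t) -> s =i x :: y :: t -> stable s a ->
  (cyc (x :: t) (del y (tperm x y * a)%g) + (y \notin porbit a x) =
   cyc s a + ((y \in porbit a x) && (a x != y)))%N.
Proof.
move=> us st sa; set c := (tperm x y * a)%g; set b := del y c.
have [xs ys] : x \in s /\ y \in s by rewrite !st !inE !eqxx orbT.
have sb : stable s b.
  by apply: stableM; [apply: stableM|]; rewrite ?permM ?tpermR //;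
    apply: stable_tperm => //; apply: sa.
pose s' := [seq z <- enum T | z \notin s].
have ms' z : (z \in s') = (z \notin s) by rewrite mem_filter mem_enum andbT.
have dis : ~~ has (mem s) s' by apply/hasPn => z; rewrite ms'.
have tot (d : {perm T}) : stable s d -> #|porbits d| = (cyc s d + cyc s' d)%N.
  move=> sd; rewrite -cyc_cat // cyc_all // => z.
  by rewrite mem_cat ms' orbN.
have e' : cyc s' b = cyc s' a.
  apply: cyc_agree => [z|z]; rewrite !ms'; first by rewrite (stable_perm _ sb).
  move=> zs; have zx : z != x by apply: contraNneq zs => ->.
  have zy : z != y by apply: contraNneq zs => ->.
  have ca : c z = a z by rewrite permM tpermD // eq_sym.
  rewrite /b delE // ca ifN //; apply: contraNneq zs => e.
  by rewrite -(stable_perm z sa) e.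
have := porbits_mul_tperm a x y; rewrite /= -/c => pc.
have := porbits_del c y; rewrite -/b permM tpermR => pb.
have cb : cyc s b = (cyc (x :: t) b).+1.
  rewrite -(@cyc_cons_fix (x :: t) b y) ?del_self //.
    by apply: eq_cyc => z; rewrite st !inE orbCA.
  by move: us; rewrite /= !inE !negb_or [y == x]eq_sym; case/and3P=> /andP[-> _] ->.
have := tot a sa; have := tot b sb; rewrite cb e'.
have xyp : (x \in porbit a y) = (y \in porbit a x) by rewrite porbit_sym.
have axy : a x == y -> y \in porbit a x.
  by move/eqP <-; apply/porbitP; exists 1%N; rewrite expg1.
have xy : x != y by move: us; rewrite /= !inE negb_or; case/and3P=> /andP[].
move: pc pb; rewrite xyp xy.
case: (boolP (y \in porbit a x)) axy => [yx _|_ axy]; rewrite /=.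
  case: eqP => _ /=; lia.
case: eqP axy => [_ /(_ isT) //|_ _] /=; lia.
Qed.

(** Adjacent swaps lead to [s] from a list that begins with an orbit of [a]. Each swap uses the
    statement for the swapped list and for two shorter lists, the latter supplied by induction on
    the size. Existence, constant terms and the coproduct are all proved by this induction. *)
Lemma stable_seq_ind (P : seq T -> {perm T} -> Prop) :
  (forall a, P [::] a) ->
  (forall a x s, uniq (fingraph.orbit a x ++ s) -> stable s a -> P s a ->
     P (fingraph.orbit a x ++ s) a) ->
  (forall s1 x y s2 a, uniq (s1 ++ x :: y :: s2) -> stable (s1 ++ x :: y :: s2) a ->
     P (s1 ++ y :: x :: s2) a -> P (s1 ++ x :: s2) (del y (tperm x y * a)%g) ->
     P (s1 ++ y :: s2) (del x (tperm x y * a)%g) -> P (s1 ++ x :: y :: s2) a) ->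
  forall s a, uniq s -> stable s a -> P s a.
Proof.
move=> P0 Porb Psw s; have [n] := ubnP (size s).
elim: n s => // n IH s sn a us sa; case: s sn us sa => [//|x s] sn us sa.
pose o := fingraph.orbit a x; pose r := [seq z <- x :: s | z \notin o].
have uo : uniq o by apply: orbit_uniq; exact: perm_inj.
have oxs z : z \in o -> z \in x :: s.
  by rewrite mem_orbit_porbit; apply: stable_porbit => //; rewrite mem_head.
have ur : uniq (o ++ r).
  rewrite cat_uniq uo filter_uniq // andbT /=; apply/hasPn => z.
  by rewrite mem_filter => /andP[].
have pe : perm_eq (o ++ r) (x :: s).
  apply: uniq_perm => // z; rewrite mem_cat mem_filter.
  by case: (boolP (z \in o)) => //= /oxs ->.
have sr : stable r a.
  move=> z; rewrite !mem_filter => /andP[zo zs]; rewrite (stable_perm _ sa) zs andbT.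
  by rewrite (stable_perm _ (@stable_orbit a x)).
have Por : P (o ++ r) a.
  have szr : (size r < n)%N.
    rewrite /r /= in_orbit /=; rewrite ltnS in sn; apply: leq_trans sn.
    by rewrite ltnS size_filter count_size.
  by apply: Porb => //; apply: IH => //; rewrite filter_uniq.
pose Q t := perm_eq t (x :: s) -> P t a.
suff : Q (x :: s) by apply.
apply: (@perm_swap_ind _ Q) pe _ => [s1 z y s2 Qt pt|_ //].
have pt' : perm_eq (s1 ++ z :: y :: s2) (x :: s).
  by rewrite (permPl (perm_adj s1 s2 y z)).
have ut : uniq (s1 ++ y :: z :: s2) by rewrite (perm_uniq pt).
have sz : size (s1 ++ y :: z :: s2) = (size s).+1 by rewrite (perm_size pt).
have st : stable (s1 ++ y :: z :: s2) a.
  by move=> u; rewrite !(perm_mem pt); apply: sa.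
have [ys zs] : y \in s1 ++ y :: z :: s2 /\ z \in s1 ++ y :: z :: s2.
  by rewrite !mem_cat !inE !eqxx !orbT.
have sc : stable (s1 ++ y :: z :: s2) (tperm y z * a)%g.
  by apply: stableM => //; apply: stable_tperm.
apply: Psw => //; first exact: Qt.
  apply: IH.
  - by move: sz sn; rewrite !size_cat /=; lia.
  - move: ut; apply: subseq_uniq; apply: cat_subseq => //.
    by rewrite /= eqxx; apply: subseq_cons.
  apply: stable_del sc _ => u.
  by have := @mem_rem_mid _ (rcons s1 y) s2 z u; rewrite !cat_rcons; apply.
apply: IH.
- by move: sz sn; rewrite !size_cat /=; lia.
- by move: ut; apply: subseq_uniq; rewrite cat_subseq // subseq_cons.
by apply: stable_del sc _ => u; apply: mem_rem_mid.
Qed.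
End CycleCount.

(** * The leading coefficient in N *)

Section Filtration.
Context (K : fieldType).
Implicit Types (u v : pol_alg K).

Lemma pweightM (d e : {cmonom nat}) : pweight (mmul d e : {cmonom nat})
  = (pweight d + pweight e)%N.
Proof.
have wE (S : {fset nat}) (m : {cmonom nat}) : (finsupp m `<=` S)%fset ->
    pweight m = (\sum_(k <- S) m k * k.+1)%N.
  move=> mS; rewrite /pweight [LHS](big_fset_incl _ mS) //= => k _ km.
  by rewrite fsfun_dflt ?mul0n.
pose S := finsupp (mmul d e : {cmonom nat}).
rewrite (wE S) // (wE S d) ?(wE S e) /S ?mdomD ?fsubsetUl ?fsubsetUr //.
by rewrite -big_split /=; apply: eq_bigr => k _; rewrite cmM mulnDl.
Qed.

Lemma poly_filtW m n u : (m <= n)%N -> poly_filt m u -> poly_filt n u.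
Proof. by move=> mn h e /h em; apply: leq_trans em mn. Qed.

Lemma poly_filt0 m : poly_filt m (0 : pol_alg K).
Proof. by move=> e; rewrite msupp0. Qed.

Lemma poly_filtD m u v : poly_filt m u -> poly_filt m v -> poly_filt m (u + v).
Proof.
by move=> hu hv e /(fsubsetP (msuppD_le _ _)); rewrite in_fsetU => /orP[/hu|/hv].
Qed.

Lemma poly_filtN m u : poly_filt m u -> poly_filt m (- u).
Proof. by move=> hu e; rewrite msuppN; apply: hu. Qed.

Lemma poly_filt_sum (I : Type) (r : seq I) (P : pred I) (F : I -> pol_alg K) m :
  (forall i, P i -> poly_filt m (F i)) -> poly_filt m (\sum_(i <- r | P i) F i).
Proof.
move=> h; elim: r => [|i r IH]; first by rewrite big_nil; apply: poly_filt0.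
by rewrite big_cons; case: ifP => // Pi; apply: poly_filtD => //; apply: h.
Qed.

Lemma poly_filtM m n u v : poly_filt m u -> poly_filt n v -> poly_filt (m + n) (u * v).
Proof.
move=> hu hv e /msuppM_le[d [d' [du dv ->]]].
by rewrite pweightM leq_add ?hu ?hv.
Qed.

Lemma poly_filt_pvar k : poly_filt k.+1 (pvar K k).
Proof.
move=> e; rewrite msuppU1 in_fset1 => /eqP->.
by rewrite /pweight mdomU big_seq_fset1 cmUU mul1n.
Qed.

Lemma poly_filt1 : poly_filt 0 (1 : pol_alg K).
Proof. by move=> e; rewrite msuppU1 in_fset1 => /eqP->;
  rewrite /pweight mdom1 big_seq_fset0. Qed.

(* Degree at most [r] in N, and weighted degree at most [m] in the p_k. *)
Definition bounded r m (P : {poly pol_alg K}) : Prop :=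
  (forall d, (r < d)%N -> P`_d = 0) /\ (forall d, poly_filt m P`_d).

Lemma boundedW r r' m m' P : (r <= r')%N -> (m <= m')%N -> bounded r m P -> bounded r' m' P.
Proof.
move=> rr mm [z f]; split=> d; last exact: poly_filtW mm (f d).
by move=> rd; apply/z/(leq_ltn_trans rr rd).
Qed.

Lemma boundedD r m P Q : bounded r m P -> bounded r m Q -> bounded r m (P + Q).
Proof.
move=> [zP fP] [zQ fQ]; split=> d; rewrite coefD; last exact: poly_filtD.
by move=> rd; rewrite zP ?zQ ?addr0.
Qed.

Lemma boundedB r m P Q : bounded r m P -> bounded r m Q -> bounded r m (P - Q).
Proof.
move=> bP [zQ fQ]; apply: boundedD => //; split=> d; rewrite coefN; last exact: poly_filtN.
by move=> rd; rewrite zQ ?oppr0.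
Qed.

(** At the sum of the two bounds only one product of coefficients survives; this is the source of
    the multiplicativity of X_0. *)
Lemma boundedM r m P r' m' Q : bounded r m P -> bounded r' m' Q ->
  bounded (r + r') (m + m') (P * Q) /\ (P * Q)`_(r + r') = P`_r * Q`_r'.
Proof.
move=> [zP fP] [zQ fQ]; have PQ0 d i : (r + r' < d + i)%N -> P`_d * Q`_i = 0.
  case: (leqP d r) => [dr rd|rd _]; last by rewrite zP ?mul0r.
  by rewrite zQ ?mulr0 //; lia.
split; first (split=> d; rewrite coefM).
- by move=> rd; rewrite big1 // => i _; apply: PQ0; rewrite subnKC // -ltnS.
- by apply: poly_filt_sum => i _; apply: poly_filtM.
have ro : (r < (r + r').+1)%N by rewrite ltnS leq_addr.
rewrite coefM (bigD1 (Ordinal ro)) //= addKn big1 ?addr0 // => i ir.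
case: (ltngtP i r) => [lt|gt|e]; first by rewrite zQ ?mulr0 //; lia.
  by rewrite zP ?mul0r.
by case/eqP: ir; apply: val_inj.
Qed.

Lemma boundedXn r m P n : bounded r m P -> bounded (r + n) m (P * 'X^n).
Proof.
move=> [z f]; split=> d; rewrite coefMXn; case: ifP => dn //.
- by move=> rd; apply: z; lia.
- exact: poly_filt0.
Qed.

Lemma bounded1 : bounded 0 0 1.
Proof.
split=> d; rewrite coef1; first by case: d.
by case: eqP => _ /=; [apply: poly_filt1|apply: poly_filt0].
Qed.

Lemma bounded_pvarX k : bounded k k.+1 (pvar K k *: 'X^k).
Proof.
split=> d; rewrite coefZ coefXn.
  by case: eqP => [->|_ _]; rewrite ?ltnn ?mulr0.
case: eqP => _; rewrite ?mulr1 ?mulr0; [exact: poly_filt_pvar|exact: poly_filt0].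
Qed.

Definition subst_scal (c : K) : {poly pol_alg K} := (<< c *g (mone : {cmonom nat})
  >> : pol_alg K)%:P.
Lemma subst_scal_additive : additive subst_scal.
Proof. by move=> a b; rewrite /subst_scal monalgUB polyCB. Qed.
Lemma subst_scal_multiplicative : multiplicative subst_scal.
Proof. by split=> [a b|]; rewrite /subst_scal ?mpolyCM ?polyCM. Qed.
HB.instance Definition _ := GRing.isAdditive.Build _ _ subst_scal subst_scal_additive.
HB.instance Definition _ := GRing.isMultiplicative.Build _ _ subst_scal subst_scal_multiplicative.

Lemma gl_subst_morphism : exists f : {rmorphism gl_poly K -> {poly pol_alg K}},
  [/\ @gl_subst K =1 f, f 'X = 'X & forall k, f (pvar K k)%:P = pvar K k *: 'X^k].
Proof.
have [| | |f [fE fX fv _]] := @gl_eval_morphism K {poly pol_alg K} subst_scal 'X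
  (fun k => pvar K k *: 'X^k).
- by move=> a s; apply: mulrC.
- by move=> s; apply: mulrC.
- by move=> j k; apply: mulrC.
by exists f.
Qed.

End Filtration.

(** * Degree bounds for the realizing polynomials *)

Section RealizationCalculus.
Context (K : fieldType).

Lemma realizes_nil (T : eqType) (a : T -> T) : realizes (1 : gl_poly K) [::] a.
Proof.
move=> n; have [f [fE _ _]] := Uspec_morphism K n.
by rewrite fE rmorph1 /UW wsum_nil.
Qed.

Lemma realizes_cat (T : eqType) (F G : gl_poly K) (s t : seq T) (a : T -> T) :
  ~~ has (mem s) t -> stable s a -> stable t a ->
  realizes F s a -> realizes G t a -> realizes (F * G) (s ++ t) a.
Proof.
move=> dis sa ta rF rG n; have [f [fE _ _]] := Uspec_morphism K n.
by rewrite fE rmorphM -!fE rF rG /UW wsum_cat.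
Qed.

Lemma realizes_orbit (T : finType) (a : {perm T}) x k : fingraph.order a x = k.+1 ->
  realizes ((pvar K k)%:P : gl_poly K) (fingraph.orbit a x) a.
Proof.
move=> ok n; have [f [fE _ fv]] := Uspec_morphism K n.
by rewrite fE fv /UW (wsum_orbit _ _ ok).
Qed.

Lemma realizes_map (T T' : eqType) (h : T -> T') s a a' (F : gl_poly K) :
  {in s &, injective h} -> stable s a -> {in s, forall x, a' (h x) = h (a x)} ->
  realizes F s a -> realizes F (map h s) a'.
Proof. by move=> hI sa aa' r n; rewrite r /UW; apply/esym/wsum_map. Qed.

Lemma realizes_catC (T : finType) (s t : seq T) (a : {perm T}) (F : gl_poly K) :
  uniq (s ++ t) -> stable (s ++ t) a -> realizes F (s ++ t) a -> realizes F (t ++ s) a.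
Proof. by move=> us sa r n; rewrite r /UW wsum_catC //; apply: Ugen_comm. Qed.

Lemma realizes_swap (T : finType) s1 s2 x y (a : {perm T}) (F F1 F2 : gl_poly K) :
  uniq (s1 ++ x :: y :: s2) ->
  realizes F (s1 ++ y :: x :: s2) a ->
  realizes F1 (s1 ++ x :: s2) (del y (tperm x y * a)%g) ->
  realizes F2 (s1 ++ y :: s2) (del x (tperm x y * a)%g) ->
  realizes (F + F1 * 'X^(a x == y) - F2 * 'X^(a y == x)) (s1 ++ x :: y :: s2) a.
Proof.
move=> us r r1 r2 n; have [f [fE fX _]] := Uspec_morphism K n.
rewrite fE rmorphB rmorphD !rmorphM !rmorphXn fX -!fE r r1 r2 /UW.
have mX (z : Ugl K n.+1) b : z * n.+1%:R ^+ b = z *+ (n.+1 ^ b).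
  by rewrite -natrX mulr_natr.
apply: etrans (esym (wsum_swap ord0 (@Ugen_comm K n.+1) a us)).
by rewrite card_ord !mX.
Qed.

(** The number m - c(a) for the part of [a] on [s], the degree in N at which X_0 is read off. *)
Definition rk (T : finType) (s : seq T) (a : {perm T}) : nat := (size s - cyc s a)%N.

Lemma porbit_next (T : finType) (a : {perm T}) x y : a x == y -> y \in porbit a x.
Proof. by move/eqP <-; apply/porbitP; exists 1%N; rewrite expg1. Qed.

(** One point is lost in each case, while the number of cycles falls by one (merging), stays
    ([a x = y]) or grows by one (splitting). *)
Lemma rk_step (T : finType) (s t : seq T) x y (a : {perm T}) :
  uniq (x :: y :: t) -> perm_eq s (x :: y :: t) -> stable s a ->
  rk s a = (rk (x :: t) (del y (tperm x y * a)%g) +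
    (if y \in porbit a x then if a x == y then 1 else 2 else 0))%N.
Proof.
move=> us pe sa; have := cyc_step us (perm_mem pe) sa.
rewrite /rk; move: (cyc_le (x :: t) (del y (tperm x y * a)%g)) (cyc_le s a).
rewrite (perm_size pe) /=; have axy := @porbit_next _ a x y;
  case: (boolP (y \in porbit a x)) axy => [_ _|_ axy] /=.
  by case: eqP => _ /=; lia.
by case: eqP axy => [_ /(_ isT) //|_ _] /=; lia.
Qed.

Lemma perm_mid (T : eqType) (s1 s2 : seq T) x : perm_eq (s1 ++ x :: s2) (x :: s1 ++ s2).
Proof. by rewrite -cat1s -[x :: s1 ++ s2]cat1s perm_catCA. Qed.

Lemma rk_perm (T : finType) (s t : seq T) (a : {perm T}) : perm_eq s t -> rk s a = rk t a.
Proof. by move=> pe; rewrite /rk (perm_size pe) (eq_cyc _ (perm_mem pe)). Qed.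

Lemma rk_step1 (T : finType) s1 s2 x y (a : {perm T}) :
  uniq (s1 ++ x :: y :: s2) -> stable (s1 ++ x :: y :: s2) a ->
  rk (s1 ++ x :: y :: s2) a = (rk (s1 ++ x :: s2) (del y (tperm x y * a)%g) +
    (if y \in porbit a x then if a x == y then 1 else 2 else 0))%N.
Proof.
move=> us sa; have pe : perm_eq (s1 ++ x :: y :: s2) [:: x, y & s1 ++ s2].
  by rewrite -[x :: y :: s2]/([:: x; y] ++ s2) perm_catCA.
rewrite (rk_step _ pe sa) ?(perm_uniq pe) //; last by rewrite -(perm_uniq pe).
by congr (_ + _)%N; apply: rk_perm; rewrite perm_sym perm_mid.
Qed.

Lemma rk_step2 (T : finType) s1 s2 x y (a : {perm T}) :
  uniq (s1 ++ x :: y :: s2) -> stable (s1 ++ x :: y :: s2) a ->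
  rk (s1 ++ x :: y :: s2) a = (rk (s1 ++ y :: s2) (del x (tperm x y * a)%g) +
    (if y \in porbit a x then if a y == x then 1 else 2 else 0))%N.
Proof.
move=> us sa; have pe := perm_adj s1 s2 x y.
rewrite -(rk_perm _ pe) rk_step1 ?(perm_uniq pe) // => [|z].
  by rewrite tpermC porbit_sym.
by rewrite !(perm_mem pe); apply: sa.
Qed.

Lemma rk_cat (T : finType) (s t : seq T) (a : {perm T}) :
  ~~ has (mem s) t -> stable s a -> rk (s ++ t) a = (rk s a + rk t a)%N.
Proof.
move=> dis sa; rewrite /rk size_cat cyc_cat //.
by move: (cyc_le s a) (cyc_le t a); lia.
Qed.

Lemma rk_orbit (T : finType) (a : {perm T}) x k : fingraph.order a x = k.+1 ->
  rk (fingraph.orbit a x) a = k.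
Proof. by move=> ok; rewrite /rk cyc_orbit size_orbit ok subn1. Qed.

(** A closed loop brings a factor N, but only when [a x = y], where the rank has dropped by one; so
    the degree bound survives each swap. The weight bound [size s] is what later makes the morphism
    filtered. *)
Lemma realizable (T : finType) (s : seq T) (a : {perm T}) : uniq s -> stable s a ->
  exists F : gl_poly K, realizes F s a /\ bounded (rk s a) (size s) (gl_subst F).
Proof.
have [f [fE fX fv]] := gl_subst_morphism K.
apply: (stable_seq_ind (P := fun s a => exists F : gl_poly K,
  realizes F s a /\ bounded (rk s a) (size s) (gl_subst F))) =>
    {s a} [a|a x s us sa [F [rF bF]]|s1 x y s2 a us sa].
- exists 1; split; first exact: realizes_nil.
  by rewrite fE rmorph1; apply: boundedW (bounded1 _).
- have [k ok] : exists k, fingraph.order a x = k.+1.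
    by exists (fingraph.order a x).-1; rewrite prednK ?order_gt0.
  have dis : ~~ has (mem (fingraph.orbit a x)) s.
    by move: us; rewrite cat_uniq => /and3P[].
  exists ((pvar K k)%:P * F); split.
    apply: realizes_cat => //; first exact: stable_orbit.
    exact: realizes_orbit.
  rewrite rk_cat ?(rk_orbit ok) //; last exact: stable_orbit.
  rewrite size_cat size_orbit ok fE rmorphM fv -fE.
  exact: (boundedM (bounded_pvarX K k) bF).1.
move=> [F [rF bF]] [F1 [rF1 bF1]] [F2 [rF2 bF2]].
exists (F + F1 * 'X^(a x == y) - F2 * 'X^(a y == x)); split.
  exact: realizes_swap.
rewrite fE rmorphB rmorphD !rmorphM !rmorphXn /= fX -!fE.
have pe := perm_adj s1 s2 x y.
rewrite (rk_perm _ pe) (perm_size pe) in bF.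
apply: boundedB; first apply: boundedD => //.
- apply: boundedW (boundedXn _ bF1); last by rewrite !size_cat /= !addnS.
  rewrite (rk_step1 us sa); have := @porbit_next _ a x y.
  by case: (y \in porbit a x); case: (a x == y) => //= H; first [lia | have := H isT].
apply: boundedW (boundedXn _ bF2); last by rewrite !size_cat /= !addnS.
rewrite (rk_step2 us sa); have := @porbit_next _ a y x; rewrite porbit_sym.
by case: (y \in porbit a x); case: (a y == x) => //= H; first [lia | have := H isT].
Qed.

End RealizationCalculus.

(** * X_0 as the coefficient of top degree *)

Section LeadingCoefficient.
Context (K : numFieldType).

Lemma realizes_inj (T : eqType) (F G : gl_poly K) (s : seq T) (a : T -> T) :
  realizes F s a -> realizes G s a -> F = G.
Proof.
move=> rF rG; apply/eqP; rewrite -subr_eq0; apply/eqP; apply: gl_specialize_inj => n.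
have [f [fE _ _]] := Uspec_morphism K n.
have : Uspec n (F - G) = Upi 0.
  by rewrite fE rmorphB -!fE rF rG subrr; apply/esym; apply: raddf0.
by move/UpiP; rewrite /Ugl_eq subr0.
Qed.

Definition wpol (T : eqType) (s : seq T) (a : T -> T) : gl_poly K :=
  classical_sets.xget 0 (fun F => realizes F s a).

Lemma wpolE (T : eqType) (F : gl_poly K) (s : seq T) (a : T -> T) :
  realizes F s a -> wpol s a = F.
Proof.
move=> rF; have : exists F : gl_poly K, realizes F s a by exists F.
by move=> /classical_sets.xgetPex-/(_ 0) r; apply: realizes_inj r rF.
Qed.

Definition X0 (T : finType) (s : seq T) (a : {perm T}) : pol_alg K :=
  (gl_subst (wpol s a))`_(rk s a).

Lemma X0P (T : finType) (s : seq T) (a : {perm T}) : uniq s -> stable s a ->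
  exists F : gl_poly K, [/\ realizes F s a, bounded (rk s a) (size s) (gl_subst F)
    & X0 s a = (gl_subst F)`_(rk s a)].
Proof.
move=> us sa; have [F [rF bF]] := realizable K us sa.
by exists F; split=> //; rewrite /X0 (wpolE rF).
Qed.

Lemma X0E (T : finType) (s : seq T) (a : {perm T}) (F : gl_poly K) :
  realizes F s a -> X0 s a = (gl_subst F)`_(rk s a).
Proof. by move=> rF; rewrite /X0 (wpolE rF). Qed.

Lemma X0_filt (T : finType) (s : seq T) (a : {perm T}) : uniq s -> stable s a ->
  poly_filt (size s) (X0 s a).
Proof. by move=> us sa; have [F [_ [_ bF] ->]] := X0P us sa. Qed.

Lemma X0_nil (T : finType) (a : {perm T}) : X0 [::] a = 1.
Proof.
have [f [fE _ _]] := gl_subst_morphism K.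
rewrite (X0E (@realizes_nil K _ a)) fE rmorph1 coef1.
by rewrite (_ : rk _ _ = 0%N) //; apply/eqP; rewrite -leqn0 /rk leq_subr.
Qed.

Lemma X0_cat (T : finType) (s t : seq T) (a : {perm T}) :
  uniq (s ++ t) -> stable s a -> stable t a -> X0 (s ++ t) a = X0 s a * X0 t a.
Proof.
have [f [fE _ _]] := gl_subst_morphism K.
rewrite cat_uniq => /and3P[us dis ut] sa ta.
have [F [rF bF ->]] := X0P us sa; have [G [rG bG ->]] := X0P ut ta.
rewrite (X0E (realizes_cat dis sa ta rF rG)) rk_cat // fE rmorphM -!fE.
exact: (boundedM bF bG).2.
Qed.

Lemma X0_orbit (T : finType) (a : {perm T}) x k : fingraph.order a x = k.+1 ->
  X0 (fingraph.orbit a x) a = pvar K k.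
Proof.
move=> ok; have [f [fE _ fv]] := gl_subst_morphism K.
by rewrite (X0E (realizes_orbit K ok)) (rk_orbit ok) fE fv coefZ coefXn eqxx mulr1.
Qed.

Lemma X0_agree (T : finType) (s : seq T) (a b : {perm T}) : uniq s -> stable s a ->
  {in s, a =1 b} -> X0 s a = X0 s b.
Proof.
move=> us sa ab; have [F [rF _ ->]] := X0P us sa.
have rF' : realizes F s b by move=> n; rewrite rF; apply: eq_wsum.
by rewrite (X0E rF') /rk (cyc_agree sa ab).
Qed.

Lemma cyc_map (T T' : finType) (h : T -> T') (s : seq T) (a : {perm T}) (a' : {perm T'}) :
  injective h -> (forall x, a' (h x) = h (a x)) -> cyc (map h s) a' = cyc s a.
Proof.
move=> hI aa'; rewrite /cyc.
have -> : [set z in map h s] = h @: [set z in s].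
  apply/setP => z; rewrite inE; apply/mapP/imsetP => -[u us ->]; exists u => //.
    by rewrite inE.
  by rewrite inE in us.
rewrite -imset_comp (eq_imset (g := fun x => h @: porbit a x)) => [|x].
  rewrite (imset_comp (fun O : {set T} => h @: O) (porbit a)) card_imset //.
  exact: imset_inj.
have hX i : (a' ^+ i)%g (h x) = h ((a ^+ i)%g x).
  by elim: i => [|i IH]; rewrite ?perm1 // !expgSr !permM IH aa'.
apply/setP => z; apply/porbitP/imsetP => [[i ->]|[u /porbitP[i ->] ->]].
  by exists ((a ^+ i)%g x) => //; apply: mem_porbit.
by exists i.
Qed.

Lemma X0_map (T T' : finType) (h : T -> T') (s : seq T) (a : {perm T}) (a' : {perm T'}) :
  injective h -> (forall x, a' (h x) = h (a x)) -> uniq s -> stable s a ->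
  X0 (map h s) a' = X0 s a.
Proof.
move=> hI aa' us sa; have [F [rF _ ->]] := X0P us sa.
have rF' : realizes F (map h s) a' by apply: realizes_map rF => // ? ? _ _ /hI.
by rewrite (X0E rF') /rk size_map (cyc_map _ hI aa').
Qed.

Lemma X0_catC (T : finType) (s t : seq T) (a : {perm T}) :
  uniq (s ++ t) -> stable (s ++ t) a -> X0 (s ++ t) a = X0 (t ++ s) a.
Proof.
move=> us sa; have [F [rF _ ->]] := X0P us sa.
rewrite (X0E (realizes_catC us sa rF)); congr (_`_ _).
by apply: rk_perm; rewrite perm_catC.
Qed.

(* The only cases in which deleting a point in [wsum_swap] keeps the leading power of N. *)
Definition merging (T : finType) (a : {perm T}) x y : bool :=
  (y \notin porbit a x) || (a x == y).

Lemma X0_swap (T : finType) (s1 s2 : seq T) x y (a : {perm T}) :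
  uniq (s1 ++ x :: y :: s2) -> stable (s1 ++ x :: y :: s2) a ->
  X0 (s1 ++ x :: y :: s2) a = X0 (s1 ++ y :: x :: s2) a
    + X0 (s1 ++ x :: s2) (del y (tperm x y * a)%g) *+ merging a x y
    - X0 (s1 ++ y :: s2) (del x (tperm x y * a)%g) *+ merging a y x.
Proof.
move=> us sa; have pe := perm_adj s1 s2 x y.
have us' : uniq (s1 ++ y :: x :: s2) by rewrite (perm_uniq pe).
have sa' : stable (s1 ++ y :: x :: s2) a by move=> z; rewrite !(perm_mem pe); apply: sa.
have sub (u v : T) : subseq (s1 ++ u :: s2) (s1 ++ u :: v :: s2).
  by apply: cat_subseq => //; rewrite /= eqxx; apply: subseq_cons.
have [xs ys] : x \in s1 ++ x :: y :: s2 /\ y \in s1 ++ x :: y :: s2.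
  by rewrite !mem_cat !inE !eqxx !orbT.
have sc : stable (s1 ++ x :: y :: s2) (tperm x y * a)%g.
  by apply: stableM => //; apply: stable_tperm.
have s1a : stable (s1 ++ x :: s2) (del y (tperm x y * a)%g).
  apply: stable_del sc _ => u.
  by have := @mem_rem_mid _ (rcons s1 x) s2 y u; rewrite !cat_rcons; apply.
have s2a : stable (s1 ++ y :: s2) (del x (tperm x y * a)%g).
  by apply: stable_del sc _ => u; apply: mem_rem_mid.
have [F [rF bF ->]] := X0P us' sa'.
have [F1 [rF1 [z1 _] ->]] := X0P (subseq_uniq (sub x y) us) s1a.
have [F2 [rF2 [z2 _] ->]] := X0P (subseq_uniq (sub y x) us') s2a.
have [f [fE fX fv]] := gl_subst_morphism K.
rewrite (X0E (realizes_swap us rF rF1 rF2))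
  fE rmorphB rmorphD !rmorphM !rmorphXn /= fX -!fE.
(* A rank drop of 2 puts the wanted coefficient beyond the degree bound; a drop of 1 is made up by
   the factor N of the closed loop; a drop of 0 keeps the top coefficient. *)
have coef_step (P : {poly pol_alg K}) r (same next : bool) : (next -> same) ->
    (forall d, (r < d)%N -> P`_d = 0) ->
    (P * 'X^next)`_(r + (if same then if next then 1 else 2 else 0)) =
    P`_r *+ (~~ same || next).
  move=> ns z; rewrite coefMXn; case: next same ns => -[] => [_|/(_ isT)|_|_] //=.
  - by rewrite addn1 subn1.
  - by rewrite subn0 z // addn2.
  by rewrite subn0 addn0.
rewrite coefB coefD; congr (_ + _ - _); first by rewrite (rk_perm _ pe).
  by rewrite (rk_step1 us sa) coef_step //; apply: porbit_next.
rewrite (rk_step2 us sa) coef_step // /merging; first by rewrite porbit_sym.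
by rewrite porbit_sym; apply: porbit_next.
Qed.

(** The lists in the swap recurrence stay nonempty, and a prepended cycle contributes a variable,
    which has no constant term. *)
Lemma X0_counit (T : finType) (s : seq T) (a : {perm T}) : uniq s -> stable s a ->
  poly_counit (X0 s a) = (s == [::])%:R.
Proof.
apply: (stable_seq_ind (P := fun s a => poly_counit (X0 s a) = (s == [::])%:R))
  => {s a} [a|a x s us sa _|s1 x y s2 a us sa].
- by rewrite X0_nil /poly_counit mcoeff1 !eqxx.
- have [k ok] : exists k, fingraph.order a x = k.+1.
    by exists (fingraph.order a x).-1; rewrite prednK ?order_gt0.
  rewrite X0_cat //; last exact: stable_orbit.
  rewrite (X0_orbit ok) /poly_counit.
  apply: etrans ((@mcoeff1g_is_multiplicative _ _).1 _ _) _.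
  by rewrite mcoeffU1 cm1_eq1 mul0r /fingraph.orbit ok.
have ne u v : s1 ++ u :: v != [::] by case: s1 {us sa}.
rewrite !(negPf (ne _ _)) (X0_swap us sa); rewrite /poly_counit.
move: (X0 _ a) (X0 (s1 ++ x :: s2) _) (X0 (s1 ++ y :: s2) _) => A B C eA eB eC.
by rewrite mcoeffB mcoeffD !mcoeffMn eA eB eC !mul0rn addr0 subr0.
Qed.

End LeadingCoefficient.

(** * The coproduct *)

Section TensorMorphisms.
Context (K : fieldType) (G H : conomType).
Implicit Types (u : {malg K[G]}) (v : {malg K[H]}).

Definition tens_l (g : G) : tensor K G H := << (g, mone) >>.
Definition tens_r (h : H) : tensor K G H := << (mone, h) >>.
Definition tens_c (c : K) : tensor K G H := << c *g mone >>.

Lemma malgMU (M : monomType) (c c' : K) (k k' : M) :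
  << c *g k >> * << c' *g k' >> = << c * c' *g mmul k k' >> :> {malg K[M]}.
Proof. by rewrite malgM_def fgmulUU. Qed.

Lemma tens_l_mmorphism : mmorphism tens_l.
Proof. by split=> [x y|] //; rewrite /tens_l malgMU mulr1 [mmul _ _ in RHS]/(pmul _ _)
  /pmul /= mulm1. Qed.
Lemma tens_r_mmorphism : mmorphism tens_r.
Proof. by split=> [x y|] //; rewrite /tens_r malgMU mulr1 [mmul _ _ in RHS]/(pmul _ _)
  /pmul /= mulm1. Qed.
HB.instance Definition _ := isMultiplicative.Build _ _ tens_l tens_l_mmorphism.
HB.instance Definition _ := isMultiplicative.Build _ _ tens_r tens_r_mmorphism.

Lemma tens_c_additive : additive tens_c.
Proof. by move=> a b; rewrite /tens_c monalgUB. Qed.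
Lemma tens_c_multiplicative : multiplicative tens_c.
Proof. by split=> [a b|]; rewrite /tens_c ?malgMU ?mulm1. Qed.
HB.instance Definition _ := GRing.isAdditive.Build _ _ tens_c tens_c_additive.
HB.instance Definition _ := GRing.isMultiplicative.Build _ _ tens_c tens_c_multiplicative.

(** In the monoid algebra of the product monoid a tensor is an ordinary product of two images, so
    bilinearity and multiplicativity of [tens] come from ring morphisms. *)
Lemma tensE (u : {malg K[G]}) (v : {malg K[H]}) :
  tens u v = mmap tens_c tens_l u * mmap tens_c tens_r v.
Proof.
rewrite /tens !mmapE mulr_suml; apply: eq_bigr => g _; rewrite mulr_sumr.
apply: eq_bigr => h _; rewrite /tens_c /tens_l /tens_r !malgMU !mulr1.
by congr << _ *g _ >>; rewrite !mul1m [mmul _ _ in RHS]/(pmul _ _) /pmul /= mulm1 mul1m.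
Qed.

Lemma tensM u v u' v' : tens u v * tens u' v' = tens (u * u') (v * v').
Proof. by rewrite !tensE !rmorphM mulrACA. Qed.

Lemma tensDl u u' v : tens (u + u') v = tens u v + tens u' v :> tensor K G H.
Proof. by rewrite !tensE raddfD mulrDl. Qed.
Lemma tensDr u v v' : tens u (v + v') = tens u v + tens u v' :> tensor K G H.
Proof. by rewrite !tensE raddfD mulrDr. Qed.
Lemma tensBl u u' v : tens (u - u') v = tens u v - tens u' v :> tensor K G H.
Proof. by rewrite !tensE raddfB mulrBl. Qed.
Lemma tensBr u v v' : tens u (v - v') = tens u v - tens u v' :> tensor K G H.
Proof. by rewrite !tensE raddfB mulrBr. Qed.
Lemma tensMnl u v n : tens (u *+ n) v = tens u v *+ n :> tensor K G H.
Proof. by rewrite !tensE raddfMn mulrnAl. Qed.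
Lemma tensMnr u v n : tens u (v *+ n) = tens u v *+ n :> tensor K G H.
Proof. by rewrite !tensE raddfMn mulrnAr. Qed.
Lemma tens11 : tens 1 1 = 1 :> tensor K G H.
Proof. by rewrite tensE !rmorph1 mulr1. Qed.
Lemma tens_combl u u' u'' v m n :
  tens (u + u' *+ m - u'' *+ n) v = tens u v + (tens u' v *+ m - tens u'' v *+ n)
    :> tensor K G H.
Proof. by rewrite tensBl tensDl !tensMnl addrA. Qed.
Lemma tens_combr u v v' v'' m n :
  tens u (v + v' *+ m - v'' *+ n) = tens u v + (tens u v' *+ m - tens u v'' *+ n)
    :> tensor K G H.
Proof. by rewrite tensBr tensDr !tensMnr addrA. Qed.
End TensorMorphisms.

Lemma poly_comult_morphism (K : fieldType) :
  exists f : {rmorphism pol_alg K -> tensor K {cmonom nat} {cmonom nat}},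
  [/\ @poly_comult K =1 f, (forall c u, f (c *: u) = c *: f u) &
    forall k, f (pvar K k) = tens (pvar K k) 1 + tens 1 (pvar K k)].
Proof.
pose v k : tensor K {cmonom nat} {cmonom nat} := tens (pvar K k) 1 + tens 1 (pvar K k).
have vC j k : GRing.comm (v j) (v k) by apply: mulrC.
pose h : {mmorphism {cmonom nat} -> tensor K {cmonom nat} {cmonom nat}} := HB.pack (mpow v)
  (isMultiplicative.Build _ _ (mpow v) (mpow_mmorphism vC)).
exists (mmap (@tens_c K {cmonom nat} {cmonom nat}) h); split=> [u|c u|k].
- by [].
- apply: etrans (mmapZ c u) _; rewrite /= /tens_c malgM_def malgZ_def fgmulUg.
  by apply: eq_bigr => k _; rewrite mul1m.
by apply: etrans (mmapU 1 (ucm k)) _; rewrite /= rmorph1 mul1r mpowU.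
Qed.

(** * Unions of cycles as stable sets *)

Section StableSets.
Context (T : finType).
Implicit Types (a : {perm T}) (A B : {set T}) (s : seq T).

Definition stableb A a : bool := [forall (z | z \in A), a z \in A].

Lemma stablebP A a : reflect (forall z, (a z \in A) = (z \in A)) (stableb A a).
Proof.
apply: (iffP forall_inP) => [h z|h z]; last by rewrite h.
have sA : stable (enum A) a by move=> u; rewrite !mem_enum; apply: h.
by have := stable_perm z sA; rewrite !mem_enum.
Qed.

Lemma stable_filter s A a : stable s a -> stableb A a -> stable [seq z <- s | z \in A] a.
Proof.
by move=> sa /stablebP hA z; rewrite !mem_filter hA => /andP[-> /sa].
Qed.

Lemma stable_filterC s A a : stable s a -> stableb A a ->
  stable [seq z <- s | z \notin A] a.
Proof.
by move=> sa /stablebP hA z; rewrite !mem_filter hA => /andP[-> /sa].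
Qed.

Lemma stable_set_porbit A a x y : stableb A a -> y \in porbit a x -> (y \in A) = (x \in A).
Proof.
move=> /stablebP hA /porbitP[n ->]; elim: n => [|n IH]; first by rewrite perm1.
by rewrite expgSr permM hA.
Qed.

(** A merging step replaces the cycles of [x] and [y] by one cycle through their points other than
    [y], so a set with [x] and [y] on the same side is a union of old cycles exactly when, without
    [y], it is a union of new ones. *)
Lemma stableb_del A a x y : x != y -> merging a x y -> (x \in A) = (y \in A) ->
  stableb (A :\ y) (del y (tperm x y * a)%g) = stableb A a.
Proof.
move=> xy mg xyA; set c := (tperm x y * a)%g.
have tA z : (tperm x y z \in A) = (z \in A) by case: tpermP => [->|->|_ _].
have -> : stableb A a = stableb A c.
  apply/stablebP/stablebP => h z; first by rewrite permM h tA.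
  by have := h (tperm x y z); rewrite permM tpermK tA.
have cy : c y = a x by rewrite permM tpermR.
case/orP: mg => [nyx|/eqP axy]; last first.
  have dc : del y c = c by rewrite /del cy axy tperm1 mulg1.
  rewrite dc; apply/stablebP/stablebP => h z.
    have [->|zy] := eqVneq z y; first by rewrite cy axy.
    have := h z; rewrite !inE zy /=; case: eqVneq => //= czy.
    by case/eqP: zy; apply: (@perm_inj _ c); rewrite czy cy axy.
  rewrite !inE h; congr (~~ _ && _); rewrite -{1}axy -cy.
  by rewrite (inj_eq (@perm_inj _ c)).
set b := del y c.
have axy : a x != y.
  by apply: contraNneq nyx => <-; apply/porbitP; exists 1%N; rewrite expg1.
(* The cycle of [x] under [b] still contains [a x]. *)
have axb : x \in porbit b (a x).
  have step i : (x \in porbit b (a x)) \/ ((a ^+ i)%g (a x) \in porbit b (a x)).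
    elim: i => [|i [IH|IH]]; [by right; rewrite perm1 porbit_id|by left|].
    have [e|zx] := eqVneq ((a ^+ i)%g (a x)) x; first by left; rewrite -{1}e.
    right; rewrite expgSr permM; set z := (a ^+ i)%g (a x) in IH zx *.
    have zp u : u \in porbit a x -> u != y by move=> ux; apply: contraNneq nyx => <-.
    have zo : z \in porbit a x.
      by apply/porbitP; exists i.+1; rewrite expgS permM.
    have zy := zp _ zo.
    have cz : c z = a z by rewrite permM tpermD // eq_sym.
    have az : a z != y.
      by apply: zp; case/porbitP: zo => n ->; rewrite -permM -expgSr mem_porbit.
    have bz : b z = a z by rewrite /b delE // cz (negPf az).
    case/porbitP: IH => n zn; rewrite -bz zn -permM -expgSr; exact: mem_porbit.
  have /porbitP[n xn] : x \in porbit a (a x).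
    by rewrite porbit_sym; apply/porbitP; exists 1%N; rewrite expg1.
  by case: (step n) => //; rewrite -xn.
apply/stablebP/stablebP => h.
  have xax : (x \in A) = (a x \in A).
    have := stable_set_porbit (introT (stablebP _ _) h) axb.
    by rewrite !inE xy axy.
  move=> z; have [->|zy] := eqVneq z y; first by rewrite cy -xax xyA.
  have := h z; rewrite /b delE // !inE zy /=; have [->|czy] := eqVneq (c z) y.
    by rewrite cy axy /= -xax xyA => ->.
  by rewrite czy.
move=> z; have [->|zy] := eqVneq z y; first by rewrite del_self !inE eqxx.
have bzy : b z != y.
  by apply: contraNneq zy => e; apply/eqP/(@perm_inj _ b); rewrite e del_self.
rewrite !inE zy bzy /= /b delE //; have [czy|_] := eqVneq (c z) y; last exact: h.
by rewrite h -(h z) czy.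
Qed.

End StableSets.

(** * Sums over splittings of the cycles into two sides *)

Section Coproduct.
Context (K : fieldType) (G : conomType) (T : finType).
Context (X : seq T -> {perm T} -> {malg K[G]}) (p : nat -> {malg K[G]}).
Implicit Types (a : {perm T}) (A B : {set T}) (s : seq T).
Hypothesis X_nil : forall a, X [::] a = 1.
Hypothesis X_orbit : forall a x k, fingraph.order a x = k.+1 ->
  X (fingraph.orbit a x) a = p k.
Hypothesis X_agree : forall s (a b : {perm T}), uniq s -> stable s a ->
  {in s, a =1 b} -> X s a = X s b.
Hypothesis X_cat : forall s t a, uniq (s ++ t) -> stable s a -> stable t a ->
  X (s ++ t) a = X s a * X t a.
Hypothesis X_swap : forall s1 s2 x y a,
  uniq (s1 ++ x :: y :: s2) -> stable (s1 ++ x :: y :: s2) a ->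
  X (s1 ++ x :: y :: s2) a = X (s1 ++ y :: x :: s2) a
    + X (s1 ++ x :: s2) (del y (tperm x y * a)%g) *+ merging a x y
    - X (s1 ++ y :: s2) (del x (tperm x y * a)%g) *+ merging a y x.

Definition split_term s a A : tensor K G G :=
  tens (X [seq z <- s | z \in A] a) (X [seq z <- s | z \notin A] a).

(** Indexed by unions of cycles instead of sets of cycles: the underlying sets of points remain
    comparable when a swap changes the cycles. The condition [A \subset s] lets each splitting of
    [s] occur once. *)
Definition split_sum s a : tensor K G G :=
  \sum_(A : {set T} | (A \subset s) && stableb A a) split_term s a A.

Lemma split_sum_del s1 s2 x y a : uniq (s1 ++ x :: y :: s2) -> merging a x y ->
  split_sum (s1 ++ x :: s2) (del y (tperm x y * a)%g) =
  \sum_(A : {set T} | [&& A \subset s1 ++ x :: y :: s2, stableb A a & (x \in A)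
    == (y \in A)])
    split_term (s1 ++ x :: s2) (del y (tperm x y * a)%g) A.
Proof.
move=> us mg; have [xy xs1 xs2 ys1 ys2] := uniq_adj us.
(* Inverse to removing [y], on sets having [x] and [y] on the same side. *)
pose ext B := if x \in B then y |: B else B.
have mr z : (z \in s1 ++ x :: s2) = (z \in s1 ++ x :: y :: s2) && (z != y).
  by have := @mem_rem_mid _ (rcons s1 x) s2 y z; rewrite !cat_rcons; apply.
rewrite /split_sum (reindex_onto (fun A => A :\ y) ext) => [|B /andP[/subsetP Bs _]];
  last first.
  have yB : y \notin B by apply/negP => /Bs; rewrite mr eqxx andbF.
  apply/setP => z; rewrite /ext; case: ifP => _; rewrite !inE.
    by have [->|] := eqVneq z y; rewrite ?(negPf yB).
  by have [->|] := eqVneq z y; rewrite ?(negPf yB).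
apply: eq_big => [A|A _].
  have extE : (ext (A :\ y) == A) = ((x \in A) == (y \in A)).
    rewrite /ext !inE xy /=; apply/eqP/eqP => [|xyA].
      by case: ifP => xA /setP/(_ y); rewrite !inE eqxx.
    apply/setP => z; case: ifP => xA; rewrite !inE; have [->|//] := eqVneq z y.
      by rewrite -xyA xA.
    by rewrite -xyA xA.
  rewrite extE andbAC [in RHS]andbA [in RHS]andbAC; case: eqP => [xyA|];
    rewrite ?andbF //= !andbT.
  rewrite stableb_del //; congr (_ && _); apply/subsetP/subsetP => h z.
    move=> zA; have [->|zy] := eqVneq z y; first by rewrite mem_cat !inE eqxx !orbT.
    by have := h z; rewrite mr !inE zy zA => /(_ isT) /andP[].
  by rewrite !inE mr => /andP[-> /h ->].
have ny z : z \in s1 ++ x :: s2 -> (z \in A :\ y) = (z \in A).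
  by rewrite mr !inE => /andP[_ ->].
rewrite /split_term (eq_in_filter ny); congr (tens _ (X _ _)).
by apply: eq_in_filter => z /ny ->.
Qed.

Lemma del_agree a x y s : uniq s -> stable s a -> x \notin s -> y \notin s ->
  X s (del y (tperm x y * a)%g) = X s a.
Proof.
move=> us sa xs ys; apply/esym/X_agree => // z zs.
have [zx zy] : z != x /\ z != y by split; [apply: contraNneq xs|apply: contraNneq ys] => <-.
have azy : a z != y by apply: contraNneq ys => <-; apply: sa.
have cz : (tperm x y * a)%g z = a z by rewrite permM tpermD // eq_sym.
by rewrite delE // cz (negPf azy).
Qed.

(** If [x] and [y] lie on the same side, the recurrence acts there and the other side does not see
    the change ([del_agree]). If they are separated, the swap alters neither filtered list. *)
Lemma split_term_swap s1 s2 x y a A :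
  uniq (s1 ++ x :: y :: s2) -> stable (s1 ++ x :: y :: s2) a -> stableb A a ->
  split_term (s1 ++ x :: y :: s2) a A = split_term (s1 ++ y :: x :: s2) a A
   + (if (x \in A) == (y \in A) then
        split_term (s1 ++ x :: s2) (del y (tperm x y * a)%g) A *+ merging a x y
      - split_term (s1 ++ y :: s2) (del x (tperm x y * a)%g) A *+ merging a y x
      else 0).
Proof.
move=> us sa hA; have uf := filter_uniq _ us.
have := stable_filterC sa hA; have := stable_filter sa hA.
have := uf (fun z => z \notin A); have := uf (mem A); rewrite {uf}.
rewrite /split_term !filter_cat /=.
case: ifP => xA; case: ifP => yA /=; rewrite ?addr0 //.
- move=> u1 u2 t1 t2; rewrite (X_swap u1 t1); apply: etrans (tens_combl _ _ _ _ _ _) _.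
  have [xn yn] : x \notin [seq z <- s1 | z \notin A] ++ [seq z <- s2 | z \notin A] /\
      y \notin [seq z <- s1 | z \notin A] ++ [seq z <- s2 | z \notin A].
    by rewrite !mem_cat !mem_filter xA yA.
  have e1 := del_agree u2 t2 xn yn; have e2 := del_agree u2 t2 yn xn.
  rewrite tpermC in e2. by rewrite e1 e2.
move=> u1 u2 t1 t2; rewrite (X_swap u2 t2); apply: etrans (tens_combr _ _ _ _ _ _) _.
have [xn yn] : x \notin [seq z <- s1 | z \in A] ++ [seq z <- s2 | z \in A] /\
    y \notin [seq z <- s1 | z \in A] ++ [seq z <- s2 | z \in A].
  by rewrite !mem_cat !mem_filter xA yA.
have e1 := del_agree u1 t1 xn yn; have e2 := del_agree u1 t1 yn xn.
rewrite tpermC in e2; by rewrite e1 e2.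
Qed.

(** For a merging correction [split_sum_del] matches the splittings of the smaller permutation with
    those not separating [x] and [y]. Otherwise the common cycle breaks in two and no such matching
    holds, but the coefficient is 0. *)
Lemma split_sum_swap s1 s2 x y a :
  uniq (s1 ++ x :: y :: s2) -> stable (s1 ++ x :: y :: s2) a ->
  split_sum (s1 ++ x :: y :: s2) a = split_sum (s1 ++ y :: x :: s2) a
   + split_sum (s1 ++ x :: s2) (del y (tperm x y * a)%g) *+ merging a x y
   - split_sum (s1 ++ y :: s2) (del x (tperm x y * a)%g) *+ merging a y x.
Proof.
move=> us sa; have pe := perm_adj s1 s2 x y.
have us' : uniq (s1 ++ y :: x :: s2) by rewrite (perm_uniq pe).
have sE A : (A \subset s1 ++ y :: x :: s2) = (A \subset s1 ++ x :: y :: s2).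
  by apply: eq_subset_r => z; rewrite (perm_mem pe).
rewrite {1}/split_sum (eq_bigr _ (fun A hA => split_term_swap us sa (proj2 (andP hA)))).
rewrite big_split -addrA; congr (_ + _).
  by rewrite /split_sum; apply: eq_bigl => A; rewrite sE.
rewrite -big_mkcondr sumrB !sumrMnl; congr (_ - _).
  case: (boolP (merging a x y)) => [mg|_]; rewrite ?mulr0n // !mulr1n split_sum_del //.
  by apply: eq_bigl => A; rewrite andbA.
case: (boolP (merging a y x)) => [mg|_]; rewrite ?mulr0n // !mulr1n.
rewrite [tperm x y]tpermC split_sum_del //.
by apply: eq_bigl => A; rewrite andbA sE [(y \in A) == _]eq_sym.
Qed.

Lemma split_sum_nil a : split_sum [::] a = 1.
Proof.
rewrite /split_sum (big_pred1 set0) => [|A].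
  by rewrite /split_term /= X_nil tens11.
rewrite /=; apply/andP/eqP => [[/subsetP h _]|->].
  by apply/setP => z; rewrite inE; apply/negP => /h.
split; first by apply/subsetP => z; rewrite inE.
by apply/stablebP => z; rewrite !inE.
Qed.

(** A stable set contains the whole orbit or misses it; the two halves of the sum yield the two
    terms of the coproduct of [p k]. *)
Lemma split_sum_orbit a x s k :
  uniq (fingraph.orbit a x ++ s) -> stable s a -> fingraph.order a x = k.+1 ->
  split_sum (fingraph.orbit a x ++ s) a =
  (tens (p k) 1 + tens 1 (p k)) * split_sum s a.
Proof.
set o := fingraph.orbit a x => us sa ok.
have uo : uniq o by apply: orbit_uniq; exact: perm_inj.
have so : stable o a by apply: stable_orbit.
have xo : x \in o by apply: in_orbit.
have dis z : z \in o -> z \notin s.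
  move=> zo; move: us; rewrite cat_uniq => /and3P[_ /hasPn h _].
  by apply/negP => /h; rewrite zo.
have ust : uniq s by move: us; rewrite cat_uniq => /and3P[].
have Xo : X o a = p k by apply: X_orbit.
have fo A : stableb A a -> [seq z <- o | z \in A] = if x \in A then o else [::].
  move=> hA; have zA z : z \in o -> (z \in A) = (x \in A).
    by rewrite mem_orbit_porbit; apply: stable_set_porbit.
  rewrite (eq_in_filter (a2 := fun=> x \in A)) //.
  by case: ifP => _; rewrite ?filter_predT ?filter_pred0.
have foC A : stableb A a -> [seq z <- o | z \notin A] = if x \in A then [::] else o.
  move=> hA; have zA z : z \in o -> (z \in A) = (x \in A).
    by rewrite mem_orbit_porbit; apply: stable_set_porbit.
  rewrite (eq_in_filter (a2 := fun=> x \notin A)) => [|z /zA -> //].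
  by case: (x \in A); rewrite ?filter_predT ?filter_pred0.
have Xc t : uniq t -> stable t a -> {subset t <= s} -> X (o ++ t) a = p k * X t a.
  move=> ut st ts; rewrite X_cat ?Xo // cat_uniq uo ut andbT /=.
  by apply/hasPn => z /ts zs; apply/negP => /dis; rewrite zs.
rewrite mulrDl /split_sum (bigID (fun A => x \in A)) /= !mulr_sumr; congr (_ + _).
  rewrite (reindex_onto (fun B => B :|: [set z in o]) (fun A => A :\: [set z in o]));
    last first.
    move=> A /andP[/andP[_ hA] xA]; apply/setP => z; rewrite !inE.
    case: (boolP (z \in o)) => zo; rewrite ?orbF ?orbT //=.
    by rewrite (stable_set_porbit hA (_ : z \in porbit a x)) // -mem_orbit_porbit.
  have ao z : (a z \in o) = (z \in o) by apply: stable_perm.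
  have PE B : [&& B :|: [set z in o] \subset o ++ s, stableb (B :|: [set z in o]) a
      & x \in B :|: [set z in o]] && ((B :|: [set z in o]) :\: [set z in o] == B) =
      (B \subset s) && stableb B a.
    apply/andP/andP => [[/and3P[/subsetP sub /stablebP st _] /eqP /setP e]|[/subsetP Bs /stablebP st]].
      have Bo z : z \in B -> z \notin o by rewrite -e !inE => /andP[].
      split.
        apply/subsetP => z zB; have := sub z; rewrite !inE zB mem_cat => /(_ isT).
        by rewrite (negPf (Bo _ zB)).
      apply/stablebP => z; have := st z; rewrite -[a z \in B]e -[z \in B]e !inE ao.
      by case: (z \in o); rewrite ?orbT // !orbF.
    have Bo z : z \in B -> z \notin o.
      by move=> zB; apply/negP => /dis; rewrite Bs.
    split; last first.
      apply/eqP/setP => z; rewrite !inE; case: (boolP (z \in o)) => zo; rewrite ?orbF //=.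
      by apply/esym/negP => /Bo; rewrite zo.
    apply/and3P; split; last by rewrite !inE xo orbT.
      by apply/subsetP => z; rewrite !inE mem_cat => /orP[/Bs->|->]; rewrite ?orbT.
    by apply/stablebP => z; rewrite !inE st ao.
  rewrite (eq_bigl (fun B => (B \subset s) && stableb B a)) => [|B];
    last by rewrite -PE andbA.
  apply: eq_bigr => B hB; have := PE B; rewrite hB => /andP[/and3P[_ st xB] _].
  have /andP[/subsetP Bs hB'] := hB.
  rewrite /split_term !filter_cat fo // foC // xB cat0s.
  have sB z : z \in s -> (z \in B :|: [set z in o]) = (z \in B).
    by move=> zs; rewrite !inE (_ : z \in o = false) ?orbF //; apply/negP => /dis;
      rewrite zs.
  have -> : [seq z <- s | z \in B :|: [set z in o]] = [seq z <- s | z \in B].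
    by apply: eq_in_filter => z /sB.
  have -> : [seq z <- s | z \notin B :|: [set z in o]] = [seq z <- s | z \notin B].
    by apply: eq_in_filter => z /sB ->.
  rewrite Xc ?filter_uniq //; [|exact: stable_filter|by move=> z; rewrite mem_filter =>
    /andP[]].
  by rewrite tensM mul1r.
rewrite (eq_bigl (fun B => (B \subset s) && stableb B a)) => [|B]; last first.
  apply/andP/andP => [[/andP[/subsetP sub hB] xB]|[/subsetP Bs hB]]; split => //.
  - apply/subsetP => z zB; have := sub z zB; rewrite mem_cat => /orP[zo|//].
    move: xB; rewrite -(stable_set_porbit hB (_ : z \in porbit a x)) ?zB //.
    by rewrite -mem_orbit_porbit.
  - by rewrite hB andbT; apply/subsetP => z zB; rewrite mem_cat Bs ?orbT.
  by apply/negP => /Bs; apply/negP/dis.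
apply: eq_bigr => B /andP[/subsetP Bs hB].
have xB : x \in B = false by apply/negP => /Bs; apply/negP/dis.
rewrite /split_term !filter_cat fo // foC // xB cat0s.
rewrite [X (o ++ _) a]Xc ?filter_uniq //; [|exact: stable_filterC|by move=> z;
  rewrite mem_filter => /andP[]].
by rewrite tensM mul1r.
Qed.

Lemma comult_split_sum (f : {rmorphism {malg K[G]} -> tensor K G G}) s a :
  (forall k, f (p k) = tens (p k) 1 + tens 1 (p k)) ->
  uniq s -> stable s a -> f (X s a) = split_sum s a.
Proof.
move=> fp.
apply: (stable_seq_ind (P := fun s a => f (X s a) = split_sum s a))
  => {s a} [a|a x s us sa IH|s1 x y s2 a us sa e e1 e2].
- by rewrite X_nil split_sum_nil rmorph1.
- have [k ok] : exists k, fingraph.order a x = k.+1.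
    by exists (fingraph.order a x).-1; rewrite prednK ?order_gt0.
  rewrite (split_sum_orbit us sa ok) X_cat //; last exact: stable_orbit.
  by rewrite (X_orbit ok) rmorphM /= fp IH.
rewrite split_sum_swap // (X_swap us sa) rmorphB rmorphD !rmorphMn /=.
by rewrite e e1 e2.
Qed.

End Coproduct.

(** * The homomorphism on classes *)

Section ClassInvariance.
Context (K : numFieldType).

Lemma stable_enum m (a : 'S_m) : stable (enum 'I_m) a.
Proof. by move=> i _; rewrite mem_enum. Qed.

(** Both uses of [xget] choose from the set of realizing polynomials, which is nonempty and has only
    one element. *)
Lemma w_glE m (a : 'S_m) : w_gl K a = wpol K (enum 'I_m) a.
Proof.
have [F [rF _ _]] := X0P K (enum_uniq 'I_m) (stable_enum a).
rewrite (wpolE rF).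
have : exists F : gl_poly K, forall N, (0 < N)%N -> Ugl_eq (gl_specialize N F)
  (w_glN K N a).
  by exists F; apply/realizes_gl.
by move=> /classical_sets.xgetPex-/(_ 0) /realizes_gl r; apply: realizes_inj r rF.
Qed.

(** The factor N^(c(a) - m) moves degree m - c(a) to degree 0; since c(a) <= m, the integer exponent
    is the natural number [rk]. *)
Lemma X_0E m (a : 'S_m) : X_ K 0 a = X0 K (enum 'I_m) a.
Proof.
rewrite /X_ /prechromatic_coef /X0 -w_glE.
have re : rk (enum 'I_m) a = (m - ncycles a)%N.
  rewrite /rk -cardE card_ord /ncycles cyc_all // => x; exact: mem_enum.
have cm : (ncycles a <= m)%N.
  rewrite -[X in (_ <= X)%N](size_enum_ord m) /ncycles -(@cyc_all _ (enum 'I_m))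
    ?cyc_le // => x.
  exact: mem_enum.
rewrite (_ : _ - _ = Posz (rk (enum 'I_m) a)) // re; lia.
Qed.

(** Turns conjugation by the standard cycle into a rotation of the list of points, to which X_0 is
    insensitive by [X0_catC]. *)
Lemma map_std_cycle_enum m : map (std_cycle m) (enum 'I_m) = rot 1 (enum 'I_m).
Proof.
apply: (inj_map val_inj); rewrite map_rot val_enum_ord -map_comp.
case: m => [|m].
  by apply: size0nil; rewrite size_map size_enum_ord.
rewrite (eq_map (g := (fun i => i.+1 %% m.+1)%N \o val)) => [|i]; last by rewrite /= permE.
have e : iota 0 m.+1 = iota 0 m ++ [:: m] by rewrite -[m.+1]addn1 iotaD.
rewrite map_comp val_enum_ord {1}e map_cat /= modnn.
rewrite /rot /= drop0 take0 -[iota 1 m]/(iota (1 + 0) m) iotaDl.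
congr (_ ++ _); apply/eq_in_map => i; rewrite mem_iota /= add0n => im.
by rewrite modn_small.
Qed.

Lemma enum_ord_cat m n :
  enum 'I_(m + n) = map (lshift n) (enum 'I_m) ++ map (@rshift m n) (enum 'I_n).
Proof.
apply: (inj_map val_inj); rewrite val_enum_ord map_cat -(map_comp val (lshift n))
  -(map_comp val (@rshift m n)) iotaD add0n.
congr (_ ++ _); first by rewrite -(val_enum_ord m); apply: eq_map.
by rewrite -[m in iota m n]addn0 iotaDl -(val_enum_ord n) -map_comp; apply: eq_map.
Qed.

Lemma X_0_conj m (a : 'S_m) : X_ K 0 (a ^ std_cycle m)%g = X_ K 0 a.
Proof.
rewrite (X_0E a) (X_0E (a ^ _)%g); set b := (a ^ _)%g.
have aI : injective (std_cycle m) by apply: perm_inj.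
have ab x : b (std_cycle m x) = std_cycle m (a x) by rewrite permJ.
rewrite -(X0_map K aI ab (enum_uniq _) (stable_enum a)) map_std_cycle_enum.
have := @X0_catC K _ (take 1 (enum 'I_m)) (drop 1 (enum 'I_m)) b.
by rewrite cat_take_drop; apply; [exact: enum_uniq|exact: stable_enum].
Qed.

Lemma X_0_concat m n (a : 'S_m) (b : 'S_n) : X_ K 0 (concat a b) = X_ K 0 a * X_ K 0 b.
Proof.
rewrite (X_0E a) (X_0E b) (X_0E (concat a b)) enum_ord_cat.
have al x : concat a b (lshift n x) = lshift n (a x) by rewrite concat_lshift.
have br x : concat a b (rshift m x) = rshift m (b x) by rewrite concat_rshift.
rewrite -(X0_map K (@lshift_inj m n) al (enum_uniq _) (stable_enum a)).
rewrite -(X0_map K (@rshift_inj m n) br (enum_uniq _) (stable_enum b)).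
apply: X0_cat; first by rewrite -enum_ord_cat enum_uniq.
- by move=> _ /mapP[i _ ->]; rewrite concat_lshift map_f ?mem_enum.
by move=> _ /mapP[i _ ->]; rewrite concat_rshift map_f ?mem_enum.
Qed.

Lemma X_0_equiv a b : rot_equiv a b -> X_ K 0 (tagged a) = X_ K 0 (tagged b).
Proof.
elim=> [a'|a' b' _ ->|a' b' c _ -> _ ->|m a'|a1 a2 b1 b2 _ ea _ eb].
- reflexivity.
- reflexivity.
- reflexivity.
- exact: esym (X_0_conj a').
apply: etrans (X_0_concat (tagged a1) (tagged b1)) _; rewrite ea eb.
exact: esym (X_0_concat (tagged a2) (tagged b2)).
Qed.

Definition X_class (x : rot_class) : pol_alg K := X_ K 0 (tagged (generic_quotient.repr x)).

Lemma X_classE m (a : 'S_m) : X_class (cls a) = X_ K 0 a.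
Proof. exact: X_0_equiv (pclass_repr (mkperm a)). Qed.

Lemma X_class_mmorphism : mmorphism X_class.
Proof.
split=> [x y|].
  rewrite [LHS](X_0_equiv (pclass_repr _)) [LHS]X_0_concat //.
by rewrite [LHS]X_classE X_0E (size0nil (size_enum_ord 0)) X0_nil.
Qed.

Lemma X_class_filt x : poly_filt (class_size x) (X_class x).
Proof.
rewrite /X_class X_0E -[class_size x](size_enum_ord (class_size x)).
by apply: X0_filt; [exact: enum_uniq|exact: stable_enum].
Qed.

Lemma X_class_counit x : poly_counit (X_class x) = (x == class_one)%:R.
Proof.
rewrite /X_class X_0E X0_counit ?enum_uniq //; last exact: stable_enum.
congr (_%:R); rewrite -size_eq0 size_enum_ord -/(class_size x).
by congr nat_of_bool; apply/eqP/eqP => [/class_size0|->] //; apply: class_sizeE.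
Qed.

(** Restriction to a union of cycles removes nothing from the cycles it keeps, so [next] is [a]
    itself and only the renumbering remains. *)
Lemma restr_stable m (a : 'S_m) (U : {set 'I_m}) (i : 'I_#|U|) : stableb U a ->
  enum_val (restr a U i) = a (enum_val i).
Proof.
move=> hU; rewrite permE /restr_ord enum_rankK_in ?restr_fun_stable ?enum_valP //.
have iU := enum_valP i; set x := enum_val i in iU *.
rewrite /restr_fun (eq_in_filter (a2 := predT)) => [|z].
  rewrite filter_predT; have := next_cycle (cycle_orbit (@perm_inj _ a) x) (in_orbit a x).
  by move/eqP.
rewrite mem_orbit_porbit => zx; by rewrite (stable_set_porbit hU zx) iU.
Qed.

Lemma X_0_restr m (a : 'S_m) (U : {set 'I_m}) : stableb U a ->
  X_ K 0 (restr a U) = X0 K [seq z <- enum 'I_m | z \in U] a.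
Proof.
move=> hU; rewrite X_0E -(@X0_map K _ _ enum_val (enum 'I_#|U|) (restr a U) a).
- congr (X0 K _ a); have <- : enum U = filter (mem U) (enum 'I_m)
  by rewrite enumT {1}/enum_mem.
  have [x0 _|U0] := pickP (mem U); last first.
    have c0 : #|U| = 0%N by apply: eq_card0.
    have -> : enum U = [::] by apply: size0nil; rewrite -cardE.
    by apply: size0nil; rewrite size_map size_enum_ord.
  rewrite (eq_map (g := nth x0 (enum U) \o val)) => [|i]; last by rewrite /= -enum_val_nth.
  by rewrite map_comp val_enum_ord cardE -/(mkseq _ _) mkseq_nth.
- exact: enum_val_inj.
- by move=> i; rewrite restr_stable.
- exact: enum_uniq.
exact: stable_enum.
Qed.

Lemma stableb_cover m (a : 'S_m) (I : {set {set 'I_m}}) :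
  I \subset porbits a -> stableb (cover I) a.
Proof.
move=> /subsetP Ia; apply/forall_inP => x /bigcupP[O OI xO].
apply/bigcupP; exists O => //; have /imsetP[y _ Oy] := Ia _ OI.
by move: xO; rewrite Oy => /porbitP[n ->]; rewrite -permM -expgSr mem_porbit.
Qed.

(** [cover] and [orb] are inverse bijections between sets of cycles and stable sets; under them the
    complementary set of cycles becomes the complementary set of points. *)
Lemma split_sum_porbits m (a : 'S_m) :
  split_sum (X0 K (T := 'I_m)) (enum 'I_m) a =
  \sum_(I in powerset (porbits a))
    tens (X_class (restr_cycles a I)) (X_class (restr_cycles a (porbits a :\: I))).
Proof.
rewrite /split_sum; pose orb (A : {set 'I_m}) := [set porbit a x | x in A].
have orbK A : stableb A a -> cover (orb A) = A.
  move=> hA; apply/setP => x; apply/bigcupP/idP => [[_ /imsetP[y yA ->] xy]|xA].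
    by rewrite (stable_set_porbit hA xy).
  by exists (porbit a x); rewrite ?porbit_id ?imset_f.
have coverC (I : {set {set 'I_m}}) : I \subset porbits a -> cover (porbits a :\: I)
  = ~: cover I.
  move=> Ia; apply/setP => x; rewrite inE; apply/bigcupP/negP => [[O]|xI].
    rewrite inE => /andP[OI /imsetP[y _ Oy]] xO /bigcupP[O' O'I xO'].
    have /imsetP[y' _ Oy'] := subsetP Ia _ O'I.
    case/negP: OI; suff -> : O = O' by [].
    rewrite Oy Oy'; move: xO xO'; rewrite Oy Oy' -!eq_porbit_mem => /eqP <- /eqP <- //.
  exists (porbit a x); rewrite ?porbit_id // inE imset_f // andbT.
  by apply/negP => oI; apply: xI; apply/bigcupP; exists (porbit a x); rewrite ?porbit_id.
rewrite (reindex_onto (fun I => cover I) orb) => [|A /andP[_ /orbK //]].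
apply: eq_big => [I|I].
  rewrite powersetE; apply/andP/idP => [[_ /eqP <-]|Ia].
    by apply/subsetP => _ /imsetP[x _ ->]; apply: imset_f.
  split; first by rewrite stableb_cover // andbT; apply/subsetP => x _; rewrite mem_enum.
  apply/eqP/setP => O; apply/imsetP/idP => [[x /bigcupP[O' O'I xO'] ->]|OI].
    have /imsetP[y _ Oy] := subsetP Ia _ O'I.
    by move: xO'; rewrite Oy -eq_porbit_mem => /eqP ->; rewrite -Oy.
  have /imsetP[y _ Oy] := subsetP Ia _ OI.
  by exists y => //; apply/bigcupP; exists O; rewrite // Oy porbit_id.
move=> /andP[_ /eqP eI]; have Ia : I \subset porbits a.
  by rewrite -eI; apply/subsetP => _ /imsetP[x _ ->]; apply: imset_f.
have XJ (J : {set {set 'I_m}}) : stableb (cover J) a ->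
    X_class (restr_cycles a J) = X0 K [seq z <- enum 'I_m | z \in cover J] a.
  by move=> hJ; apply: etrans (X_classE (restr a (cover J))) (X_0_restr hJ).
have hI := stableb_cover Ia; have hC : stableb (cover (porbits a :\: I)) a.
  by apply: stableb_cover; apply: subsetDl.
apply: (congr2 (@tens _ _ _)); apply/esym; first exact: XJ.
apply: etrans (XJ _ hC) _; congr (X0 K _ a).
by apply: eq_filter => z; rewrite coverC // inE.
Qed.

Lemma comult_X_0 m (a : 'S_m) : poly_comult (X_ K 0 a) =
  \sum_(I in powerset (porbits a))
    tens (X_class (restr_cycles a I)) (X_class (restr_cycles a (porbits a :\: I))).
Proof.
have [f [fE _ fp]] := poly_comult_morphism K.
rewrite (X_0E a) fE; apply: etrans _ (split_sum_porbits a).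
have H := @comult_split_sum K {cmonom nat} 'I_m (fun s b => X0 K s b) (pvar K)
  (@X0_nil K _).
have H1 := H (@X0_orbit K _).
have H2 := H1 (@X0_agree K _).
have H3 := H2 (@X0_cat K _).
have H4 := H3 (@X0_swap K _).
have H5 := H4 f (enum 'I_m) a.
have H6 := H5 fp.
have H7 := H6 (enum_uniq _) (stable_enum _).
exact: H7.
Qed.

End ClassInvariance.

(** * Linear extension and the Hopf algebra morphism *)

Section LinearExtension.
Context (K : fieldType) (I : choiceType) (V : lmodType K) (g : I -> V).

(** [tens_map] is an instance by unfolding, and thereby becomes linear, so the coproduct has to be
    compared on classes only. *)
Definition lin_ext (t : {malg K[I]}) : V := \sum_(k <- msupp t) t@_k *: g k.

Lemma lin_extEw (d : {fset I}) t : (msupp t `<=` d)%fset ->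
  lin_ext t = \sum_(k <- d) t@_k *: g k.
Proof.
move=> le; rewrite /lin_ext [LHS](big_fset_incl _ le) //= => x xd /mcoeff_outdom ->.
by rewrite scale0r.
Qed.

Lemma lin_ext_linear : linear lin_ext.
Proof.
move=> c t u; pose d := (msupp t `|` msupp u)%fset.
have td : (msupp t `<=` d)%fset by apply: fsubsetUl.
have ud : (msupp u `<=` d)%fset by apply: fsubsetUr.
have cd : (msupp (c *: t + u) `<=` d)%fset.
  apply: fsubset_trans (msuppD_le _ _) _; apply: fsetSU; exact: msuppZ_le.
rewrite (lin_extEw td) (lin_extEw ud) (lin_extEw cd) scaler_sumr -big_split /=.
by apply: eq_bigr => k _; rewrite mcoeffD mcoeffZ scalerDl scalerA.
Qed.
HB.instance Definition _ := GRing.isLinear.Build K _ _ *:%R lin_ext lin_ext_linear.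

Lemma lin_extU k : lin_ext << k >> = g k.
Proof. by rewrite /lin_ext msuppU oner_eq0 big_seq_fset1 mcoeffUU scale1r. Qed.
End LinearExtension.

Lemma mcoeff_sum (K : fieldType) (I : choiceType) (x : {malg K[I]}) k :
  \sum_(c <- msupp x) x@_c * (c == k)%:R = x@_k.
Proof.
have [xk|xk] := boolP (k \in msupp x).
  rewrite (big_rem k) //= eqxx mulr1 big1_seq ?addr0 // => c /andP[_].
  by rewrite mem_rem_uniq ?fset_uniq // inE => /andP[/negPf-> _]; rewrite mulr0.
rewrite (mcoeff_outdom xk) big1_seq // => c /andP[_ cx].
by case: eqVneq cx xk => [->->|_ _ _] //; rewrite mulr0.
Qed.

Section Homomorphism.
Context (K : numFieldType).

Lemma X_hom_exists : exists f : {lrmorphism rot_alg K -> pol_alg K},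
  forall x, f x = \sum_(c <- msupp x) x@_c *: X_class K c.
Proof.
pose h : {mmorphism rot_class -> pol_alg K} := HB.pack (X_class K)
  (isMultiplicative.Build _ _ (X_class K) (X_class_mmorphism K)).
pose phi : {rmorphism K -> pol_alg K} := @malgC {cmonom nat} K.
pose f0 := mmap phi h.
have f0Z : scalable_for *:%R f0.
  by move=> c u; rewrite /f0 mmapZ /= mul_malgC.
pose f : {lrmorphism rot_alg K -> pol_alg K} := HB.pack f0
  (GRing.isScalable.Build _ _ _ *:%R f0 f0Z).
exists f => x; rewrite /= /f0 mmapE; apply: eq_bigr => c _.
exact: mul_malgC.
Qed.

(** A morphism of bialgebras between Hopf algebras respects the antipodes, so the algebra and
    coalgebra structures suffice. The field has characteristic 0 for the uniqueness of [w_gl]. *)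
Theorem X_0_hopf_morphism : exists f : {lrmorphism rot_alg K -> pol_alg K},
  [/\ forall (m : nat) (a : 'S_m), f << cls a >> = X_ K 0 a,
      coalgebra_morphism f & filtered_morphism f].
Proof.
have [f fE] := X_hom_exists; exists f.
have fU c : f << c >> = X_class K c.
  by rewrite fE msuppU oner_eq0 big_seq_fset1 mcoeffUU scale1r.
split=> [m a||].
- by rewrite fU X_classE.
- split=> x.
    have [g [gE gZ _]] := poly_comult_morphism K.
    pose L := lin_ext (fun k => tens (f << k.1 >>) (f << k.2 >>)).
    have LU k : L << k >> = tens (f << k.1 >>) (f << k.2 >>) by apply: lin_extU.
    have Lc c : L (comult_class K c) = poly_comult (X_class K c).
      apply: etrans _ (esym (comult_X_0 K (tagged (generic_quotient.repr c)))).
      rewrite /comult_class /comult_perm; apply: etrans (linear_sum L _ _ _) _.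
      by apply: eq_bigr => I _; apply: etrans (LU _) _; rewrite !fU.
    have -> : tens_map f f (rot_comult x) = L (rot_comult x) by [].
    rewrite fE gE /rot_comult; apply: etrans (linear_sum L _ _ _) _.
    apply: etrans _ (esym (raddf_sum g _ _ _)); apply: eq_bigr => c _.
    apply: etrans (linearZ_LR L _ _) _; apply: etrans _ (esym (gZ _ _)).
    by apply: (congr1 (fun u => x@_c *: u)); apply: etrans (Lc c) _; apply: gE.
  rewrite fE /rot_counit; apply: etrans (raddf_sum (mcoeff mone) _ _ _) _.
  have cE c : (x@_c *: X_class K c)@_(mone : {cmonom nat}) = x@_c * (c == mone)%:R.
    by rewrite mcoeffZ -[X in _ * X]/(poly_counit (X_class K c)) X_class_counit.
  by apply: etrans (eq_bigr _ (fun c _ => cE c)) _; apply: mcoeff_sum.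
move=> n x xn; rewrite fE big_seq; apply: poly_filt_sum => c cx e.
move/(fsubsetP (msuppZ_le _ _)) => /X_class_filt ec.
exact: leq_trans ec (xn c cx).
Qed.
End Homomorphism.

Theorem theorem3p2 (R : realType) :
  exists f : {lrmorphism rot_alg R[i] -> pol_alg R[i]},
    [/\ forall (m : nat) (a : 'S_m), f << cls a >> = X_ R[i] 0 a,
        coalgebra_morphism f
      & filtered_morphism f].
Proof. exact: X_0_hopf_morphism. Qed.
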